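(* Let $E$ be a solid translation-invariant Banach function space of bounded type on $\mathbb{R}^n$, let $\mathfrak{M},\mathfrak{N}$ be weight sequence systems and let $\mathcal{W},\mathcal{V}$ be weight function systems. Assume that $\mathfrak{M}$ is log-convex and satisfies $[\mathrm{L}]$ and $[\mathrm{I}]$, $\mathfrak{N}$ satisfies $[\mathrm{L}]$ and $[\mathrm{wI}]$, $\mathcal{W}$ satisfies $[\mathrm{M}]$, and $\mathcal{V}$ satisfies $[\mathrm{wM}]$. Suppose that $E^{[\mathfrak{M}]}_{[\mathcal{W}]}\neq\{0\}$. Then the following statements are equivalent: (i) $\mathfrak{M}\,[\subseteq]\,\mathfrak{N}$ and $\mathcal{W}\,[\subseteq]\,\mathcal{V}$. (ii) $E^{[\mathfrak{M}]}_{[\mathcal{W}]}\subseteq E^{[\mathfrak{N}]}_{[\mathcal{V}]}$ as sets. (iii) $E^{[\mathfrak{M}]}_{[\mathcal{W}]}\subseteq E^{[\mathfrak{N}]}_{[\mathcal{V}]}$ and the inclusion map is continuous.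
   Context: Conventions: $\mathbb{N}=\{0,1,2,\dots\}$, $\mathbb{R}_+=(0,\infty)$, $T_xf(t)=f(t-x)$, $B(0,1)=\{x\in\mathbb{R}^n:|x|<1\}$. The symbol $[\,\cdot\,]$ is a common notation for $(\,\cdot\,)$ (Beurling case) and $\{\,\cdot\,\}$ (Roumieu case): the statement is asserted twice, once with all $[\,\cdot\,]$ replaced by $(\,\cdot\,)$ and once with all replaced by $\{\,\cdot\,\}$. Banach function spaces. A Banach space $E$ is a translation-invariant Banach function space (TIBF) of bounded type on $\mathbb{R}^n$ if $E\neq\{0\}$, $E\subseteq L^1_{\mathrm{loc}}(\mathbb{R}^n)$ continuously, $T_xE\subseteq E$ for all $x\in\mathbb{R}^n$, there is $C_0>0$ with $\|T_xf\|_E\le C_0\|f\|_E$ for all $x\in\mathbb{R}^n$, $f\in E$, and $E*C_c(\mathbb{R}^n)\subseteq E$. It is solid if $f\in E$, $g\in L^1_{\mathrm{loc}}(\mathbb{R}^n)$ and $|g|\le|f|$ a.e. imply $g\in E$ and $\|g\|_E\le\|f\|_E$. Weight function systems. A weight function is a continuous $w:\mathbb{R}^n\to[1,\infty)$. A weight function system is a family $\mathcal{W}=\{w^\lambda:\lambda\in\mathbb{R}_+\}$ of weight functions with $w^\lambda\le w^\mu$ pointwise whenever $\mu\le\lambda$ (and $\mathcal{V}=\{v^\lambda:\lambda\in\mathbb{R}_+\}$). Conditions ($\lambda,\mu,\nu$ range over $\mathbb{R}_+$): $(\mathrm{wM})$: $\forall\lambda\,\exists\mu\,\exists C>0\,\forall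 x\in\mathbb{R}^n,y\in B(0,1)$: $w^\lambda(x+y)\le Cw^\mu(x)$. $\{\mathrm{wM}\}$: $\forall\mu\,\exists\lambda\,\exists C>0\,\forall x\in\mathbb{R}^n,y\in B(0,1)$: $w^\lambda(x+y)\le Cw^\mu(x)$. $(\mathrm{M})$: $\forall\lambda\,\exists\mu,\nu\,\exists C>0\,\forall x,y\in\mathbb{R}^n$: $w^\lambda(x+y)\le Cw^\mu(x)w^\nu(y)$. $\{\mathrm{M}\}$: $\forall\mu,\nu\,\exists\lambda\,\exists C>0\,\forall x,y\in\mathbb{R}^n$: $w^\lambda(x+y)\le Cw^\mu(x)w^\nu(y)$. $\mathcal{W}(\subseteq)\mathcal{V}$ means $\forall\lambda\,\exists\mu$: $v^\lambda(t)=O(w^\mu(t))$; $\mathcal{W}\{\subseteq\}\mathcal{V}$ means $\forall\mu\,\exists\lambda$: $v^\lambda(t)=O(w^\mu(t))$. Weight sequence systems. A weight sequence is a family $M=(M_\alpha)_{\alpha\in\mathbb{N}^n}$ of positive numbers with $M_0=1$ and $\lim_{|\alpha|\to\infty}M_\alpha^{1/|\alpha|}=\infty$; it is log-convex if there is a convex $F:[0,\infty)^n\to\mathbb{R}$ with $F(\alpha)=\log M_\alpha$ for all $\alpha\in\mathbb{N}^n$. A weight sequence system is a family $\mathfrak{M}=\{M^\lambda:\lambda\in\mathbb{R}_+\}$ of weight sequences with $M^\lambda_\alpha\le M^\mu_\alpha$ for all $\alpha$ whenever $\lambda\le\mu$ (and $\mathfrak{N}=\{N^\lambda\}$); it is log-convex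 if each $M^\lambda$ is. Conditions: $(\mathrm{L})$: $\forall R>0\,\forall\lambda\,\exists\mu\,\exists C>0\,\forall\alpha$: $R^{|\alpha|}M^\mu_\alpha\le CM^\lambda_\alpha$. $\{\mathrm{L}\}$: $\forall R>0\,\forall\mu\,\exists\lambda\,\exists C>0\,\forall\alpha$: $R^{|\alpha|}M^\mu_\alpha\le CM^\lambda_\alpha$. $(\mathrm{wI})$: $\forall\lambda\,\exists\mu\,\exists H>0\,\forall R>0\,\exists C>0\,\forall\alpha,\beta$: $M^\mu_\alpha R^{|\beta|}\le CH^{|\alpha+\beta|}M^\lambda_{\alpha+\beta}$. $\{\mathrm{wI}\}$: $\forall\mu\,\exists\lambda\,\exists H>0\,\forall R>0\,\exists C>0\,\forall\alpha,\beta$: $M^\mu_\alpha R^{|\beta|}\le CH^{|\alpha+\beta|}M^\lambda_{\alpha+\beta}$. $(\mathrm{I})$: $\forall\lambda\,\exists\mu,\nu\,\exists C,H>0\,\forall\alpha,\beta$: $M^\mu_\alpha M^\nu_\beta\le CH^{|\alpha+\beta|}M^\lambda_{\alpha+\beta}$. $\{\mathrm{I}\}$: $\forall\mu,\nu\,\exists\lambda\,\exists C,H>0\,\forall\alpha,\beta$: $M^\mu_\alpha M^\nu_\beta\le CH^{|\alpha+\beta|}M^\lambda_{\alpha+\beta}$. $\mathfrak{M}(\subseteq)\mathfrak{N}$ means $\forall\lambda\,\exists\mu\,\exists C>0\,\forall\alpha$: $M^\mu_\alpha\le CN^\lambda_\alpha$; $\mathfrak{M}\{\subseteq\}\mathfrak{N}$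 means $\forall\mu\,\exists\lambda\,\exists C>0\,\forall\alpha$: $M^\mu_\alpha\le CN^\lambda_\alpha$. Spaces. For a weight sequence $M$ and a weight function $w$, $E^M_w$ is the Banach space of all $f\in C^\infty(\mathbb{R}^n)$ with $f^{(\alpha)}w\in E$ for all $\alpha\in\mathbb{N}^n$ and $\|f\|_{E,M,w}=\sup_\alpha\|f^{(\alpha)}w\|_E/M_\alpha<\infty$. Then $E^{(\mathfrak{M})}_{(\mathcal{W})}=\varprojlim_{\lambda\to0^+}E^{M^\lambda}_{w^\lambda}$ (intersection over all $\lambda$, projective limit topology) and $E^{\{\mathfrak{M}\}}_{\{\mathcal{W}\}}=\varinjlim_{\lambda\to\infty}E^{M^\lambda}_{w^\lambda}$ (union over all $\lambda$, locally convex inductive limit topology). *)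

(* Defs.v *)
From HB Require Import structures.
From mathcomp Require Import all_boot all_order all_algebra.
From mathcomp Require Import complex.
From mathcomp Require Import all_classical all_reals all_analysis.

Set Implicit Arguments.
Unset Strict Implicit.
Unset Printing Implicit Defensive.

Import Order.TTheory GRing.Theory Num.Theory.
Import numFieldNormedType.Exports.
Import ComplexField.Normc.

Local Open Scope classical_set_scope.
Local Open Scope ring_scope.

(* R^n is 'rV[R]_n.  The library norm on 'rV[R]_n is the sup norm; it induces
   the usual topology, but the Euclidean ball has to be defined. *)
Definition enorm (R : realType) (n : nat) (x : 'rV[R]_n) : R :=
  Num.sqrt (\sum_(i < n) (x ord0 i) ^+ 2).

(* The Borel sigma-algebra of R^n, generated by the coordinate projections. *)
Definition rV_display : measure_display. Proof. exact. Qed.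

Section rV_measurable.
Context {R : realType} (n : nat).

Let coor (i : 'I_n) (x : 'rV[R]_n) : R := x ord0 i.

Let rV_set0 : g_sigma_preimage coor set0.
Proof. exact: sigma_algebra0. Qed.

Let rV_setC A : g_sigma_preimage coor A -> g_sigma_preimage coor (~` A).
Proof. exact: sigma_algebraC. Qed.

Let rV_bigcup (F : nat -> set 'rV[R]_n) :
  (forall i, g_sigma_preimage coor (F i)) ->
  g_sigma_preimage coor (\bigcup_i (F i)).
Proof. exact: sigma_algebra_bigcup. Qed.

HB.instance Definition _ := @isMeasurable.Build rV_display 'rV[R]_n
  (g_sigma_preimage coor) rV_set0 rV_setC rV_bigcup.

Lemma measurable_coor (i : 'I_n) :
  measurable_fun [set: 'rV[R]_n] (fun x : 'rV[R]_n => x ord0 i).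
Proof.
move=> _ Y mY; rewrite setTI; apply: sub_sigma_algebra => /=.
rewrite -bigcup_seq/=; exists i => /=; first by rewrite mem_index_enum.
by exists Y => //; rewrite setTI.
Qed.

Lemma measurable_fun_rV d (T : measurableType d) (f : T -> 'rV[R]_n) :
  (forall i, measurable_fun [set: T] (fun t => f t ord0 i)) ->
  measurable_fun [set: T] f.
Proof.
move=> mf _ A mA; rewrite setTI.
pose G : set (set 'rV[R]_n) := [set B | measurable (f @^-1` B)].
have sG : sigma_algebra setT G.
  split; rewrite /G /=.
  - by rewrite preimage_set0.
  - by move=> B mB; rewrite setTD preimage_setC; exact: measurableC.
  - by move=> F mF; rewrite preimage_bigcup; exact: bigcup_measurable.
have : g_sigma_preimage coor `<=` G; last exact.
apply: smallest_sub => //; rewrite -bigcup_seq/=.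
apply: bigcup_sub => i _ B [C mC <-]; rewrite /G /= setTI.
by rewrite -[X in measurable X]setTI; exact: mf.
Qed.

End rV_measurable.

(* Lebesgue measure on R^n: the n-fold product of Lebesgue measure on R, carried
   to R^(n+1) = R^n x R by appending the last coordinate. *)
Definition rV_rcons (R : realType) (n : nat) (p : 'rV[R]_n * R) : 'rV[R]_n.+1 :=
  \row_(i < n.+1) if unlift ord_max i is Some j then p.1 ord0 j else p.2.

Lemma measurable_rV_rcons (R : realType) (n : nat) :
  measurable_fun [set: 'rV[R]_n * R] (@rV_rcons R n).
Proof.
apply: measurable_fun_rV => i; case: (unliftP ord_max i) => [j ->|->].
  have -> : (fun t : 'rV[R]_n * R => rV_rcons t ord0 (lift ord_max j)) =
      (fun x : 'rV[R]_n => x ord0 j) \o fst.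
    by apply/funext => p; rewrite /= mxE liftK.
  by apply: measurableT_comp; [exact: measurable_coor|exact: measurable_fst].
have -> : (fun t : 'rV[R]_n * R => rV_rcons t ord0 ord_max) = snd.
  by apply/funext => p; rewrite mxE unlift_none.
exact: measurable_snd.
Qed.

Definition lebesgue_succ (R : realType) (n : nat)
    (mu : {measure set 'rV[R]_n -> \bar R}) :
    {measure set 'rV[R]_n.+1 -> \bar R} :=
  @measure_function_pushforward__canonical__measure_function_Measure
   _ _ _ _ _ (mu \x (@lebesgue_measure R))%E _ (@measurable_rV_rcons R n).

Fixpoint lebesgue_rV (R : realType) (n : nat) :
    {measure set 'rV[R]_n -> \bar R} :=
  match n with
  | 0%N => dirac (0 : 'rV[R]_0)
  | m.+1 => lebesgue_succ (lebesgue_rV R m)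
  end.

Section Functions.
Context {R : realType} {n : nat}.
Local Notation mu := (lebesgue_rV R n).
Implicit Types f g : 'rV[R]_n -> R[i].

Definition Repart f : 'rV[R]_n -> R := fun x => complex.Re (f x).
Definition Impart f : 'rV[R]_n -> R := fun x => complex.Im (f x).

Definition ae_eq_cfun f g : Prop := {ae mu, forall x, f x = g x}.

(* L^1_loc(R^n), as a set of functions; classes modulo equality almost
   everywhere are handled through [ae_eq_cfun]. *)
Definition L1loc f : Prop :=
  [/\ measurable_fun [set: 'rV[R]_n] (Repart f),
      measurable_fun [set: 'rV[R]_n] (Impart f) &
      forall K : set 'rV[R]_n, compact K ->
        (\int[mu]_(x in K) (normc (f x))%:E < +oo)%E].

Definition cintegral f : R[i] :=
  Complex (\int[mu]_(x in [set: 'rV[R]_n]) Repart f x)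
          (\int[mu]_(x in [set: 'rV[R]_n]) Impart f x).

Definition convolution f g : 'rV[R]_n -> R[i] :=
  fun x => cintegral (fun t => f (x - t) * g t).

Definition Cc f : Prop :=
  [/\ continuous (Repart f), continuous (Impart f) &
      compact (closure [set x | f x != 0])].

Definition translate (x : 'rV[R]_n) f : 'rV[R]_n -> R[i] := fun t => f (t - x).

Definition partial (i : 'I_n) (h : 'rV[R]_n -> R) : 'rV[R]_n -> R :=
  fun x => 'D_(delta_mx ord0 i) h x.

Definition partials (s : seq 'I_n) (h : 'rV[R]_n -> R) : 'rV[R]_n -> R :=
  foldr partial h s.

Definition smooth (h : 'rV[R]_n -> R) : Prop :=
  forall s : seq 'I_n, continuous (partials s h) /\
    forall (i : 'I_n) (x : 'rV[R]_n),
      derivable (partials s h) x (delta_mx ord0 i).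

Definition csmooth f : Prop := smooth (Repart f) /\ smooth (Impart f).

Definition multi_index := {ffun 'I_n -> nat}.

Definition deg (alpha : multi_index) : nat := (\sum_(i < n) alpha i)%N.

Definition madd (alpha beta : multi_index) : multi_index :=
  [ffun i => (alpha i + beta i)%N].

(* For a smooth h the order of the partial derivatives is irrelevant. *)
Definition mderiv (alpha : multi_index) (h : 'rV[R]_n -> R) : 'rV[R]_n -> R :=
  partials (flatten [seq nseq (alpha i) i | i <- enum 'I_n]) h.

(* R[i] carries no normed R-module structure in the library, hence the
   derivatives of the real and imaginary parts. *)
Definition cderiv (alpha : multi_index) f : 'rV[R]_n -> R[i] :=
  fun x => Complex (mderiv alpha (Repart f) x) (mderiv alpha (Impart f) x).

End Functions.

Arguments multi_index : clear implicits.

(* A space of measurable functions with a norm; [fnorm] is only meaningful on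
   the functions [f] with [E f], which are representatives of classes of functions. *)
Record fspace (R : realType) (n : nat) := FSpace {
  fcar :> ('rV[R]_n -> R[i]) -> Prop;
  fnorm : ('rV[R]_n -> R[i]) -> R
}.

Section BanachFunctionSpaces.
Context {R : realType} {n : nat}.
Local Notation mu := (lebesgue_rV R n).
Variable E : fspace R n.
Local Notation "N[ f ]" := (fnorm E f) (at level 0).

Record is_tibf_bounded_type : Prop := IsTibf {
  tibf_L1loc : forall f, E f -> L1loc f;
  (* E is saturated for equality almost everywhere *)
  tibf_ae : forall f g, E f -> L1loc g -> ae_eq_cfun f g ->
    E g /\ N[g] = N[f];
  tibf_0 : E (cst 0);
  tibf_add : forall f g, E f -> E g -> E (f \+ g);
  tibf_scale : forall (a : R[i]) f, E f -> E (fun x => a * f x);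
  tibf_norm_add : forall f g, E f -> E g ->
    N[f \+ g] <= N[f] + N[g];
  tibf_norm_scale : forall (a : R[i]) f, E f ->
    N[fun x => a * f x] = normc a * N[f];
  tibf_norm_eq0 : forall f, E f -> N[f] = 0 -> ae_eq_cfun f (cst 0);
  tibf_complete : forall u : nat -> 'rV[R]_n -> R[i],
    (forall k, E (u k)) ->
    (forall e : R, 0 < e -> exists k0 : nat, forall j k : nat,
       (k0 <= j)%N -> (k0 <= k)%N -> N[u j \- u k] < e) ->
    exists2 f, E f & (fun k => N[u k \- f]) @ \oo --> (0 : R);
  tibf_neq0 : exists2 f, E f & ~ ae_eq_cfun f (cst 0);
  tibf_cont : forall K : set 'rV[R]_n, compact K ->
    exists C : R, forall f, E f ->
      (\int[mu]_(x in K) (normc (f x))%:E <= (C * N[f])%:E)%E;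
  tibf_translate : forall x f, E f -> E (translate x f);
  tibf_bounded : exists2 C0 : R, 0 < C0 & forall x f, E f ->
    N[translate x f] <= C0 * N[f];
  tibf_convolution : forall f phi, E f -> Cc phi ->
    E (convolution f phi)
}.

Definition solid : Prop := forall f g, E f -> L1loc g ->
  {ae mu, forall x, normc (g x) <= normc (f x)} ->
  E g /\ N[g] <= N[f].

End BanachFunctionSpaces.

(* The two readings of the symbol [.]: (.) and {.} *)
Inductive limit_type := Beurling | Roumieu.

Definition quant (R : realType) (c : limit_type)
    (P : {posnum R} -> {posnum R} -> Prop) : Prop :=
  match c with
  | Beurling => forall lam, exists mu, P lam mu
  | Roumieu => forall mu, exists lam, P lam mu
  end.

Definition quant3 (R : realType) (c : limit_type)
    (P : {posnum R} -> {posnum R} -> {posnum R} -> Prop) : Prop :=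
  match c with
  | Beurling => forall lam, exists mu nu, P lam mu nu
  | Roumieu => forall mu nu, exists lam, P lam mu nu
  end.

Section WeightFunctions.
Context {R : realType} {n : nat}.

Definition is_weight_function (w : 'rV[R]_n -> R) : Prop :=
  continuous w /\ forall x, 1 <= w x.

Record weight_function_system := WeightFunctionSystem {
  wf :> {posnum R} -> 'rV[R]_n -> R;
  wf_weight : forall lam, is_weight_function (wf lam);
  wf_anti : forall lam mu : {posnum R}, mu%:num <= lam%:num ->
    forall x, wf lam x <= wf mu x
}.

Implicit Types W V : weight_function_system.

Definition cond_wM (c : limit_type) W : Prop :=
  quant c (fun lam mu : {posnum R} => exists2 C : R, 0 < C &
    forall x y : 'rV[R]_n, enorm y < 1 -> W lam (x + y) <= C * W mu x).

Definition cond_M (c : limit_type) W : Prop :=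
  quant3 c (fun lam mu nu : {posnum R} => exists2 C : R, 0 < C &
    forall x y : 'rV[R]_n, W lam (x + y) <= C * (W mu x * W nu y)).

(* v^lam(t) = O(w^mu(t)), as a bound over all of R^n; for continuous weights
   with values in [1, oo) this is the same as the bound for large |t|. *)
Definition wf_incl (c : limit_type) W V : Prop :=
  quant c (fun lam mu : {posnum R} => exists2 C : R, 0 < C &
    forall t : 'rV[R]_n, V lam t <= C * W mu t).

End WeightFunctions.
Arguments weight_function_system : clear implicits.

Section WeightSequences.
Context {R : realType} {n : nat}.
Local Notation mi := (multi_index n).

Definition is_weight_sequence (M : mi -> R) : Prop :=
  [/\ forall alpha, 0 < M alpha,
      M [ffun=> 0%N] = 1 &
      forall A : R, exists k : nat, forall alpha : mi, (k <= deg alpha)%N ->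
        A <= M alpha `^ ((deg alpha)%:R^-1)].

Definition log_convex_seq (M : mi -> R) : Prop :=
  exists F : 'rV[R]_n -> R,
    @convex_function R 'rV[R]_n [set x | forall i, 0 <= x ord0 i] F /\
    forall alpha : mi, F (\row_i (alpha i)%:R) = ln (M alpha).

Record weight_sequence_system := WeightSequenceSystem {
  ws :> {posnum R} -> mi -> R;
  ws_weight : forall lam, is_weight_sequence (ws lam);
  ws_mono : forall lam mu : {posnum R}, lam%:num <= mu%:num ->
    forall alpha, ws lam alpha <= ws mu alpha
}.

Implicit Types M N : weight_sequence_system.

Definition log_convex M : Prop := forall lam, log_convex_seq (M lam).

Definition cond_L (c : limit_type) M : Prop :=
  forall r : R, 0 < r ->
  quant c (fun lam mu : {posnum R} => exists2 C : R, 0 < C &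
    forall alpha, r ^+ deg alpha * M mu alpha <= C * M lam alpha).

Definition cond_wI (c : limit_type) M : Prop :=
  quant c (fun lam mu : {posnum R} => exists2 H : R, 0 < H &
    forall r : R, 0 < r -> exists2 C : R, 0 < C &
    forall alpha beta, M mu alpha * r ^+ deg beta <=
      C * H ^+ deg (madd alpha beta) * M lam (madd alpha beta)).

Definition cond_I (c : limit_type) M : Prop :=
  quant3 c (fun lam mu nu : {posnum R} =>
    exists C H : R, [/\ 0 < C, 0 < H &
    forall alpha beta, M mu alpha * M nu beta <=
      C * H ^+ deg (madd alpha beta) * M lam (madd alpha beta)]).

Definition ws_incl (c : limit_type) M N : Prop :=
  quant c (fun lam mu : {posnum R} => exists2 C : R, 0 < C &
    forall alpha, M mu alpha <= C * N lam alpha).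

End WeightSequences.
Arguments weight_sequence_system : clear implicits.

Section Spaces.
Context {R : realType} {n : nat}.
Implicit Types f g : 'rV[R]_n -> R[i].
Implicit Types U O : set ('rV[R]_n -> R[i]).

Section Step.
Variables (E : fspace R n) (M : multi_index n -> R) (w : 'rV[R]_n -> R).

Definition wderiv (alpha : multi_index n) f : 'rV[R]_n -> R[i] :=
  fun x => cderiv alpha f x * (w x)%:C%C.

Definition gs_norm f : \bar R :=
  ereal_sup [set (fnorm E (wderiv alpha f) / M alpha)%:E |
             alpha in [set: multi_index n]].

Definition gs_step : set ('rV[R]_n -> R[i]) :=
  [set f | [/\ csmooth f, forall alpha, E (wderiv alpha f) &
               (gs_norm f < +oo)%E]].

End Step.

Variables (c : limit_type) (E : fspace R n).
Variables (M : weight_sequence_system R n) (W : weight_function_system R n).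
Local Notation Estep lam := (gs_step E (M lam) (W lam)).
Local Notation Enorm lam := (gs_norm E (M lam) (W lam)).

Definition gs_space : set ('rV[R]_n -> R[i]) :=
  match c with
  | Beurling => [set f | forall lam : {posnum R}, Estep lam f]
  | Roumieu => [set f | exists lam : {posnum R}, Estep lam f]
  end.

Definition absolutely_convex U : Prop :=
  U (cst 0) /\ forall (a b : R[i]) f g, normc a + normc b <= 1 ->
    U f -> U g -> U (fun x => a * f x + b * g x).

(* A base of neighbourhoods of 0: for the projective limit topology, the finite
   intersections of balls of the steps; for the locally convex inductive limit
   topology, the absolutely convex sets meeting every step in a neighbourhood
   of 0 of that step. *)
Definition basic_nbhs0 U : Prop :=
  match c with
  | Beurling => exists (s : seq {posnum R}) (e : R), 0 < e /\
      U = [set f | gs_space f /\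
                   forall lam, lam \in s -> (Enorm lam f < e%:E)%E]
  | Roumieu => [/\ U `<=` gs_space, absolutely_convex U &
      forall lam : {posnum R}, exists2 e : R, 0 < e &
        forall f, Estep lam f -> (Enorm lam f < e%:E)%E -> U f]
  end.

Definition gs_open O : Prop :=
  O `<=` gs_space /\
  forall f, O f -> exists2 U, basic_nbhs0 U & forall g, U g -> O (f \+ g).

End Spaces.

Definition continuous_inclusion (R : realType) (n : nat) (c : limit_type)
    (E : fspace R n) (M N : weight_sequence_system R n)
    (W V : weight_function_system R n) : Prop :=
  forall O, gs_open c E N V O -> gs_open c E M W (gs_space c E M W `&` O).

(* Main.v *)
From HB Require Import structures.
Require Import Defs.
From mathcomp Require Import all_boot all_order all_algebra.
From mathcomp Require Import complex.
From mathcomp Require Import all_classical all_reals all_analysis.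
From mathcomp Require Import measurable_realfun.
From mathcomp Require Import ring lra.
Set Implicit Arguments.
Unset Strict Implicit.
Unset Printing Implicit Defensive.
Import Order.TTheory GRing.Theory Num.Theory.
Import numFieldNormedType.Exports.
Import ComplexField.Normc.
Local Open Scope classical_set_scope.
Local Open Scope ring_scope.

(** That the inclusions of the weight systems imply the continuous inclusion of the spaces is a
consequence of the solidity of [E]: a domination of the weights dominates the norms of all
weighted derivatives ([gs_step_mono]).  The converse rests on three ideas.

Uniform boundedness.  If the spaces are included as sets, a family of real functions that is
bounded in the source space is bounded in the target space, as far as local seminorms
are concerned, for which the functions are cut off to a cube ([uniform_local_bound]).  Otherwise
a gliding hump argument yields a series of members of the family
with coefficients [4^-k] that converges in the source space, and whose [k]-th local seminorm is
at least [2^k / 4] ([gliding_hump]).  The sum is smooth and can be differentiated term by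
term, because a Sobolev inequality turns norms of [E] into pointwise bounds ([RE_Sobolev]).

Weight functions.  Up to the sign, some translate of the real or the imaginary part of a nonzero
element of the source space is a function [p] with [p 0 > 0].  By [[M]] the norm of the translate of [p] by [x]
is at most of the order of [w^nu(x)], while by [[wM]] its local seminorm near [x] is at least of
the order of [v^lam(x)].  The uniform bound compares the two ([wf_incl_of_subset]).

Weight sequences.  By [[I]], the product of [p] with a plane wave of frequency [xi] and with a
translate of the function [smear], an average of [p], has a norm of the order of the associated
function [A(xi) = sup |xi^al| / M_al].  Averaging such products over translations, the
factor of the wave becomes the nonnegative function [square], an integral of translates of the
square of [smear]; thus all derivatives of the products of [square] with plane waves are bounded in
terms of [A(xi)] and [N] ([wave_bounded_square]).  The derivative along an axis of the product of
a wave with an average of [square] along this axis is [xi_j] times such a product, up to a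
difference of translates.  After iteration ([wave_bounded_averages]), where [[wI]] and [[L]]
absorb the lower order terms, this gives [|xi^al| <= C A(xi) N_al] for all [xi] and [al].
As [M] is log-convex, for each [al] there is a [xi] such that [A(xi) = xi^al / M_al], namely the
exponential of a subgradient of [log M] at [al] ([log_convex_subgradient]), and so
[M_al <= C N_al]. *)

(** * Partial derivatives on R^n *)

Lemma le_of_eq (d : Order.disp_t) (T : porderType d) (x y : T) : x = y -> (x <= y)%O.
Proof. by move=> ->. Qed.

Section Calculus.
Context {R : realType}.

Local Notation ee i := (delta_mx ord0 i).

Definition cube {n} (r : R) : set 'rV[R]_n :=
  [set x | forall i, `|x ord0 i| <= r].

(** Partial derivatives only depend on the restriction to a line, and so can be
compared across dimensions. *)
Lemma derivable_lineP {m n} (g : 'rV[R]_m -> R) (h : 'rV[R]_n -> R)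
    (x : 'rV[R]_m) (y : 'rV[R]_n) i j :
  (forall t : R, g (x + t *: ee i) = h (y + t *: ee j)) ->
  derivable h y (ee j) ->
  derivable g x (ee i) /\ partial i g x = partial j h y.
Proof.
move=> gh dh.
have E : (fun t : R => t^-1 *: (g (t *: ee i + x) - g x)) =
         (fun t : R => t^-1 *: (h (t *: ee j + y) - h y)).
  apply/funext => t; rewrite [t *: _ + x]addrC [t *: _ + y]addrC gh.
  by have := gh 0; rewrite !scale0r !addr0 => ->.
split; first by rewrite /derivable -/(fun _ => _) E.
by rewrite /partial /derive -/(fun _ => _) E.
Qed.

Context {n : nat}.
Implicit Types (h g : 'rV[R]_n -> R) (x y : 'rV[R]_n) (i j : 'I_n).

Lemma line_is_derive h x i (t : R) : derivable h (x + t *: ee i) (ee i) ->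
  is_derive t 1 (fun s : R => h (x + s *: ee i)) (partial i h (x + t *: ee i)).
Proof.
move=> dh.
have E : (fun s : R => s^-1 *: (h (x + (s *: (1 : R) + t) *: ee i) - h (x + t *: ee i))) =
         (fun s : R => s^-1 *: (h (s *: ee i + (x + t *: ee i)) - h (x + t *: ee i))).
  apply/funext => s; congr (_ *: (h _ - _)).
  by rewrite scalerDl /GRing.scale/= mulr1 addrCA.
split; first by rewrite /derivable /= E; exact: dh.
by rewrite /partial /derive /= E.
Qed.

Lemma is_derive_line h x i (d : R) :
  is_derive (0 : R) 1 (fun s : R => h (x + s *: ee i)) d ->
  derivable h x (ee i) /\ partial i h x = d.
Proof.
move=> [dh <-].
have E : (fun s : R => s^-1 *: (h (x + (s *: (1 : R) + 0) *: ee i) - h (x + 0 *: ee i))) =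
         (fun s : R => s^-1 *: (h (s *: ee i + x) - h x)).
  apply/funext => s; congr (_ *: (h _ - h _)).
    by rewrite addr0 /GRing.scale/= mulr1 addrC.
  by rewrite scale0r addr0.
split; first by move: dh; rewrite /derivable /= E.
by rewrite /partial /derive /= E.
Qed.

Lemma partial_MVT h x i (t : R) : (forall y, derivable h y (ee i)) ->
  exists2 c : R, `|c| <= `|t| &
    h (x + t *: ee i) - h x = partial i h (x + c *: ee i) * t.
Proof.
move=> dh.
pose f s := h (x + s *: ee i); pose df s := partial i h (x + s *: ee i).
have D (s : R) : is_derive s (1 : R) f (df s) by exact: line_is_derive.
have C (a b : R) : {within `[a, b], continuous f}.
  by apply: derivable_within_continuous => s _; have [] := D s.
have f0 : f 0 = h x by rewrite /f scale0r addr0.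
have [t0|t0] := leP 0 t.
  have [c + E] := @MVT_segment _ f df _ _ t0 (fun s _ => D s) (@C _ _).
  rewrite in_itv/= => /andP[c0 ct]; exists c; first by rewrite !ger0_norm.
  by rewrite -f0 -/(f t) E subr0.
have [c + E] := @MVT_segment _ f df _ _ (ltW t0) (fun s _ => D s) (@C _ _).
rewrite in_itv/= => /andP[c0 ct]; exists c.
  by rewrite !ler0_norm ?lerN2// ltW.
by rewrite -f0 -/(f t) -opprB E sub0r mulrN opprK.
Qed.

Lemma in_cubeD (x : 'rV[R]_n) i (a r : R) : cube r x ->
  cube (r + `|a|) (x + a *: ee i).
Proof.
move=> cx k; rewrite !mxE eqxx/=; apply: (le_trans (ler_normD _ _)).
apply: lerD; first exact: cx.
by case: (k == i) => /=; rewrite ?mulr1 ?mulr0 ?normr0.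
Qed.

Lemma cubeP (x : 'rV[R]_n) (r : R) : 0 <= r -> cube r x <-> `|x| <= r.
Proof.
move=> r0; rewrite -[`|x|]/(mx_norm x) mx_normrE; split=> [cx|/bigmax_leP[_ H] i].
  by apply: bigmax_le => [|[a i] _] //=; rewrite ord1; exact: cx.
by have := H (ord0, i) isT.
Qed.

Lemma cube_norm (x : 'rV[R]_n) : cube `|x| x.
Proof. exact/cubeP. Qed.

Lemma cube_le (r s : R) (x : 'rV[R]_n) : r <= s -> cube r x -> cube s x.
Proof. by move=> rs cx i; exact: le_trans (cx i) rs. Qed.

Lemma cubeD (r s : R) (x y : 'rV[R]_n) : cube r x -> cube s y -> cube (r + s) (x + y).
Proof.
by move=> cx cy i; rewrite mxE; apply: (le_trans (ler_normD _ _)); exact: lerD.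
Qed.

Definition locally_bounded (h : 'rV[R]_n -> R) :=
  forall r, exists B, forall x, cube r x -> `|h x| <= B.

Lemma compact_cube (r : R) : compact (@cube n r).
Proof.
have -> : @cube n r = [set v | forall i : 'I_n, `[- r, r]%classic (v ord0 i)].
  apply/seteqP; split=> v /= H i; have := H i; rewrite ler_norml ?in_itv/=; by case/andP => -> ->.
apply: (@rV_compact R n (fun=> `[- r, r]%classic)) => i; exact: segment_compact.
Qed.

Lemma continuous_locally_bounded (h : 'rV[R]_n -> R) : continuous h -> locally_bounded h.
Proof.
move=> ch r.
have /compact_bounded[M [_ HM]] : compact (h @` @cube n r).
  by apply: continuous_compact; [exact: continuous_subspaceT|exact: compact_cube].
exists (M + 1) => x cx; apply: (HM (M + 1)); first by rewrite ltrDl.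
by exists x.
Qed.

(** The increment is split into steps parallel to the axes, and the mean value theorem is
applied to each of them; the factor 3 leaves room for the intermediate points. *)
Lemma partial_Lipschitz h (r B : R) :
  (forall i y, derivable h y (ee i)) ->
  (forall i y, cube (3 * r) y -> `|partial i h y| <= B) ->
  forall x y, cube r x -> cube r y -> `|h y - h x| <= B * \sum_i `|y ord0 i - x ord0 i|.
Proof.
move=> dh bh x y cx cy.
pose z (k : nat) : 'rV[R]_n := \row_i (if (i < k)%N then y ord0 i else x ord0 i).
have z0 : z 0%N = x by apply/rowP => i; rewrite mxE ltn0.
have zn : z n = y by apply/rowP => i; rewrite mxE ltn_ord.
suff H k : (k <= n)%N -> `|h (z k) - h x| <=
    B * \sum_(i < n | (i < k)%N) `|y ord0 i - x ord0 i|.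
  by rewrite -{1}zn; have := H n (leqnn n); rewrite (eq_bigl xpredT)// => i; rewrite ltn_ord.
elim: k => [_|k IH kn].
  by rewrite z0 subrr normr0 big_pred0 ?mulr0// => i; rewrite ltn0.
pose j := Ordinal kn.
have zS : z k.+1 = z k + (y ord0 j - x ord0 j) *: ee j.
  apply/rowP => i; rewrite !mxE eqxx/= ltnS leq_eqVlt.
  have [ik|ik] := eqVneq (i : nat) k => /=.
    have -> : i = j by apply/val_inj.
    by rewrite eqxx ltnn mulr1 addrCA subrr addr0.
  have /negbTE -> : i != j by apply: contra ik => /eqP ->.
  by rewrite mulr0 addr0.
have [c c1 E] := @partial_MVT h (z k) j (y ord0 j - x ord0 j) (dh j).
have -> : h (z k.+1) - h x = (h (z k.+1) - h (z k)) + (h (z k) - h x) by rewrite addrA subrK.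
apply: (le_trans (ler_normD _ _)).
rewrite (bigD1 j)//= mulrDr; apply: lerD.
  rewrite zS E normrM ler_wpM2r//; apply: bh.
  have -> : 3 * r = r + (r + r) by ring.
  apply: (@cube_le (r + `|c|)).
    rewrite lerD2l (le_trans c1)// (le_trans (ler_normB _ _))// lerD//.
  apply: in_cubeD => i; rewrite mxE; by case: ifP.
rewrite (eq_bigl (fun i : 'I_n => (i < k)%N)); first exact/IH/ltnW.
move=> i; rewrite ltnS leq_eqVlt -(inj_eq val_inj) /=.
by have [->|] := eqVneq (i : nat) k; rewrite ?ltnn ?andbT.
Qed.

Lemma continuous_bounded_partials h :
  (forall i y, derivable h y (ee i)) ->
  (forall i, locally_bounded (partial i h)) -> continuous h.
Proof.
move=> dh bh x.
have [B HB] : exists B, forall i y, cube (3 * (`|x| + 1)) y -> `|partial i h y| <= B.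
  have /choice[f Hf] : forall i, exists B, forall y, cube (3 * (`|x| + 1)) y -> `|partial i h y| <= B.
    by move=> i; exact: bh.
  exists (\sum_i `|f i|) => i y cy; apply: (le_trans (Hf i y cy)).
  rewrite (bigD1 i)//= (le_trans (ler_norm _))// lerDl; exact: sumr_ge0.
pose C := `|B| * n%:R + 1.
have C0 : 0 < C by rewrite ltr_wpDl// mulr_ge0.
apply/(@cvgrPdist_le _ _ _ (nbhs x) (@nbhs_filter _ x)) => e e0.
have d0 : 0 < Num.min 1 (e / C) by rewrite lt_min ltr01 divr_gt0.
apply: (@filterS _ (nbhs x) (@nbhs_filter _ x) _ _ _ (nbhsx_ballx x _ d0)) => y.
rewrite -ball_normE /= lt_min => /andP[/ltW yx /ltW yx'].
have cx : cube (`|x| + 1) x by apply: (cube_le _ (cube_norm x)); rewrite lerDl.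
have cy : cube (`|x| + 1) y.
  apply: (cube_le _ (cube_norm y)).
  rewrite -[X in `|X|](subrK x) addrC (le_trans (ler_normD _ _))// lerD2l distrC//.
have := @partial_Lipschitz h _ _ dh HB y x cy cx.
move/le_trans; apply.
have H i : `|x ord0 i - y ord0 i| <= e / C.
  by have := cube_norm (x - y) i; rewrite !mxE => /le_trans; apply.
apply: (@le_trans _ _ (`|B| * \sum_i `|x ord0 i - y ord0 i|)).
  by rewrite ler_wpM2r ?ler_norm// sumr_ge0.
apply: (@le_trans _ _ (`|B| * \sum_(i < n) (e / C))).
  by rewrite ler_wpM2l//; exact: ler_sum.
have -> : `|B| * \sum_(i < n) (e / C) = e * (`|B| * n%:R / C).
  by rewrite sumr_const card_ord -mulr_natr; ring.
by apply: ler_piMr; [exact: ltW | rewrite ler_pdivrMr// mul1r lerDl].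
Qed.

(** ** Smooth functions *)

(** Smoothness of order [k], which peels off the innermost derivative first, so that
closure properties follow by induction on [k]. *)
Fixpoint smooth_upto (k : nat) h : Prop :=
  continuous h /\ match k with
  | 0%N => True
  | m.+1 => forall i, (forall x, derivable h x (ee i)) /\ smooth_upto m (partial i h)
  end.

Lemma partials_rcons (s : seq 'I_n) i h :
  partials (rcons s i) h = partials s (partial i h).
Proof. by rewrite /partials foldr_rcons. Qed.

Lemma partials_cat (s t : seq 'I_n) h : partials (s ++ t) h = partials s (partials t h).
Proof. by rewrite /partials foldr_cat. Qed.

Lemma smooth_partials s h : smooth h -> smooth (partials s h).
Proof. by move=> sh t; rewrite -partials_cat; exact: sh. Qed.

Lemma smooth_partial i h : smooth h -> smooth (partial i h).
Proof. exact: (@smooth_partials [:: i]). Qed.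

Lemma smooth_derivable h i x : smooth h -> derivable h x (ee i).
Proof. by move=> /(_ [::])[_]; exact. Qed.

Lemma smooth_continuous h : smooth h -> continuous h.
Proof. by move=> /(_ [::])[]. Qed.

Lemma smooth_uptoP h : smooth h <-> forall k, smooth_upto k h.
Proof.
split=> [sh k|H s].
  elim: k h sh => [|k IH] h sh /=; split=> //; try exact: smooth_continuous.
  move=> i; split=> [x|]; first exact: smooth_derivable.
  exact/IH/smooth_partial.
have {H} := H (size s).+1.
elim/last_ind: s h => [|s i IH] h.
  by move=> [ch H]; split=> // i x; have [] := H i.
rewrite size_rcons partials_rcons => -[_ /(_ i)[_ H]].
exact: IH.
Qed.

(** Local bounds suffice: those for the derivatives of the next order give continuity. *)
Lemma smooth_bounded h : (forall s i x, derivable (partials s h) x (ee i)) ->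
  (forall s, locally_bounded (partials s h)) -> smooth h.
Proof.
move=> dh bh s; split=> [|i x]; last exact: dh.
apply: continuous_bounded_partials => [i y|i]; first exact: dh.
exact: (bh (i :: s)).
Qed.

Lemma smooth_locally_bounded s h : smooth h -> locally_bounded (partials s h).
Proof. by move=> sh; apply/continuous_locally_bounded; have [] := sh s. Qed.

Lemma partialD i h g x : derivable h x (ee i) -> derivable g x (ee i) ->
  partial i (h \+ g) x = partial i h x + partial i g x.
Proof. exact: deriveD. Qed.

Lemma partialM i h g x : derivable h x (ee i) -> derivable g x (ee i) ->
  partial i (h \* g) x = partial i h x * g x + h x * partial i g x.
Proof.
move=> dh dg; rewrite /partial [LHS](deriveM dh dg) addrC.
by rewrite /GRing.scale/= [g x * _]mulrC.
Qed.

Lemma smooth_uptoW k h : smooth_upto k.+1 h -> smooth_upto k h.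
Proof.
elim: k h => [|k IH] h /= [ch H]; split=> // i.
by have [dh sh] := H i; split=> //; apply: IH.
Qed.

Lemma smooth_uptoD k h g : smooth_upto k h -> smooth_upto k g -> smooth_upto k (h \+ g).
Proof.
elim: k h g => [|k IH] h g /= [ch H] [cg G]; split=> //.
1,2: by move=> x; apply: (@continuousD _ _ _ h g); [exact: ch|exact: cg].
move=> i; have [dh sh] := H i; have [dg sg] := G i; split=> [x|].
  exact: derivableD.
have -> : partial i (h \+ g) = partial i h \+ partial i g.
  by apply/funext => x; exact: partialD.
exact: IH.
Qed.

Lemma smooth_uptoM k h g : smooth_upto k h -> smooth_upto k g -> smooth_upto k (h \* g).
Proof.
elim: k h g => [|k IH] h g.
  move=> [ch _] [cg _]; split=> // x.
  by apply: (@continuousM _ _ h g); [exact: ch|exact: cg].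
move=> Hh Hg; have := smooth_uptoW Hh; have := smooth_uptoW Hg => Wg Wh.
move: Hh Hg => /= [ch H] [cg G]; split=> // [x|].
  by apply: (@continuousM _ _ h g); [exact: ch|exact: cg].
move=> i; have [dh sh] := H i; have [dg sg] := G i; split=> [x|].
  exact: derivableM.
have -> : partial i (h \* g) = (partial i h \* g) \+ (h \* partial i g).
  by apply/funext => x; exact: partialM.
apply: smooth_uptoD; first exact: IH.
exact: IH.
Qed.

Lemma smoothD h g : smooth h -> smooth g -> smooth (h \+ g).
Proof.
move=> /smooth_uptoP H /smooth_uptoP G; apply/smooth_uptoP => k.
exact: smooth_uptoD.
Qed.

Lemma smoothM h g : smooth h -> smooth g -> smooth (h \* g).
Proof.
move=> /smooth_uptoP H /smooth_uptoP G; apply/smooth_uptoP => k.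
exact: smooth_uptoM.
Qed.

Lemma partial_cst i (a : R) : partial i (cst a : 'rV[R]_n -> R) = cst 0.
Proof. by apply/funext => x; rewrite /partial derive_cst. Qed.

Lemma smooth_cst (a : R) : smooth (cst a : 'rV[R]_n -> R).
Proof.
apply/smooth_uptoP => k; elim: k a => [|k IH] a /=; split=> //; try exact: cst_continuous.
move=> i; split=> [x|]; first exact: derivable_cst.
by rewrite partial_cst.
Qed.

Lemma smoothZ (a : R) h : smooth h -> smooth (fun x => a * h x).
Proof. by move=> sh; exact: (smoothM (smooth_cst a) sh). Qed.

Lemma partialsD s h g : smooth h -> smooth g ->
  partials s (h \+ g) = partials s h \+ partials s g.
Proof.
move=> sh sg; elim: s => //= i s ->; apply/funext => x.
by rewrite partialD//; apply: smooth_derivable; exact: smooth_partials.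
Qed.

Lemma partialsZ s (a : R) h : smooth h ->
  partials s (fun x => a * h x) = (fun x => a * partials s h x).
Proof.
move=> sh; elim: s => //= i s ->; apply/funext => x.
rewrite (@partialM i (cst a) (partials s h))//; last first.
  by apply: smooth_derivable; exact: smooth_partials.
by rewrite partial_cst mul0r add0r.
Qed.

Lemma partialsB s h g : smooth h -> smooth g ->
  partials s (h \- g) = partials s h \- partials s g.
Proof.
move=> sh sg; have E f : (fun x => - f x) = (fun x : 'rV[R]_n => -1 * f x :> R).
  by apply/funext => x; rewrite mulN1r.
rewrite (_ : h \- g = h \+ (fun x => -1 * g x)); last first.
  by apply/funext => x /=; rewrite mulN1r.
rewrite (partialsD s sh (smoothZ (-1) sg)).
by rewrite partialsZ//; apply/funext => x /=; rewrite mulN1r.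
Qed.

Lemma smoothB h g : smooth h -> smooth g -> smooth (h \- g).
Proof.
move=> sh sg; rewrite (_ : h \- g = h \+ (fun x => -1 * g x)); last first.
  by apply/funext => x /=; rewrite mulN1r.
exact: (smoothD sh (smoothZ (-1) sg)).
Qed.

Lemma partial_shift i h (a x : 'rV[R]_n) : derivable h (x + a) (ee i) ->
  derivable (fun y => h (y + a)) x (ee i) /\
  partial i (fun y => h (y + a)) x = partial i h (x + a).
Proof.
by move=> dh; apply: derivable_lineP dh => t; rewrite addrAC.
Qed.

Lemma partials_shift s h (a : 'rV[R]_n) : smooth h ->
  partials s (fun y => h (y + a)) = (fun y => partials s h (y + a)).
Proof.
move=> sh; elim: s => //= i s ->; apply/funext => x.
have [|_ ->//] := @partial_shift i (partials s h) a x.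
by apply: smooth_derivable; exact: smooth_partials.
Qed.

Lemma continuous_shift h (a : 'rV[R]_n) : continuous h -> continuous (fun y => h (y + a)).
Proof.
move=> ch x; apply: (@continuous_comp _ _ _ (fun y => y + a) h); last exact: ch.
apply: (@continuousD _ _ _ id (cst a)); last exact: cst_continuous.
exact: (@cvg_id _ (nbhs x)).
Qed.

Lemma smooth_shift h (a : 'rV[R]_n) : smooth h -> smooth (fun y => h (y + a)).
Proof.
move=> sh s; rewrite partials_shift//; split.
  by apply: continuous_shift; have [] := sh s.
move=> i x; have [|//] := @partial_shift i (partials s h) a x.
by have [_] := sh s; exact.
Qed.

End Calculus.
Arguments smooth_derivable {R n h} i x _.

(** * Symmetry of mixed partial derivatives *)

Section Schwarz.
Context {R : realType} {n : nat}.
Local Notation ee i := (delta_mx ord0 i).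
Implicit Types (h g : 'rV[R]_n -> R) (x y : 'rV[R]_n) (i j : 'I_n).

Lemma continuous_cubeP h x (e : R) : continuous h -> 0 < e ->
  exists2 d : R, 0 < d & forall y, cube d y -> `|h x - h (x + y)| < e.
Proof.
move=> ch e0.
have /(@cvgrPdist_lt _ _ _ (nbhs x) (@nbhs_filter _ x)) /(_ e e0) := ch x.
move=> /nbhs_ballP[d /= d0 H]; exists (d / 2); first by rewrite divr_gt0.
move=> y cy; apply: (H (x + y)); rewrite -ball_normE /= opprD addNKr normrN.
have d2 : 0 <= d / 2 by rewrite divr_ge0// ltW.
by apply: (le_lt_trans (proj1 (cubeP _ d2) cy)); rewrite ltr_pdivrMr// ltr_pMr// ltr1n.
Qed.

(** The mean value theorem is applied to the difference of [h] in the direction [j], and then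
to the derivative [partial i h]. *)
Lemma second_difference h x i j (t : R) : smooth h ->
  exists c c' : R, [/\ `|c| <= `|t|, `|c'| <= `|t| &
    h (x + t *: ee i + t *: ee j) - h (x + t *: ee i) - h (x + t *: ee j) + h x =
    t * t * partial j (partial i h) (x + c *: ee i + c' *: ee j)].
Proof.
move=> sh.
pose g y := h (y + t *: ee j) - h y.
have dg y : derivable g y (ee i) /\
    partial i g y = partial i h (y + t *: ee j) - partial i h y.
  have [d1 d2] := @partial_shift R n i h (t *: ee j) y (smooth_derivable _ _ sh).
  have d3 := smooth_derivable i y sh.
  split; first exact: (derivableB d1 d3).
  by rewrite -d2; exact: (deriveB d1 d3).
have [c c1 E] := @partial_MVT R n g x i t (fun y => proj1 (dg y)).
have [c' c2 E'] := @partial_MVT R n (partial i h) (x + c *: ee i) j t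
  (fun y => smooth_derivable j y (smooth_partial i sh)).
exists c, c'; split => //.
rewrite (_ : t * t * _ = partial j (partial i h) (x + c *: ee i + c' *: ee j) * t * t).
  by rewrite -E' -(proj2 (dg _)) -E /g; ring.
by ring.
Qed.

Lemma normrM_bool (a : R) (b : bool) : `|a * b%:R| <= `|a|.
Proof. by case: b; rewrite ?mulr1// mulr0 normr0. Qed.

Lemma continuous_eq_near (A B : 'rV[R]_n -> R) x : continuous A -> continuous B ->
  (forall d : R, 0 < d -> exists p q, [/\ cube d p, cube d q & A (x + p) = B (x + q)]) ->
  A x = B x.
Proof.
move=> cA cB H; apply/eqP; rewrite -subr_eq0 -normr_le0 leNgt; apply/negP => e0.
have e2 : 0 < `|A x - B x| / 2 by rewrite divr_gt0.
have [d1 d10 H1] := continuous_cubeP x cA e2.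
have [d2 d20 H2] := continuous_cubeP x cB e2.
have d0 : 0 < Num.min d1 d2 by rewrite lt_min d10.
have [p [q [cp cq]]] := H _ d0.
have {H1} := H1 p (cube_le _ cp); rewrite ge_min lexx => /(_ isT).
have {H2} := H2 q (cube_le _ cq); rewrite ge_min lexx orbT => /(_ isT).
move: (A (x + p)) (B (x + q)) => u v Q2 Q1 uv; move: Q1; rewrite uv => Q1.
rewrite distrC in Q2.
by have := le_lt_trans (ler_distD v _ _) (ltrD Q1 Q2); rewrite -splitr ltxx.
Qed.

(** Both sides are limits of the same second difference quotient. *)
Lemma partialC h i j x : smooth h -> partial i (partial j h) x = partial j (partial i h) x.
Proof.
move=> sh.
have c1 : continuous (partial i (partial j h)).
  by apply: smooth_continuous; apply/smooth_partial/smooth_partial.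
have c2 : continuous (partial j (partial i h)).
  by apply: smooth_continuous; apply/smooth_partial/smooth_partial.
apply: (continuous_eq_near c1 c2) => d d0.
pose t := d / 2.
have t0 : 0 < t by rewrite divr_gt0.
have dt : d = t + t by rewrite /t; field.
clearbody t.
have [a [a' [ha ha' E]]] := @second_difference h x i j t sh.
have [b [b' [hb hb' E']]] := @second_difference h x j i t sh.
have tt : t * t != 0 by rewrite mulf_neq0// gt_eqF.
have small k l (u v : R) : `|u| <= `|t| -> `|v| <= `|t| ->
    cube d (u *: ee k + v *: ee l : 'rV[R]_n).
  rewrite (gtr0_norm t0) dt => hu hv.
  by apply: cubeD => p; rewrite !mxE eqxx /=; exact: (le_trans (normrM_bool _ _)).
exists (b *: ee j + b' *: ee i), (a *: ee i + a' *: ee j).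
split; [exact: small|exact: small|].
rewrite [X in _ X = _]addrA [X in _ = _ X]addrA.
apply: (mulfI tt); apply: (etrans (esym E')); apply: (etrans _ E).
by rewrite [x + _ *: _ + t *: _ in RHS]addrAC; ring.
Qed.

Lemma perm_partials h (s t : seq 'I_n) : smooth h -> perm_eq s t ->
  partials s h = partials t h.
Proof.
move=> sh; elim: s t => [|i s IH] t; first by rewrite perm_sym => /perm_nilP ->.
move=> st; have it : i \in t by rewrite -(perm_mem st) inE eqxx.
move: st; case/splitPr: it => t1 t2.
rewrite perm_sym -cat1s perm_catCA /= perm_cons perm_sym => /IH -> /=.
elim: t1 => //= j t1 <-; apply/funext => x.
exact: (partialC _ _ _ (smooth_partials _ sh)).
Qed.

(** Derivatives are indexed by lists, which allow induction; a multi-index records the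
multiplicities in a list. *)
Definition mindex (s : seq 'I_n) : multi_index n := [ffun i => count_mem i s].

Definition mlist (alpha : multi_index n) : seq 'I_n :=
  flatten [seq nseq (alpha i) i | i <- enum 'I_n].

Lemma mlistK alpha : mindex (mlist alpha) = alpha.
Proof.
apply/ffunP => i; rewrite ffunE /mlist count_flatten -map_comp sumnE big_map big_enum /=.
rewrite (bigD1 i)//= count_nseq /= eqxx mul1n big1 ?addn0// => j /negbTE ji.
by rewrite count_nseq /= ji.
Qed.

Lemma deg_mindex s : deg (mindex s) = size s.
Proof.
rewrite /deg; elim: s => [|i s IH]; first by rewrite big1// => i _; rewrite ffunE.
under eq_bigr do rewrite ffunE /=.
rewrite big_split/= -add1n; congr (_ + _)%N.
  by rewrite (bigD1 i)//= eqxx big1// => j /negbTE; rewrite eq_sym => ->.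
by rewrite -[RHS]IH; apply: eq_bigr => j _; rewrite ffunE.
Qed.

Lemma mindex_cat s t : mindex (s ++ t) = madd (mindex s) (mindex t).
Proof. by apply/ffunP => i; rewrite !ffunE count_cat. Qed.

Lemma mindex_perm s t : mindex s = mindex t -> perm_eq s t.
Proof.
move=> E; apply/allP => i _ /=; move/ffunP: E => /(_ i).
by rewrite !ffunE => ->.
Qed.

Lemma perm_mindex s t : perm_eq s t -> mindex s = mindex t.
Proof. by move=> /permP E; apply/ffunP => i; rewrite !ffunE E. Qed.

Lemma mderivE s h : smooth h -> mderiv (mindex s) h = partials s h.
Proof. by move=> sh; apply: perm_partials => //; apply: mindex_perm; rewrite mlistK. Qed.

(** ** Plane waves *)

Definition wave (xi : 'I_n -> R) (th : R) x : R := cos (\sum_i xi i * x ord0 i + th).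

Lemma wave_shift xi th x y :
  wave xi th (x + y) = wave xi (th + \sum_i xi i * y ord0 i) x.
Proof.
rewrite /wave; congr cos; under eq_bigr do rewrite mxE mulrDr.
by rewrite big_split/= -addrA [_ + th]addrC.
Qed.

Lemma sum_delta (xi : 'I_n -> R) i (s : R) :
  \sum_k xi k * (s *: (ee i : 'rV[R]_n)) ord0 k = s * xi i.
Proof.
rewrite (bigD1 i)//= big1 => [|k /negbTE ki]; rewrite !mxE ?ki ?eqxx /=.
  by rewrite mulr1 addr0 mulrC.
by rewrite !mulr0.
Qed.

Lemma is_derive_affine (a b x : R) : is_derive x (1 : R) (fun s : R => s * a + b) a.
Proof.
rewrite (_ : (fun s => _) = (a \*: id) + cst b); last first.
  by apply/funext => s; rewrite fctE /GRing.scale /= mulrC.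
apply: is_derive_eq.
by rewrite /GRing.scale /= mulr1 addr0.
Qed.

Lemma wave_partial xi th i x : derivable (wave xi th) x (ee i) /\
  partial i (wave xi th) x = xi i * wave xi (th + pi / 2) x.
Proof.
apply: is_derive_line.
have E : (fun s : R => wave xi th (x + s *: ee i)) =
   cos \o (fun s : R => s * xi i + (\sum_k xi k * x ord0 k + th)).
  apply/funext => s /=; rewrite wave_shift /wave; congr cos.
  by rewrite sum_delta addrA addrC.
rewrite E.
have D : is_derive (0 : R) (1 : R) (fun s : R => s * xi i + (\sum_k xi k * x ord0 k + th)) (xi i).
  exact: is_derive_affine.
set gg := (fun s : R => _) in D *.
have D' := is_derive_cos (gg 0).
have := is_derive1_comp D' D.
rewrite (_ : - sin (gg 0) * xi i = xi i * wave xi (th + pi / 2) x)//.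
by rewrite /gg mul0r add0r mulrC /wave addrA cosDpihalf.
Qed.

Lemma smooth_wave xi th : smooth (wave xi th).
Proof.
apply/smooth_uptoP => k.
have c t : continuous (wave xi t).
  apply: continuous_bounded_partials => [i y|i r]; first by have [] := wave_partial xi t i y.
  exists (`|xi i|) => x _; rewrite (proj2 (wave_partial _ _ _ _)) normrM ler_piMr//.
  exact: cos_max.
elim: k th => [|k IH] th /=; split=> // i; split=> [x|].
  by have [] := wave_partial xi th i x.
rewrite (_ : partial i _ = cst (xi i) \* wave xi (th + pi / 2)); last first.
  by apply/funext => x; rewrite (proj2 (wave_partial _ _ _ _)).
by apply: smooth_uptoM => //; move/smooth_uptoP: (@smooth_cst R n (xi i)).
Qed.

Lemma partials_wave xi th s : exists th', 
  partials s (wave xi th) = (fun x => (\prod_(i <- s) xi i) * wave xi th' x).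
Proof.
elim/last_ind: s th => [|s i IH] th.
  by exists th; apply/funext => x; rewrite big_nil mul1r.
have [th' E] := IH (th + pi / 2); exists th'.
rewrite partials_rcons (_ : partial i _ = (fun x => xi i * wave xi (th + pi / 2) x)); last first.
  by apply/funext => x; rewrite (proj2 (wave_partial _ _ _ _)).
rewrite partialsZ; last exact: smooth_wave.
apply/funext => x; rewrite E mulrA; congr (_ * _).
by rewrite -cats1 big_cat big_seq1 mulrC.
Qed.

Lemma wave_le1 xi th x : `|wave xi th x| <= 1.
Proof. exact: cos_max. Qed.

(** The waves of a given frequency span a plane, so that bounds for two phases give bounds for
all of them. *)
Lemma wave_phase xi th b x :
  wave xi (th + b) x = cos b * wave xi th x + sin b * wave xi (th + pi / 2) x.
Proof.
rewrite /wave !addrA cosDpihalf cosD; ring.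
Qed.

End Schwarz.

(** * Differentiation under an integral sign *)

(** [J] stands for an integral against a finite measure on [T] and [D] for the
bounded measurable functions.  Since all derivatives are bounded locally uniformly in
the parameter, a second order Taylor estimate replaces dominated convergence, and
the same statement covers integrals and absolutely convergent series. *)
Record bounded_functional {R : realType} (T : Type) (Q : set T) (D : (T -> R) -> Prop)
    (J : (T -> R) -> R) (c : R) : Prop := BoundedFunctional {
  bf_dom : forall (a b : R) g h, D g -> D h -> D (fun t => a * g t + b * h t);
  bf_lin : forall (a b : R) g h, D g -> D h ->
    J (fun t => a * g t + b * h t) = a * J g + b * J h;
  bf_bound : forall g B, D g -> (forall t, Q t -> `|g t| <= B) -> `|J g| <= c * B
}.

Section ParametricIntegral.
Context {R : realType} {n : nat} (T : Type) (Q : set T) (D : (T -> R) -> Prop)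
  (J : (T -> R) -> R) (c : R) (bJ : bounded_functional Q D J c).
Local Notation ee i := (delta_mx ord0 i).
Variable k : T -> 'rV[R]_n -> R.
Hypothesis sk : forall t, smooth (k t).
Hypothesis Dk : forall s x, D (fun t => partials s (k t) x).
Hypothesis bk : forall s (r : R), exists B, forall t x, Q t -> cube r x -> `|partials s (k t) x| <= B.

Lemma partial_functional s i x :
  derivable (fun x => J (fun t => partials s (k t) x)) x (ee i) /\
  partial i (fun x => J (fun t => partials s (k t) x)) x =
    J (fun t => partials (i :: s) (k t) x).
Proof.
apply: is_derive_line.
set G := fun u : R => J _; set d := J _.
have [B HB] := bk (i :: i :: s) (`|x| + 1).
have B0 : 0 <= `|c * B| by [].
have key (u : R) : u != 0 -> `|u| <= 1 -> `|d - u^-1 * (G u - G 0)| <= `|c * B| * `|u|.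
  move=> u0 u1.
  pose g t := partials (i :: s) (k t) x.
  pose f1 t := partials s (k t) (x + u *: ee i).
  pose f0 t := partials s (k t) x.
  have D0 : D (fun t => 1 * f1 t + (- 1) * f0 t) by apply: (bf_dom bJ); exact: Dk.
  have -> : d - u^-1 * (G u - G 0) =
      J (fun t => 1 * g t + (- u^-1) * (1 * f1 t + (- 1) * f0 t)).
    rewrite (bf_lin bJ)//; last exact: Dk.
    rewrite (bf_lin bJ); [|exact: Dk|exact: Dk].
    rewrite /G scale0r addr0 -/d /f1 /f0 /g; ring.
  apply: (@le_trans _ _ (c * (B * `|u|))); last first.
    by rewrite mulrA ler_wpM2r// ler_norm.
  apply: (bf_bound bJ) => [|t Qt].
    by apply: (bf_dom bJ) => //; exact: Dk.
  have sks := smooth_partials s (sk t).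
  have [a a1 E] := @partial_MVT R n (partials s (k t)) x i u (fun y => smooth_derivable i y sks).
  have [a' a1' E'] := @partial_MVT R n (partials (i :: s) (k t)) x i a
    (fun y => smooth_derivable i y (smooth_partial i sks)).
  have -> : 1 * g t + - u^-1 * (1 * f1 t + -1 * f0 t) =
      - (partials (i :: s) (k t) (x + a *: ee i) - partials (i :: s) (k t) x).
    rewrite (_ : 1 * f1 t + _ = f1 t - f0 t); last by ring.
    by rewrite /f1 /f0 E /g /=; field.
  rewrite normrN E' normrM; apply: ler_pM => //.
  apply: HB => //; apply: (cube_le _ (in_cubeD i a' (cube_norm x))).
  by rewrite lerD2l (le_trans a1')// (le_trans a1).
have C : (fun u => u^-1 *: (G (u *: (1 : R) + 0) - G 0)) @ 0^' --> d.
  apply/cvgrPdist_le => e e0.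
  have C0 : 0 < `|c * B| + 1 by rewrite ltr_wpDl.
  near=> u.
  rewrite /GRing.scale /= mulr1 addr0.
  have u0 : u != 0 by near: u; exact: nbhs_dnbhs_neq.
  have u1 : `|u| <= 1 by near: u; apply: dnbhs0_le.
  have ue : `|u| <= e / (`|c * B| + 1) by near: u; apply: dnbhs0_le; rewrite divr_gt0.
  apply: (le_trans (key u u0 u1)).
  apply: (@le_trans _ _ ((`|c * B| + 1) * `|u|)); first by rewrite ler_wpM2r// lerDl.
  by rewrite mulrC -ler_pdivlMr.
split; first by apply/cvg_ex; exists d.
exact/cvg_lim.
Unshelve. all: by end_near.
Qed.

Lemma partials_functional s :
  partials s (fun x => J (k^~ x)) = (fun x => J (fun t => partials s (k t) x)).
Proof.
elim: s => //= i s ->; apply/funext => x.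
exact: (proj2 (partial_functional s i x)).
Qed.

Lemma smooth_functional : smooth (fun x => J (k^~ x)).
Proof.
apply: smooth_bounded => [s i x|s r]; rewrite partials_functional.
  exact: (proj1 (partial_functional s i x)).
have [B HB] := bk s r; exists (c * B) => x cx.
by apply: (bf_bound bJ) => // t Qt; exact: HB.
Qed.

End ParametricIntegral.

(** * Lebesgue measure on R^n *)

Section BorelSets.
Context {R : realType} {n : nat}.

Let box (p : 'rV[rat]_n * rat) : set 'rV[R]_n :=
  [set x | forall i, `|x ord0 i - ratr (p.1 ord0 i)| < ratr p.2].

Let measurable_box p : measurable (box p).
Proof.
have -> : box p = \big[setI/setT]_(i < n)
    [set x | `|x ord0 i - ratr (p.1 ord0 i)| < ratr p.2].
  apply/seteqP; split=> x.
    by move=> H; elim/big_ind: _ => [//|A B HA HB|i _]; [split|exact: H].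
  by move=> H i; move: H; rewrite (bigD1 i)//= => -[].
elim/big_ind: _ => [|A B mA mB|i _]; [exact: measurableT|exact: measurableI|].
have := @measurable_coor R n i measurableT
  `](ratr (p.1 ord0 i) - ratr p.2 : R), (ratr (p.1 ord0 i) + ratr p.2)[%classic.
rewrite setTI => H; have {H} := H (measurable_itv _); congr measurable.
by apply/seteqP; split=> x; rewrite /= in_itv/= ltr_distl.
Qed.

(** An open set is the union of the countably many rational boxes inside it. *)
Lemma measurable_open_rV (A : set 'rV[R]_n) : open A -> measurable A.
Proof.
move=> oA.
have -> : A = \bigcup_(p : 'rV[rat]_n * rat) (if `[< box p `<=` A >] then box p else set0).
  apply/seteqP; split=> x; last first.
    by move=> [p _]; case: asboolP => // H; exact: H.
  move=> Ax; have /nbhs_ballP[e /= e0 He] : nbhs x A by exact: open_nbhs_nbhs.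
  have e2 : 0 < e / 2 by rewrite divr_gt0.
  have [r] := rat_in_itvoo e2; rewrite in_itv/= => /andP[r0 re].
  have /choice[q Hq] : forall i, exists q : rat, `|x ord0 i - ratr q| < ratr r.
    move=> i; have [|q] := @rat_in_itvoo R (x ord0 i - ratr r) (x ord0 i + ratr r).
      by rewrite ltrD2l (lt_trans _ r0)// oppr_lt0.
    rewrite in_itv/= => /andP[q1 q2]; exists q; rewrite distrC ltr_distl.
    by rewrite q1.
  exists (\row_i q i, r) => //=; rewrite asboolT => [i|y yb] /=; first by rewrite mxE.
  apply: He; rewrite -ball_normE /=.
  apply: (@le_lt_trans _ _ (2 * ratr r)); last by rewrite mulrC -ltr_pdivlMr.
  apply/cubeP; first by rewrite mulr_ge0// ltW.
  move=> i; rewrite !mxE; have := yb i; have := Hq i; rewrite /= mxE => h1 h2.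
  rewrite (_ : 2 * _ = ratr r + ratr r); last by ring.
  apply: (le_trans (ler_distD (ratr (q i)) _ _)); apply: lerD; first exact: ltW.
  by rewrite distrC; exact: ltW.
apply: countable_bigcupT_measurable => // p.
by case: asboolP => _; [exact: measurable_box|exact: measurable0].
Qed.

Lemma continuous_measurable (h : 'rV[R]_n -> R) : continuous h ->
  measurable_fun [set: 'rV[R]_n] h.
Proof.
move=> /continuousP ch; apply: (measurability _ (RGenOpens.measurableE R)).
move=> _ [_ [a [b ->] <-]]; rewrite setTI.
by apply: measurable_open_rV; apply: ch; exact: interval_open.
Qed.

Lemma measurable_partials s (h : 'rV[R]_n -> R) : smooth h ->
  measurable_fun [set: 'rV[R]_n] (partials s h).
Proof.
by move=> sh; apply: continuous_measurable; apply: smooth_continuous; exact: smooth_partials.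
Qed.
Lemma closed_cube (r : R) : closed (@cube R n r).
Proof. by apply: compact_closed; [exact: norm_hausdorff|exact: compact_cube]. Qed.

Lemma measurable_cube (r : R) : measurable (@cube R n r).
Proof.
rewrite -[cube r]setCK; apply: measurableC; apply: measurable_open_rV.
by rewrite openC; exact: closed_cube.
Qed.

End BorelSets.

Section CubeMeasure.
Context {R : realType}.

Lemma rV_rcons_cube n (r : R) :
  @rV_rcons R n @^-1` cube r = cube r `*` `[- r, r]%classic.
Proof.
apply/seteqP; split=> -[y t] /=; rewrite in_itv/= -ler_norml.
  move=> H; split=> [i|].
    by have := H (lift ord_max i); rewrite mxE liftK.
  by have := H ord_max; rewrite mxE unlift_none.
move=> [Hy Ht] i; rewrite mxE; case: unliftP => [j _|_] //=; exact: Hy.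
Qed.

Lemma lebesgue_cube n (r : R) : 0 <= r ->
  lebesgue_rV R n (cube r) = ((2 * r) ^+ n)%:E.
Proof.
move=> r0; elim: n => [|n IH].
  by rewrite /= diracE mem_set// => -[].
rewrite /= /pushforward rV_rcons_cube.
rewrite (@product_measure1E _ _ _ _ _ (lebesgue_rV R n) lebesgue_measure _ _ (measurable_cube r) (measurable_itv _)).
rewrite IH [X in (_ * X)%E](lebesgue_measure_itv `[- r, r]) /= lte_fin.
have -> : (2 * r) = r - - r by ring.
case: ltP => [_|rr]; first by rewrite -EFinB -EFinM exprSr.
have -> : r = 0 by apply/eqP; rewrite eq_le r0 andbT; lra.
by rewrite mule0 opprK addr0 exprS mul0r.
Qed.

Lemma lebesgue_cube_lty n (r : R) : (lebesgue_rV R n (cube r) < +oo)%E.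
Proof.
apply: (@le_lt_trans _ _ (lebesgue_rV R n (cube `|r|))).
  apply: le_measure; [by apply/mem_set; exact: measurable_cube|by apply/mem_set; exact: measurable_cube|].
  by move=> x; apply: cube_le; exact: ler_norm.
by rewrite lebesgue_cube// ltry.
Qed.

Lemma lebesgue_sigma_finite n : sigma_finite setT (lebesgue_rV R n).
Proof.
exists (fun k => cube k%:R).
  apply/seteqP; split=> // x _; exists (Num.bound `|x|) => //.
  by apply: (cube_le _ (cube_norm x)); rewrite ltW// archi_boundP.
by move=> k; split; [exact: measurable_cube|exact: lebesgue_cube_lty].
Qed.

(** A second name for Lebesgue measure, to carry the sigma-finiteness that the theorems of
Tonelli and Fubini need. *)
Definition lebesgue_sf n : set 'rV[R]_n -> \bar R := lebesgue_rV R n.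
Arguments lebesgue_sf : clear implicits.

Let lebesgue_sf0 n : lebesgue_sf n set0 = 0%E.
Proof. exact: measure0. Qed.

Let lebesgue_sf_ge0 n A : (0 <= lebesgue_sf n A)%E.
Proof. exact: measure_ge0. Qed.

Let lebesgue_sf_additive n : semi_sigma_additive (lebesgue_sf n).
Proof. exact: measure_semi_sigma_additive. Qed.

HB.instance Definition _ n := isMeasure.Build _ _ _ (lebesgue_sf n)
  (lebesgue_sf0 n) (@lebesgue_sf_ge0 n) (@lebesgue_sf_additive n).

HB.instance Definition _ n := Measure_isSigmaFinite.Build _ _ _ (lebesgue_sf n)
  (lebesgue_sigma_finite n).

Let lebR : {sigma_finite_measure set (measurableTypeR R) -> \bar R} := @lebesgue_measure R.

Definition slice_integral n (f : 'rV[R]_n.+1 -> R) (r t : R) : \bar R :=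
  (\int[lebesgue_rV R n]_(y in cube r) (f (rV_rcons (y, t)))%:E)%E.

(** Tonelli's theorem, for Lebesgue measure as an iterated product. *)
Lemma integral_cube_succ n (f : 'rV[R]_n.+1 -> R) (r : R) :
  measurable_fun setT f -> (forall x, 0 <= f x) ->
  (\int[lebesgue_rV R n.+1]_(x in cube r) (f x)%:E =
   \int[lebesgue_measure]_(t in `[(- r)%R, r])
     slice_integral f r t)%E /\
  measurable_fun setT (slice_integral f r).
Proof.
move=> mf f0.
pose g : 'rV[R]_n * measurableTypeR R -> \bar R := fun p => ((f (rV_rcons p)) * \1_(cube r) p.1)%:E.
have mg : measurable_fun setT g.
  apply/measurable_EFinP; apply: measurable_funM.
    by apply: (measurableT_comp mf); exact: measurable_rV_rcons.
  exact: (measurableT_comp (measurable_indic (measurable_cube r)) measurable_fst).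
have g0 p : (0 <= g p)%E by rewrite lee_fin mulr_ge0.
have gE t : (\int[lebesgue_rV R n]_y g (y, t))%E = slice_integral f r t.
  rewrite [RHS]integral_mkcond; apply: eq_integral => y _.
  by rewrite /g /patch /= indicE; case: ifP => _; rewrite ?mulr1 ?mulr0.
have mG : measurable_fun setT (fubini_G (lebesgue_sf n) g).
  exact: measurable_fun_fubini_tonelli_G.
have GE : fubini_G (lebesgue_sf n) g = slice_integral f r.
  by apply/funext => t; rewrite /fubini_G -gE.
split; last by rewrite -GE.
have mfc : measurable_fun (cube r) (fun x => (f x)%:E).
  by apply/measurable_EFinP; exact: measurable_funTS.
have fc0 : {in cube r, forall x, (0 <= (f x)%:E)%E} by move=> x _; rewrite lee_fin.
transitivity (\int[lebesgue_sf n \x lebR]_(p in cube r `*` `[(- r)%R, r])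
    (f (rV_rcons p))%:E)%E.
  rewrite -rV_rcons_cube; refine (@ge0_integral_pushforward _ _ _ _ _ _ _
    (lebesgue_rV R n \x @lebesgue_measure R)%E _ _ (measurable_cube r) mfc fc0).
  exact: measurable_rV_rcons.
rewrite integral_mkcond.
pose G : 'rV[R]_n * measurableTypeR R -> \bar R := fun p => (f (rV_rcons p) * \1_(cube r) p.1 * \1_`[- r, r]%classic p.2)%:E.
rewrite (_ : (fun x => _) = G); last first.
  apply/funext => -[y t]; rewrite /G /patch /= !indicE in_setX /=.
  by case: (y \in _); case: (t \in _); rewrite /= ?mulr1 ?mulr0 ?mul0r.
transitivity (\int[lebR]_y fubini_G (lebesgue_sf n) G y)%E.
  apply: fubini_tonelli2; last by move=> p; rewrite lee_fin !mulr_ge0.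
  apply/measurable_EFinP; apply: measurable_funM; first exact/measurable_EFinP.
  exact: (measurableT_comp (measurable_indic (measurable_itv _)) measurable_snd).
rewrite [RHS]integral_mkcond; apply: eq_integral => t _.
rewrite /fubini_G /G /patch /= indicE; case: ifP => tr /=; last first.
  by apply: integral0_eq => y _; rewrite mulr0.
by rewrite -gE; apply: eq_integral => y _; rewrite mulr1.
Qed.

End CubeMeasure.

(** * A Sobolev inequality *)

Section Sobolev.
Context {R : realType}.

Lemma is_derive_continuous (g dg : R -> R) : (forall t, is_derive t (1 : R) g (dg t)) -> continuous g.
Proof.
by move=> Dg t; apply: differentiable_continuous; apply/derivable1_diffP; have [] := Dg t.
Qed.

(** The fundamental theorem of calculus is applied to [(1 - t) g(t)] on the unit interval. *)
Lemma Sobolev1 (g dg : R -> R) : (forall t, is_derive t (1 : R) g (dg t)) -> continuous dg ->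
  (`|g 0|%:E <= \int[lebesgue_measure]_(t in `[(- 1)%R, 1%R]) (`|g t| + `|dg t|)%:E)%E.
Proof.
move=> Dg cdg.
have cg := is_derive_continuous Dg.
pose G t := (1 - t) * g t; pose f t := (1 - t) * dg t - g t.
have Df t : is_derive t (1 : R) G (f t).
  have D1 : is_derive t (1 : R) (fun s : R => s * (-1) + 1) (-1) by exact: is_derive_affine.
  have -> : G = (fun s : R => s * (-1) + 1) * g.
    by apply/funext => s; rewrite /G fctE; ring.
  apply: (is_derive_eq (is_deriveM D1 (Dg t))).
  by rewrite /f /GRing.scale /=; ring.
have cf : continuous f.
  move=> t; apply: cvgB; last exact: cg.
  apply: cvgM; last exact: cdg.
  by apply: cvgB; [exact: cvg_cst|exact: cvg_id].
have cG := is_derive_continuous Df.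
have := @continuous_FTC2 R f G 0 1 ltr01 (continuous_subspaceT cf).
have H1 : derivable_oo_LRcontinuous G 0 1.
  split=> [t _||]; first by have [] := Df t.
  - exact/cvg_at_right_filter/cG.
  - exact/cvg_at_left_filter/cG.
move=> /(_ H1) H2.
have {H2} /(congr1 abse) : (\int[lebesgue_measure]_(x in `[0%R, 1%R]) (f x)%:E)%E = ((G 1)%:E - (G 0)%:E)%E.
  by apply: H2 => t _; rewrite derive1E; have [_ ->] := Df t.
rewrite /G subrr mul0r subr0 mul1r sub0e abseN /= => <-.
have mf : measurable_fun (`[0%R, 1%R]%classic : set R) (EFin \o f).
  by apply/measurable_EFinP; apply: measurable_funTS; exact: continuous_measurable_fun.
apply: le_trans; first exact: (@le_abse_integral _ _ _ (@lebesgue_measure R) _ _ (measurable_itv _) mf).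
have mF (D : set R) : measurable_fun D (fun t => (`|g t| + `|dg t|)%:E).
  apply: measurable_funTS; apply/measurable_EFinP; apply: measurable_funD.
    by apply: measurableT_comp => //; exact: continuous_measurable_fun.
  by apply: measurableT_comp => //; exact: continuous_measurable_fun.
apply: (@le_trans _ _ (\int[lebesgue_measure]_(t in `[0%R, 1%R]) (`|g t| + `|dg t|)%:E)%E).
  apply: ge0_le_integral.
  - exact: measurable_itv.
  - by move=> t _ /=; rewrite lee_fin.
  - exact: (measurableT_comp _ mf).
  - exact: mF.
  - move=> t /=; rewrite in_itv/= => /andP[t0 t1]; rewrite lee_fin.
    rewrite (le_trans (ler_normB _ _))// addrC lerD// normrM ler_piMl//.
    by rewrite ger0_norm ?subr_ge0// gerBl.
apply: ge0_subset_integral; [exact: measurable_itv|exact: measurable_itv|exact: mF| |].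
  by move=> t _; rewrite lee_fin addr_ge0.
by move=> t /=; rewrite !in_itv/= => /andP[t0 ->]; rewrite andbT (le_trans _ t0).
Qed.

(** The derivatives of order at most one in each variable are those that appear when the
one-dimensional inequality is iterated over the coordinates. *)
Fixpoint sobolev_lists (n : nat) : seq (seq 'I_n) :=
  match n with
  | 0%N => [:: [::]]
  | m.+1 => [seq [seq lift ord_max i | i <- s] | s <- sobolev_lists m] ++
      [seq rcons [seq lift ord_max i | i <- s] ord_max | s <- sobolev_lists m]
  end.

Lemma rV_rconsD n (y : 'rV[R]_n) (t u : R) i :
  rV_rcons (y + u *: delta_mx ord0 i, t) = rV_rcons (y, t) + u *: delta_mx ord0 (lift ord_max i).
Proof.
apply/rowP => j; rewrite !mxE eqxx /=; case: unliftP => [k ->|->] /=.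
  by rewrite !mxE eqxx /= (inj_eq lift_inj).
by rewrite (negbTE (neq_lift _ _)) mulr0 addr0.
Qed.

Lemma rV_rconsD_max n (y : 'rV[R]_n) (t u : R) :
  rV_rcons (y, t + u) = rV_rcons (y, t) + u *: delta_mx ord0 ord_max.
Proof.
apply/rowP => j; rewrite !mxE eqxx /=; case: unliftP => [k ->|->] /=.
  by rewrite eq_sym (negbTE (neq_lift _ _)) mulr0 addr0.
by rewrite eqxx mulr1.
Qed.

Lemma continuous_rV_rcons n (t : R) : continuous (fun y : 'rV[R]_n => rV_rcons (y, t)).
Proof.
move=> y A /nbhs_ballP[e /= e0 He]; apply/nbhs_ballP; exists e => //= z [_ yz].
apply: He; split=> // i j; rewrite !mxE; case: unliftP => [k _|_] /=; last exact: ballxx.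
exact: yz.
Qed.

Lemma partials_rV_rcons n (h : 'rV[R]_n.+1 -> R) (t : R) s : smooth h ->
  partials s (fun y : 'rV[R]_n => h (rV_rcons (y, t))) =
  (fun y => partials [seq lift ord_max i | i <- s] h (rV_rcons (y, t))).
Proof.
move=> sh; elim: s => //= i s ->; apply/funext => y.
have [||//] := @derivable_lineP R n n.+1
  (fun y => partials [seq lift ord_max i | i <- s] h (rV_rcons (y, t)))
  (partials [seq lift ord_max i | i <- s] h) y (rV_rcons (y, t)) i (lift ord_max i).
  by move=> u; rewrite rV_rconsD.
by apply: smooth_derivable; exact: smooth_partials.
Qed.

Lemma smooth_rV_rcons n (h : 'rV[R]_n.+1 -> R) (t : R) : smooth h ->
  smooth (fun y : 'rV[R]_n => h (rV_rcons (y, t))).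
Proof.
move=> sh s; rewrite partials_rV_rcons//.
have sh' := smooth_partials [seq lift ord_max i | i <- s] sh; split=> [y|i y].
  apply: (@continuous_comp _ _ _ (fun y => rV_rcons (y, t))); first exact: continuous_rV_rcons.
  exact: smooth_continuous.
have [||//] := @derivable_lineP R n n.+1
  (fun y => partials [seq lift ord_max i | i <- s] h (rV_rcons (y, t)))
  (partials [seq lift ord_max i | i <- s] h) y (rV_rcons (y, t)) i (lift ord_max i).
  by move=> u; rewrite rV_rconsD.
by apply: smooth_derivable.
Qed.

(** By induction on the dimension: the one-dimensional inequality is applied in the last
coordinate, and the inequality in dimension [n] on the slices. *)
Lemma Sobolev n (h : 'rV[R]_n -> R) : smooth h ->
  (`|h 0|%:E <= \sum_(s <- sobolev_lists n)
     \int[lebesgue_rV R n]_(x in cube 1) `|partials s h x|%:E)%E.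
Proof.
elim: n h => [|n IH] h sh.
  rewrite /= big_seq1 integral_dirac//; last first.
    by apply/measurable_EFinP; apply: measurable_funTS; apply: measurableT_comp => //;
      apply: continuous_measurable; exact: smooth_continuous.
    exact: measurable_cube.
  by rewrite diracE mem_set ?mul1e// => -[].
set m := ord_max : 'I_n.+1.
pose g t := h (rV_rcons (0 : 'rV[R]_n, t)).
pose dg t := partial m h (rV_rcons (0 : 'rV[R]_n, t)).
have rc t : rV_rcons (0 : 'rV[R]_n, t) = 0 + t *: delta_mx ord0 m.
  rewrite -[t in LHS]add0r rV_rconsD_max; congr (_ + _).
  by apply/rowP => i; rewrite !mxE; case: unliftP => // k _; rewrite mxE.
have Dg t : is_derive t (1 : R) g (dg t).
  rewrite /g /dg rc (_ : (fun _ => _) = fun u => h (0 + u *: delta_mx ord0 m)); last first.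
    by apply/funext => u; rewrite rc.
  by apply: line_is_derive; exact: smooth_derivable.
have cdg : continuous dg.
  move=> t; rewrite /dg (_ : (fun _ => _) = fun u => partial m h (0 + u *: delta_mx ord0 m)); last first.
    by apply/funext => u; rewrite rc.
  apply: differentiable_continuous; apply/derivable1_diffP.
  by have [] := @line_is_derive R n.+1 (partial m h) 0 m t
    (smooth_derivable m _ (smooth_partial m sh)).
have h0 : h 0 = g 0 by rewrite /g rc scale0r addr0.
rewrite h0; apply: (le_trans (Sobolev1 Dg cdg)).
pose K s (k : 'rV[R]_n.+1 -> R) :=
  slice_integral (fun x => `|partials [seq lift ord_max i | i <- s] k x|) 1.
have mpart s k : smooth k -> measurable_fun setT (fun x : 'rV[R]_n.+1 => `|partials s k x|).
  move=> sk; apply: measurableT_comp => //; apply: continuous_measurable.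
  by apply: smooth_continuous; exact: smooth_partials.
have succ s k : smooth k -> (\int[lebesgue_rV R n.+1]_(x in cube 1)
      `|partials [seq lift ord_max i | i <- s] k x|%:E = \int[lebesgue_measure]_(t in `[(- 1)%R, 1%R]) K s k t)%E /\
    measurable_fun setT (K s k).
  by move=> sk; apply: integral_cube_succ => //; exact: mpart.
have mK s k sk := proj2 (succ s k sk).
have KE s k sk := esym (proj1 (succ s k sk)).
have K0 s k t : (0 <= K s k t)%E by apply: integral_ge0 => y _; rewrite lee_fin.
have H k t : smooth k -> (`|k (rV_rcons (0%R : 'rV[R]_n, t))|%:E <= \sum_(s <- sobolev_lists n) K s k t)%E.
  move=> sk; have := IH _ (smooth_rV_rcons t sk).
  congr (_ <= _)%E; apply: eq_bigr => s _; apply: eq_integral => y _.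
  by rewrite partials_rV_rcons.
have sh' := smooth_partial m sh.
pose SK t := (\sum_(s <- sobolev_lists n) (K s h t + K s (partial m h) t))%E.
have mKD s : measurable_fun setT (fun t => K s h t + K s (partial m h) t)%E.
  by apply: emeasurable_funD; exact: mK.
apply: (@le_trans _ _ (\int[lebesgue_measure]_(t in `[(- 1)%R, 1%R]) SK t)%E).
  apply: ge0_le_integral => //.
  - apply: measurable_funTS; apply/measurable_EFinP; apply: measurable_funD.
      apply: measurableT_comp => //; apply: continuous_measurable_fun.
      exact: (is_derive_continuous Dg).
    by apply: measurableT_comp => //; exact: continuous_measurable_fun.
  - apply: measurable_funTS; apply: emeasurable_sum => s _; exact: mKD.
  - by move=> t _; rewrite EFinD /SK big_split/=; apply: leeD; exact: H.
rewrite /SK ge0_integral_sum//; last 2 first.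
- by move=> s; apply: measurable_funTS; exact: mKD.
- by move=> s t _; exact: adde_ge0.
rewrite /= big_cat/= !big_map -big_split/=; apply: le_of_eq.
apply: eq_bigr => s _; rewrite ge0_integralD//; last 2 first.
- by apply: measurable_funTS; exact: mK.
- by apply: measurable_funTS; exact: mK.
rewrite !KE//; congr (_ + _)%E; apply: eq_integral => x _.
by rewrite partials_rcons.
Qed.

End Sobolev.

(** * Real functions in a solid Banach function space *)

Section ComplexModulus.
Context {R : realType}.

Lemma normcE (z : R[i]) : normc z = Num.sqrt (complex.Re z ^+ 2 + complex.Im z ^+ 2).
Proof. by case: z. Qed.

Lemma normc_real (a : R) : normc (a%:C)%C = `|a|.
Proof. by rewrite normcE /= expr0n addr0 sqrtr_sqr. Qed.

Lemma normc_ge0 (z : R[i]) : 0 <= normc z.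
Proof. by rewrite normcE sqrtr_ge0. Qed.

Lemma Re_le_normc (z : R[i]) : `|complex.Re z| <= normc z.
Proof. by rewrite normcE -sqrtr_sqr ler_wsqrtr// lerDl sqr_ge0. Qed.

Lemma Im_le_normc (z : R[i]) : `|complex.Im z| <= normc z.
Proof. by rewrite normcE -sqrtr_sqr ler_wsqrtr// lerDr sqr_ge0. Qed.

End ComplexModulus.

Section RealFunctions.
Context {R : realType} {n : nat}.
Local Notation V := 'rV[R]_n.
Local Notation mu := (lebesgue_rV R n).
Implicit Types (h g : V -> R) (f : V -> R[i]).

Definition toC h : V -> R[i] := fun x => (h x)%:C%C.

Lemma measurable_normc f : measurable_fun setT (Repart f) -> measurable_fun setT (Impart f) ->
  measurable_fun setT (fun x => normc (f x)).
Proof.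
move=> mr mi.
rewrite (_ : (fun _ => _) = @Num.sqrt R \o (fun x => Repart f x ^+ 2 + Impart f x ^+ 2)); last first.
  by apply/funext => x; rewrite /= normcE.
apply: measurableT_comp; first by apply: continuous_measurable_fun; exact: sqrt_continuous.
by apply: measurable_funD; exact: measurable_funX.
Qed.

Lemma measurable_compact (K : set V) : compact K -> measurable K.
Proof.
move=> cK; rewrite -[K]setCK; apply: measurableC; apply: measurable_open_rV.
by rewrite openC; apply: compact_closed => //; exact: norm_hausdorff.
Qed.

Lemma L1loc_le f (g : V -> R[i]) (c : R) : L1loc f -> 0 <= c ->
  measurable_fun setT (Repart g) -> measurable_fun setT (Impart g) ->
  (forall x, normc (g x) <= c * normc (f x)) -> L1loc g.
Proof.
move=> [mr mi fK] c0 mrg mig gf; split=> // K cK.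
have mK := measurable_compact cK; have mf := measurable_normc mr mi.
apply: (@le_lt_trans _ _ (c%:E * \int[mu]_(x in K) (normc (f x))%:E)%E); last first.
  by apply: lte_mul_pinfty => //; exact: fK.
rewrite -ge0_integralZl//; last 2 first.
- by apply/measurable_EFinP; exact: measurable_funTS.
- by move=> x _; rewrite lee_fin normc_ge0.
apply: ge0_le_integral => //.
- by move=> x _; rewrite lee_fin normc_ge0.
- by apply/measurable_EFinP; apply: measurable_funTS; exact: measurable_normc.
- by apply/measurable_EFinP; apply: measurable_funTS; apply: measurable_funM.
- by move=> x _; rewrite -EFinM lee_fin.
Qed.

Variables (E : fspace R n) (HE : is_tibf_bounded_type E) (solE : solid E).

Lemma E_dominated f (g : V -> R[i]) (c : R) : E f -> 0 <= c ->
  measurable_fun setT (Repart g) -> measurable_fun setT (Impart g) ->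
  (forall x, normc (g x) <= c * normc (f x)) -> E g /\ fnorm E g <= c * fnorm E f.
Proof.
move=> Ef c0 mr mi gf.
have Ecf := tibf_scale HE (c%:C)%C Ef.
have [|Eg Ng] := solE Ecf (L1loc_le (tibf_L1loc HE Ef) c0 mr mi gf).
  by apply: aeW => x; rewrite normcM normc_real (ger0_norm c0).
by split=> //; rewrite (le_trans Ng)// (tibf_norm_scale HE)// normc_real (ger0_norm c0).
Qed.

(** The converse implication only concerns the real and the imaginary parts of the elements of
the spaces. *)
Definition RE h := E (toC h).
Definition RN h := fnorm E (toC h).

Lemma RE_dominated f h (c : R) : E f -> 0 <= c -> measurable_fun setT h ->
  (forall x, `|h x| <= c * normc (f x)) -> RE h /\ RN h <= c * fnorm E f.
Proof.
move=> Ef c0 mh hf; apply: E_dominated => //.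
- by rewrite (_ : Impart _ = cst 0); [exact: measurable_cst|exact/funext].
- by move=> x; rewrite /toC normc_real.
Qed.

Lemma RE_measurable h : RE h -> measurable_fun setT h.
Proof. by move=> /(tibf_L1loc HE)[]. Qed.

Lemma RE_le h g (c : R) : RE g -> 0 <= c -> measurable_fun setT h ->
  (forall x, `|h x| <= c * `|g x|) -> RE h /\ RN h <= c * RN g.
Proof.
move=> Eg c0 mh hg; apply: RE_dominated => // x.
by rewrite /toC normc_real.
Qed.

Lemma RE0 : RE (cst 0).
Proof. exact: tibf_0. Qed.

Lemma toCD h g : toC (h \+ g) = toC h \+ toC g.
Proof. by apply/funext => x; rewrite /toC /= rmorphD. Qed.

Lemma toCZ (a : R) h : toC (fun x => a * h x) = (fun x => (a%:C)%C * toC h x).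
Proof. by apply/funext => x; rewrite /toC /= rmorphM. Qed.

Lemma toCB h g : toC (h \- g) = toC h \- toC g.
Proof. by apply/funext => x; rewrite /toC /= rmorphB. Qed.

Lemma RE_add h g : RE h -> RE g -> RE (h \+ g) /\ RN (h \+ g) <= RN h + RN g.
Proof.
move=> Eh Eg; rewrite /RE /RN toCD; split; first exact: (tibf_add HE).
exact: (tibf_norm_add HE).
Qed.

Lemma RE_scale (a : R) h : RE h -> RE (fun x => a * h x) /\ RN (fun x => a * h x) = `|a| * RN h.
Proof.
move=> Eh; rewrite /RE /RN toCZ; split; first exact: (tibf_scale HE).
by rewrite (tibf_norm_scale HE)// normc_real.
Qed.

Lemma fnorm_ge0 f : E f -> 0 <= fnorm E f.
Proof.
move=> Ef.
have E0 : fnorm E (fun x => 0 * f x) = 0 by rewrite (tibf_norm_scale HE)// normc0 mul0r.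
have EN := tibf_norm_scale HE (-1) Ef.
have := tibf_norm_add HE Ef (tibf_scale HE (-1) Ef).
rewrite EN normcN normc1 mul1r (_ : f \+ _ = fun x => 0 * f x); last first.
  by apply/funext => x /=; rewrite mulN1r subrr mul0r.
by rewrite E0 -mulr2n pmulrn_lge0.
Qed.

Lemma RN_ge0 h : RE h -> 0 <= RN h.
Proof. exact: fnorm_ge0. Qed.

Lemma RE_sub h g : RE h -> RE g -> RE (h \- g) /\ RN (h \- g) <= RN h + RN g.
Proof.
move=> Eh Eg; have [Eg' Ng'] := RE_scale (-1) Eg.
have -> : h \- g = h \+ (fun x => -1 * g x) by apply/funext => x /=; rewrite mulN1r.
by have [? ?] := RE_add Eh Eg'; split=> //; move: Ng'; rewrite normrN normr1 mul1r => <-.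
Qed.

Lemma RN_sub_sym h g : RE h -> RE g -> RN (h \- g) = RN (g \- h).
Proof.
move=> Eh Eg; have [Ehg _] := RE_sub Eh Eg.
have [_] := RE_scale (-1) Ehg; rewrite normrN normr1 mul1r => <-; congr RN.
by apply/funext => x /=; rewrite mulN1r opprB.
Qed.

Lemma RE_shift : exists2 C : R, 0 < C & forall (a : V) h, RE h ->
  RE (fun x => h (x + a)) /\ RN (fun x => h (x + a)) <= C * RN h.
Proof.
have [C C0 HC] := tibf_bounded HE; exists C => // a h Eh.
have E1 : toC (fun x => h (x + a)) = translate (- a) (toC h).
  by apply/funext => x; rewrite /translate opprK.
by rewrite /RE /RN E1; split; [exact: (tibf_translate HE)|exact: HC].
Qed.

Lemma RE_integral (r : R) : exists2 C : R, 0 <= C & forall h, RE h ->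
  (\int[mu]_(x in cube r) `|h x|%:E <= (C * RN h)%:E)%E.
Proof.
have [C HC] := tibf_cont HE (@compact_cube R n r).
exists `|C| => // h Eh; have := HC _ Eh.
under eq_integral do rewrite /toC normc_real.
move/le_trans; apply; rewrite lee_fin; apply: ler_wpM2r; [exact: (RN_ge0 Eh)|exact: ler_norm].
Qed.

(** Sobolev embedding: the bound is uniform because the norm of [E] controls the integrals
over all translates of a cube. *)
Lemma RE_Sobolev : exists2 C : R, 0 <= C & forall h (B : R), smooth h ->
  (forall s, s \in sobolev_lists n -> RE (partials s h) /\ RN (partials s h) <= B) ->
  forall x, `|h x| <= C * B.
Proof.
have [C1 C10 H1] := RE_integral 1; have [C2 C20 H2] := RE_shift.
exists ((size (sobolev_lists n))%:R * (C1 * C2)) => [|h B sh Hh x].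
  by rewrite !mulr_ge0// ltW.
rewrite -lee_fin; have := Sobolev (smooth_shift x sh); rewrite add0r => /le_trans; apply.
apply: (@le_trans _ _ (\sum_(s <- sobolev_lists n) (C1 * C2 * B)%:E)%E).
  rewrite big_seq [leRHS]big_seq; apply: lee_sum => s sS.
  have [Es Ns] := Hh s sS; have [Es' Ns'] := H2 x _ Es.
  rewrite (partials_shift _ _ sh); apply: (le_trans (H1 _ Es')).
  by rewrite lee_fin -mulrA ler_wpM2l// (le_trans Ns')// ler_wpM2l// ltW.
rewrite sumEFin lee_fin big_const_seq count_predT iter_addr_0 -[leLHS]mulr_natl.
by rewrite !mulrA lexx.
Qed.

(** Absolutely convergent series of [E] that also converge pointwise: the limit in [E]
agrees with the pointwise limit, because the norm of [E] controls local integrals and by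
Fatou's lemma. *)
Lemma RE_series (h : nat -> V -> R) (H : V -> R) (B : R) :
  (forall k, RE (h k)) -> (forall k, RN (h k) <= B * 4^-1 ^+ k) ->
  measurable_fun setT H ->
  (forall x, (fun m => \sum_(k < m) h k x) @ \oo --> H x) ->
  RE H /\ RN H <= 2 * B.
Proof.
move=> Eh Nh mH cH.
have B0 : 0 <= B by have := le_trans (RN_ge0 (Eh 0%N)) (Nh 0%N); rewrite expr0 mulr1.
pose S m x := \sum_(k < m) h k x.
have SS m : S m.+1 = S m \+ h m by apply/funext => x; rewrite /S big_ord_recr.
have ES m : RE (S m).
  elim: m => [|m IH]; last by rewrite SS; have [] := RE_add IH (Eh m).
  by rewrite (_ : S 0%N = cst 0); [exact: RE0|apply/funext => x; rewrite /S big_ord0].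
have q0 (k : nat) : 0 <= (4^-1 : R) ^+ k by rewrite exprn_ge0.
have diff m m' : (m' <= m)%N -> RN (S m \- S m') <= 2 * B * (4^-1 ^+ m' - 4^-1 ^+ m).
  move=> /subnKC <-; elim: (m - m')%N => [|d IH].
    rewrite addn0 subrr mulr0 (_ : _ \- _ = (fun x => 0 * cst 0 x)); last first.
      by apply/funext => x /=; rewrite subrr mul0r.
    by have [_ ->] := RE_scale 0 RE0; rewrite normr0 mul0r.
  rewrite addnS SS.
  have [Ed _] := RE_sub (ES (m' + d)%N) (ES m').
  have -> : (S (m' + d)%N \+ h (m' + d)%N) \- S m' = (S (m' + d)%N \- S m') \+ h (m' + d)%N.
    by apply/funext => x /=; rewrite addrAC.
  have [_ /le_trans] := RE_add Ed (Eh (m' + d)%N); apply.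
  apply: (le_trans (lerD IH (Nh _))); rewrite exprS.
  have := q0 (m' + d)%N; have := B0; move: (4^-1 ^+ (m' + d)) (4^-1 ^+ m') => u v B0' u0.
  have : 0 <= B * u by exact: mulr_ge0.
  lra.
have q4 : (fun k : nat => (4^-1 : R) ^+ k) @ \oo --> (0 : R).
  by apply: cvg_expr; rewrite gtr0_norm ?invf_lt1// ltr1n.
have [f Ef cf] : exists2 f, E f & (fun k => fnorm E (toC (S k) \- f)) @ \oo --> (0 : R).
  apply: (tibf_complete HE) => // e e0.
  have BB : 0 < 2 * B + 1 by rewrite ltr_wpDl// mulr_ge0.
  have : \forall k \near \oo, (4^-1 : R) ^+ k < e / (2 * B + 1).
    have e1 : 0 < e / (2 * B + 1) by rewrite divr_gt0.
    move/cvgrPdist_lt: q4 => /(_ _ e1); apply: filterS => k.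
    by rewrite sub0r normrN ger0_norm.
  move=> [k0 _ Hk0]; exists k0 => j k.
  have key a b : (k0 <= b)%N -> (b <= a)%N -> RN (S a \- S b) < e.
    move=> kb ba; apply: (le_lt_trans (diff _ _ ba)).
    apply: (@le_lt_trans _ _ ((2 * B + 1) * 4^-1 ^+ b)).
      apply: ler_pM; rewrite ?mulr_ge0 ?subr_ge0 ?lerDl ?gerBl//.
      by apply: ler_wiXn2l => //; rewrite invf_le1// ler1n.
    by rewrite mulrC -ltr_pdivlMr//; exact: Hk0.
  move=> kj kk; rewrite -toCB -/(RN _).
  have [jk|/ltnW jk] := leqP k j; first exact: key.
  by rewrite RN_sub_sym//; exact: key.
have Edf k : E (toC (S k) \- f).
  apply: (tibf_add HE); first exact: ES.
  have := tibf_scale HE (-1) Ef.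
  by rewrite (_ : (fun x => -1 * f x) = fun x => - f x)//; apply/funext => x; rewrite mulN1r.
have [mfr mfi fK] := tibf_L1loc HE Ef.
have mdf g : measurable_fun setT g -> measurable_fun setT (fun x => normc (toC g x - f x)).
  move=> mg; apply: measurable_normc.
    rewrite (_ : Repart _ = g \- Repart f); first exact: measurable_funB.
    by apply/funext => x; rewrite /Repart /=; case: (f x).
  rewrite (_ : Impart _ = cst 0 \- Impart f); first exact: measurable_funB.
  by apply/funext => x; rewrite /Impart /=; case: (f x).
have mD k := mdf _ (RE_measurable (ES k)).
have mHf := mdf _ mH.
have pointwise x : (fun k => (normc (toC (S k) x - f x))%:E) @ \oo --> (normc (toC H x - f x))%:E.
  apply: cvg_EFin; first exact: nearW.
  rewrite (_ : _ \o _ = (fun y : R => normc ((y%:C)%C - f x)) \o (S ^~ x)); last by [].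
  have : continuous (fun y : R => normc ((y%:C)%C - f x)).
    rewrite (_ : (fun _ => _) = fun y => Num.sqrt ((y - Repart f x) ^+ 2 + (Impart f x) ^+ 2)).
      move=> y; apply: continuous_comp; last exact: sqrt_continuous.
      apply: cvgD; last exact: cvg_cst.
      rewrite expr2 (_ : (fun _ => _) = fun y => (y - Repart f x) * (y - Repart f x)) //.
      apply: cvgM; apply: cvgB; by [exact: cvg_id|exact: cvg_cst].
    apply/funext => y; rewrite normcE /Repart /Impart; case: (f x) => a b /=.
    by rewrite sub0r sqrrN.
  move=> /(_ (H x)) c; exact: (cvg_comp _ _ (cH x) c).
(* the integrals over a cube tend to 0 by continuity of the embedding into the locally
   integrable functions, and Fatou's lemma passes to the pointwise limit *)
have zero (N : nat) : (\int[mu]_(x in cube N%:R) (normc (toC H x - f x))%:E)%E = 0%E.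
  have [C HC] := tibf_cont HE (@compact_cube R n N%:R).
  apply/eqP; rewrite eq_le integral_ge0 ?andbT; last by move=> x _; rewrite lee_fin normc_ge0.
  apply: (@le_trans _ _ (\int[mu]_(x in cube N%:R)
     limn_einf (fun k => (normc (toC (S k) x - f x))%:E))%E).
    apply: le_of_eq; apply: eq_integral => x _.
    by rewrite (cvg_limn_einf_sup (pointwise x)).
  apply: le_trans.
    refine (@fatou _ _ _ mu _ (measurable_cube N%:R) (fun k x => (normc (toC (S k) x - f x))%:E) _ _).
      by move=> k; apply/measurable_EFinP; exact: measurable_funTS.
    by move=> k x _; rewrite lee_fin normc_ge0.
  pose I k := (\int[mu]_(x in cube N%:R) (normc (toC (S k) x - f x))%:E)%E.
  have I0 : I @ \oo --> 0%E.
    apply: (@squeeze_cvge _ _ _ _ (cst 0%E) _ (fun k => (C * fnorm E (toC (S k) \- f))%:E)).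
    - apply: nearW => k; rewrite integral_ge0/=; last by move=> x _; rewrite lee_fin normc_ge0.
      exact: HC (Edf k).
    - exact: cvg_cst.
    - apply: cvg_EFin; first exact: nearW.
      by rewrite -(mulr0 C); exact: cvgMr.
  by rewrite (cvg_limn_einf_sup I0).
have HfE (N : nat) : {ae mu, forall x, cube N%:R x -> toC H x = f x}.
  have mm : measurable_fun (cube N%:R) (fun x => (normc (toC H x - f x))%:E).
    by apply/measurable_EFinP; exact: measurable_funTS.
  have [U _] := ae_eq_integral_abs mu (measurable_cube N%:R) mm.
  have U0 : (\int[mu]_(x in cube N%:R) `|(normc (toC H x - f x))%:E| = 0)%E.
    rewrite -[RHS](zero N); apply: eq_integral => x _.
    by rewrite abse_EFin ger0_norm// normc_ge0.
  apply: (@filterS _ _ (ae_filter_ringOfSetsType mu) _ _ _ (U U0)) => x H1 cx.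
  have [] := H1 cx => /eq0_normc /eqP.
  by rewrite subr_eq0 => /eqP.
have aeHf : {ae mu, forall x, f x = toC H x}.
  apply: (@filterS _ _ (ae_filter_ringOfSetsType mu) _ _ _ (ae_foralln HfE)) => x Hx; symmetry.
  apply: (Hx (Num.bound `|x|)).
  by apply: (cube_le _ (cube_norm x)); rewrite ltW// archi_boundP.
have mnf := measurable_normc mfr mfi.
have LH : L1loc (toC H).
  split.
  - by rewrite (_ : Repart _ = H).
  - rewrite (_ : Impart _ = cst 0); first exact: measurable_cst.
    by apply/funext.
  - move=> K cK; apply: (le_lt_trans _ (fK K cK)).
    apply: le_of_eq.
    apply: ge0_ae_eq_integral.
    + exact: measurable_compact.
    + apply/measurable_EFinP; apply: measurable_funTS.
      under eq_fun do rewrite /toC normc_real.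
      exact: measurableT_comp.
    + by apply/measurable_EFinP; exact: measurable_funTS.
    + by move=> x _; rewrite lee_fin normc_ge0.
    + by move=> x _; rewrite lee_fin normc_ge0.
    + by apply: (@filterS _ _ (ae_filter_ringOfSetsType mu) _ _ _ aeHf) => x -> _.
have [EH NH] := tibf_ae HE Ef LH aeHf.
split=> //; rewrite /RN NH.
apply/ler_addgt0Pl => e e0.
move/cvgrPdist_lt: cf => /(_ _ e0) [k _ /(_ k (leqnn _))].
rewrite sub0r normrN => Hk.
have -> : f = toC (S k) \+ (fun x => -1 * (toC (S k) \- f) x).
  by apply/funext => x /=; rewrite mulN1r opprB addrC subrK.
apply: (le_trans (tibf_norm_add HE (ES k) (tibf_scale HE _ (Edf k)))).
rewrite (tibf_norm_scale HE)// normcN normc1 mul1r addrC lerD//.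
  by rewrite (le_trans (ler_norm _))// ltW.
have := diff k 0%N (leq0n _).
rewrite (_ : S k \- S 0%N = S k); last by apply/funext => x; rewrite /S /= big_ord0 subr0.
move/le_trans; apply; rewrite expr0 -[leRHS]mulr1 ler_wpM2l ?mulr_ge0// lerBlDr lerDl.
Qed.

End RealFunctions.

(** * Weight systems *)

Section Quantifiers.
Context {R : realType}.

Lemma quant_impl c (P Q : {posnum R} -> {posnum R} -> Prop) :
  (forall l m, P l m -> Q l m) -> quant c P -> quant c Q.
Proof. by move=> PQ; case: c => /= H l; have [m /PQ] := H l; exists m. Qed.

Lemma quant_comp c (P Q T : {posnum R} -> {posnum R} -> Prop) :
  (forall l m k, P l m -> Q m k -> T l k) -> quant c P -> quant c Q -> quant c T.
Proof.
move=> PQ; case: c => /= HP HQ l.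
  by have [m Pm] := HP l; have [k Qk] := HQ m; exists k; exact: PQ Qk.
by have [m Qm] := HQ l; have [k Pk] := HP m; exists k; exact: PQ Qm.
Qed.

End Quantifiers.

Lemma wf_continuous (R : realType) n (W : weight_function_system R n) l : continuous (W l).
Proof. by have [] := wf_weight W l. Qed.

Lemma wf_ge1 (R : realType) n (W : weight_function_system R n) l x : 1 <= W l x.
Proof. by have [_] := wf_weight W l; exact. Qed.

Lemma wf_gt0 (R : realType) n (W : weight_function_system R n) l x : 0 < W l x.
Proof. exact: lt_le_trans ltr01 (wf_ge1 W l x). Qed.

Section WeightSequenceLemmas.
Context {R : realType} {n : nat}.
Local Notation mi := (multi_index n).
Implicit Types (M N : weight_sequence_system R n) (al be : mi) (xi : 'I_n -> R).

Lemma deg_madd al be : deg (madd al be) = (deg al + deg be)%N.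
Proof. by rewrite /deg -big_split/=; apply: eq_bigr => i _; rewrite ffunE. Qed.

Lemma ws_gt0 M l al : 0 < M l al.
Proof. by have [] := ws_weight M l. Qed.

(** The constant [K] absorbs all exponential factors of the later estimates; [[L]] and
[[wI]] have to be applied in opposite orders in the two cases. *)
Lemma wI_L c N (K : R) : 0 < K -> cond_L c N -> cond_wI c N ->
  quant c (fun lam mu : {posnum R} => forall r : R, 0 < r -> exists2 C : R, 0 < C &
    forall al be, N mu al * r ^+ deg be * K ^+ deg (madd al be) <= C * N lam (madd al be)).
Proof.
move=> K0; case: c => L wI lam.
  have [m1 [H H0 HH]] := wI lam.
  have [mu [C1 C10 H1]] := L (K * H) (mulr_gt0 K0 H0) m1.
  exists mu => r r0; have [C2 C20 H2] := HH (r * K * H) (mulr_gt0 (mulr_gt0 r0 K0) H0).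
  exists (C1 * C2) => [|al be]; first exact: mulr_gt0.
  have h1 := H1 al; have h2 := H2 al be.
  have Ha : 0 < H ^+ deg (madd al be) by rewrite exprn_gt0.
  rewrite -(ler_pM2l Ha) deg_madd.
  apply: (@le_trans _ _ ((K * H) ^+ deg al * N mu al * (r * K * H) ^+ deg be)).
    by rewrite !exprD !exprMn; apply: le_of_eq; ring.
  apply: (@le_trans _ _ (C1 * N m1 al * (r * K * H) ^+ deg be)).
    by rewrite ler_wpM2r// exprn_ge0// ltW// !mulr_gt0.
  rewrite -mulrA; apply: (@le_trans _ _ (C1 * (C2 * H ^+ deg (madd al be) * N lam (madd al be)))).
    by rewrite ler_wpM2l// ltW.
  by rewrite deg_madd; apply: le_of_eq; ring.
have [l1 [H H0 HH]] := wI lam.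
have [mu [C1 C10 H1]] := L (K * H) (mulr_gt0 K0 H0) l1.
exists mu => r r0; have [C2 C20 H2] := HH r r0.
exists (C1 * C2) => [|al be]; first exact: mulr_gt0.
have h1 := H1 (madd al be); have h2 := H2 al be.
apply: (@le_trans _ _ (C2 * H ^+ deg (madd al be) * N l1 (madd al be) * K ^+ deg (madd al be))).
  by rewrite ler_wpM2r// exprn_ge0// ltW.
apply: (@le_trans _ _ (C2 * (C1 * N mu (madd al be)))); last by rewrite mulrA [C2 * _]mulrC.
apply: (@le_trans _ _ (C2 * ((K * H) ^+ deg (madd al be) * N l1 (madd al be)))).
  by rewrite exprMn; apply: le_of_eq; ring.
by rewrite ler_wpM2l// ltW.
Qed.

Lemma I_L c M (K : R) : 0 < K -> cond_L c M -> cond_I c M ->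
  quant3 c (fun lam mu nu : {posnum R} => exists2 C : R, 0 < C &
    forall al be, M mu al * M nu be * K ^+ deg (madd al be) <= C * M lam (madd al be)).
Proof.
move=> K0; case: c => L I.
  move=> lam; have [m1 [n1 [C [H [C0 H0 HH]]]]] := I lam.
  have [mu [C1 C10 H1]] := L (K * H) (mulr_gt0 K0 H0) m1.
  have [nu [C2 C20 H2]] := L (K * H) (mulr_gt0 K0 H0) n1.
  exists mu, nu, (C1 * C2 * C) => [|al be]; first by rewrite !mulr_gt0.
  have h1 := H1 al; have h2 := H2 be; have h := HH al be.
  have Ha : 0 < H ^+ deg (madd al be) by rewrite exprn_gt0.
  rewrite -(ler_pM2l Ha).
  apply: (@le_trans _ _ (((K * H) ^+ deg al * M mu al) * ((K * H) ^+ deg be * M nu be))).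
    by rewrite deg_madd !exprD !exprMn; apply: le_of_eq; ring.
  apply: (@le_trans _ _ ((C1 * M m1 al) * (C2 * M n1 be))).
    by apply: ler_pM => //; rewrite mulr_ge0 ?exprn_ge0 ?ltW ?mulr_gt0 ?ws_gt0.
  apply: (@le_trans _ _ ((C1 * C2) * (M m1 al * M n1 be))).
    by apply: le_of_eq; ring.
  apply: (@le_trans _ _ ((C1 * C2) * (C * H ^+ deg (madd al be) * M lam (madd al be)))).
    by rewrite ler_wpM2l// ltW// mulr_gt0.
  by apply: le_of_eq; ring.
move=> mu nu; have [l1 [C [H [C0 H0 HH]]]] := I mu nu.
have [lam [C1 C10 H1]] := L (K * H) (mulr_gt0 K0 H0) l1.
exists lam, (C * C1) => [|al be]; first exact: mulr_gt0.
have h1 := H1 (madd al be); have h := HH al be.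
apply: (@le_trans _ _ (C * H ^+ deg (madd al be) * M l1 (madd al be) * K ^+ deg (madd al be))).
  by rewrite ler_wpM2r// exprn_ge0// ltW.
apply: (@le_trans _ _ (C * ((K * H) ^+ deg (madd al be) * M l1 (madd al be)))).
  by rewrite exprMn; apply: le_of_eq; ring.
by rewrite -[C * C1 * _]mulrA ler_wpM2l// ltW.
Qed.

(** Beyond finitely many multi-indices the root of order [deg al] of [M al] exceeds [r]; the
sum [S] takes care of the others. *)
Lemma weight_sequence_growth (M : mi -> R) (r : R) : is_weight_sequence M -> 0 < r ->
  exists2 C : R, 0 < C & forall al, r ^+ deg al <= C * M al.
Proof.
move=> [M0 _ HM] r0; have [k Hk] := HM r.
pose f (g : {ffun 'I_n -> 'I_k.+1}) : mi := [ffun i => g i : nat].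
pose S := \sum_(g : {ffun 'I_n -> 'I_k.+1}) r ^+ deg (f g) / M (f g).
have t0 al : 0 <= r ^+ deg al / M al by rewrite divr_ge0 ?exprn_ge0 ?ltW.
exists (S + 1) => [|al]; first by rewrite ltr_wpDl// sumr_ge0.
have [kal|alk] := leqP k.+1 (deg al).
  have d0 : (0 < deg al)%N by exact: leq_trans kal.
  have h := Hk al (ltnW kal).
  apply: (@le_trans _ _ (M al)); last by rewrite ler_peMl ?lerDr ?sumr_ge0// ltW.
  have -> : M al = (M al `^ (deg al)%:R^-1) ^+ deg al.
    rewrite -powR_mulrn ?powR_ge0// -powRrM mulVf ?pnatr_eq0 -?lt0n//.
    by rewrite powRr1// ltW.
  by rewrite lerXn2r// nnegrE ?ltW// (lt_le_trans r0).
have lt_al i : (al i < k.+1)%N.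
  by apply: leq_ltn_trans alk; rewrite /deg (bigD1 i)//= leq_addr.
pose g : {ffun 'I_n -> 'I_k.+1} := [ffun i => Ordinal (lt_al i)].
have fg : f g = al by apply/ffunP => i; rewrite !ffunE.
rewrite -ler_pdivrMr// (le_trans _ (_ : S <= _)) ?lerDl//.
by rewrite /S (bigD1 g)//= fg lerDl sumr_ge0.
Qed.

(** ** The associated function of a weight sequence *)

Definition mono (xi : 'I_n -> R) al : R := \prod_i xi i ^+ al i.

Lemma prod_list (xi : 'I_n -> R) (s : seq 'I_n) :
  \prod_(i <- s) xi i = mono xi (mindex s).
Proof.
elim: s => [|j s IH].
  by rewrite big_nil /mono big1// => i _; rewrite ffunE expr0.
rewrite big_cons IH /mono (bigD1 j)//= [RHS](bigD1 j)//= !ffunE /= eqxx add1n exprS mulrA.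
by congr (_ * _); apply: eq_bigr => i /negbTE ij; rewrite !ffunE /= eq_sym ij.
Qed.

Lemma normr_mono xi al : `|mono xi al| = mono (fun i => `|xi i|) al.
Proof. by rewrite /mono normr_prod; apply: eq_bigr => i _; rewrite normrX. Qed.

Lemma mono_le_deg xi al (r : R) : (forall i, 0 <= xi i <= r) -> mono xi al <= r ^+ deg al.
Proof.
move=> H; rewrite /deg expr_sum; apply: ler_prod => i _.
by have /andP[h1 h2] := H i; rewrite exprn_ge0//= lerXn2r// nnegrE// (le_trans h1).
Qed.

(** The associated function in the sense of Mandelbrojt, without the logarithm. *)
Definition assoc_fun (M : mi -> R) (xi : 'I_n -> R) : R :=
  sup [set mono (fun i => `|xi i|) al / M al | al in [set: mi]].

Section AssociatedFunction.
Variables (M : mi -> R) (wM : is_weight_sequence M).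

Let assoc_bound xi : has_ubound [set mono (fun i => `|xi i|) al / M al | al in [set: mi]].
Proof.
have r0 : 0 < 1 + \sum_i `|xi i| by rewrite ltr_wpDr// sumr_ge0.
have [C C0 HC] := weight_sequence_growth wM r0.
exists C => _ [al _ <-]; have [M0 _ _] := wM; rewrite ler_pdivrMr// (le_trans _ (HC al))//.
apply: mono_le_deg => i; rewrite normr_ge0 /= (bigD1 i)//= addrCA lerDl.
by rewrite addr_ge0// sumr_ge0.
Qed.

Lemma mono_le_assoc xi al : `|mono xi al| <= assoc_fun M xi * M al.
Proof.
have [M0 _ _] := wM; rewrite normr_mono -ler_pdivrMr//.
by apply: ub_le_sup; [exact: assoc_bound|exists al].
Qed.

Lemma assoc_le xi (B : R) : (forall al, mono (fun i => `|xi i|) al / M al <= B) ->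
  assoc_fun M xi <= B.
Proof.
move=> H; apply: ge_sup; last by move=> _ [al _ <-].
by exists (mono (fun i => `|xi i|) [ffun=> 0%N] / M [ffun=> 0%N]); exists [ffun=> 0%N].
Qed.

Lemma assoc_ge1 xi : 1 <= assoc_fun M xi.
Proof.
have [_ M1 _] := wM; have := mono_le_assoc xi [ffun=> 0%N].
have -> : mono xi [ffun=> 0%N] = 1 by rewrite /mono big1// => i _; rewrite ffunE expr0.
by rewrite M1 mulr1 normr1.
Qed.

End AssociatedFunction.

Lemma assoc_anti (M M' : mi -> R) xi : is_weight_sequence M -> is_weight_sequence M' ->
  (forall al, M al <= M' al) -> assoc_fun M' xi <= assoc_fun M xi.
Proof.
move=> wM wM' MM'; apply: assoc_le => al.
have [M0 _ _] := wM; have [M0' _ _] := wM'.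
rewrite ler_pdivrMr// -normr_mono (le_trans (mono_le_assoc wM _ _))// ler_wpM2l//.
by rewrite (le_trans _ (assoc_ge1 wM _)).
Qed.

(** ** Subgradients of log-convex sequences *)

Lemma convex_functionP (F : 'rV[R]_n -> R) (D : set 'rV[R]_n) (x y : 'rV[R]_n) (t : R) :
  @convex_function R 'rV[R]_n D F -> D x -> D y -> 0 <= t -> t <= 1 ->
  F (t *: x + (1 - t) *: y) <= t * F x + (1 - t) * F y.
Proof.
move=> cF Dx Dy t0 t1.
exact: (cF (Itv01 t0 t1) x y (mem_set Dx) (mem_set Dy)).
Qed.

(** Hahn-Banach extension of the supporting functional, one coordinate at a time.  Only the
coordinates along which [a] is interior to the orthant can be treated. *)
Lemma subgradient (F : 'rV[R]_n -> R) (a : 'rV[R]_n) (l : seq 'I_n) :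
  @convex_function R 'rV[R]_n [set x | forall i, 0 <= x ord0 i] F ->
  (forall i, 0 <= a ord0 i) -> (forall i, i \in l -> 0 < a ord0 i) ->
  exists k : 'I_n -> R, forall x : 'rV[R]_n, (forall i, 0 <= x ord0 i) ->
    (forall i, i \notin l -> x ord0 i = a ord0 i) ->
    F a + \sum_i k i * (x ord0 i - a ord0 i) <= F x.
Proof.
move=> cF a0; elim: l => [|j l IH] al.
  exists (fun=> 0) => x _ xa; rewrite big1 ?addr0; last by move=> i _; rewrite mul0r.
  by rewrite (_ : x = a)//; apply/rowP => i; exact: xa.
have [|k Hk] := IH; first by move=> i il; apply: al; rewrite inE il orbT.
have aj : 0 < a ord0 j by apply: al; rewrite inE eqxx.
pose g (x : 'rV[R]_n) := F x - F a - \sum_(i | i != j) k i * (x ord0 i - a ord0 i).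
pose D (x : 'rV[R]_n) := (forall i, 0 <= x ord0 i) /\
  (forall i, i \notin j :: l -> x ord0 i = a ord0 i).
(* the difference quotients of [g] to the left of [a] are below those to the right, because
   [g] is nonnegative at the point [z] of the segment where the coordinate [j] is that of [a] *)
have key x y : D x -> D y -> x ord0 j - a ord0 j < 0 -> 0 < y ord0 j - a ord0 j ->
    g x / (x ord0 j - a ord0 j) <= g y / (y ord0 j - a ord0 j).
  move=> [x0 xl] [y0 yl]; set t := x ord0 j - a ord0 j; set s := y ord0 j - a ord0 j => t0 s0.
  have st : 0 < s - t by rewrite subr_gt0 (lt_trans t0).
  pose p := s / (s - t).
  have p0 : 0 <= p by rewrite divr_ge0// ltW.
  have p1 : p <= 1 by rewrite ler_pdivrMr// mul1r lerBrDl gerDr ltW.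
  have q0 : 1 - p = - t / (s - t) by rewrite /p; field; rewrite gt_eqF.
  pose z := p *: x + (1 - p) *: y.
  have zE i : z ord0 i = p * x ord0 i + (1 - p) * y ord0 i by rewrite !mxE.
  have z0 i : 0 <= z ord0 i by rewrite zE addr_ge0// mulr_ge0// subr_ge0.
  have zj : z ord0 j = a ord0 j.
    rewrite zE; have -> : x ord0 j = a ord0 j + t by rewrite /t addrC subrK.
    have -> : y ord0 j = a ord0 j + s by rewrite /s addrC subrK.
    by rewrite q0 /p; field; rewrite gt_eqF.
  have zl i : i \notin l -> z ord0 i = a ord0 i.
    have [->//|ij] := eqVneq i j => il.
    rewrite zE xl ?yl ?inE ?negb_or ?ij//; ring.
  have h1 := Hk z z0 zl.
  have h2 := convex_functionP cF x0 y0 p0 p1.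
  have gz : 0 <= p * g x + (1 - p) * g y.
    rewrite /g -subr_ge0 in h2 h1 *.
    have E : \sum_i k i * (z ord0 i - a ord0 i) =
        p * (\sum_(i | i != j) k i * (x ord0 i - a ord0 i)) +
        (1 - p) * (\sum_(i | i != j) k i * (y ord0 i - a ord0 i)).
      rewrite (bigD1 j)//= zj subrr mulr0 add0r !mulr_sumr -big_split/=.
      by apply: eq_bigr => i _; rewrite zE; ring.
    move: h1 h2; rewrite -/z E; lra.
  rewrite ler_ndivrMr// -subr_ge0.
  have -> : g x - g y / s * t = (s - t) / s * (p * g x + (1 - p) * g y).
    by rewrite q0 /p; field; rewrite gt_eqF// gt_eqF.
  by rewrite mulr_ge0// divr_ge0// ltW.
pose A := [set g x / (x ord0 j - a ord0 j) | x in [set x | D x /\ x ord0 j - a ord0 j < 0]].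
pose e : 'rV[R]_n := delta_mx ord0 j.
have ej (c : R) : (a + c *: e) ord0 j - a ord0 j = c by rewrite !mxE !eqxx mulr1 addrC addKr.
have De (c : R) : 0 <= a ord0 j + c -> D (a + c *: e).
  move=> c0; split=> i; rewrite !mxE eqxx/=.
    by have [->|_] := eqVneq i j; rewrite ?mulr1// mulr0 addr0.
  by rewrite inE negb_or => /andP[/negbTE -> _]; rewrite mulr0 addr0.
have A0 : A !=set0.
  exists (g (a + (- a ord0 j) *: e) / (- a ord0 j)).
  exists (a + (- a ord0 j) *: e); last by rewrite ej.
  split; last by rewrite ej oppr_lt0.
  by apply: De; rewrite subrr.
have ubA y : D y -> 0 < y ord0 j - a ord0 j -> ubound A (g y / (y ord0 j - a ord0 j)).
  by move=> Dy y0 _ [x [Dx x0] <-]; exact: key.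
have hA : has_ubound A.
  exists (g (a + 1 *: e) / ((a + 1 *: e) ord0 j - a ord0 j)).
  by apply: ubA; rewrite ?ej//; apply: De; rewrite addr_ge0// ltW.
pose kj := sup A.
exists (fun i => if i == j then kj else k i) => x x0 xl.
rewrite (bigD1 j)//= eqxx.
rewrite (_ : \sum_(i | i != j) _ = \sum_(i | i != j) k i * (x ord0 i - a ord0 i)); last first.
  by apply: eq_bigr => i /negbTE ->.
suff : kj * (x ord0 j - a ord0 j) <= g x by rewrite /g; lra.
have Dx : D x by [].
have [xj|xj|xj] := ltgtP (x ord0 j - a ord0 j) 0.
- rewrite -ler_ndivrMr//; apply: ub_le_sup => //; by exists x.
- by rewrite -ler_pdivlMr//; apply: ge_sup => //; exact: ubA.
- rewrite xj mulr0 /g -addrA -opprD subr_ge0.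
  have xl' i : i \notin l -> x ord0 i = a ord0 i.
    have [-> _|ij il] := eqVneq i j; first by apply/eqP; rewrite -subr_eq0 xj.
    by apply: xl; rewrite inE negb_or ij.
  apply: le_trans (Hk x x0 xl'); rewrite lerD2l [leRHS](bigD1 j)//= xj mulr0 add0r.
  exact: lexx.
Qed.

(** Along the coordinates where [al] vanishes the slope can be chosen very negative, because
the logarithms of a weight sequence grow superlinearly. *)
Lemma log_convex_subgradient (M : mi -> R) al : is_weight_sequence M -> log_convex_seq M ->
  exists2 xi : 'I_n -> R, (forall i, 0 < xi i) &
    forall be, mono xi be / M be <= mono xi al / M al.
Proof.
move=> wM [F [cF FE]]; have [M0 _ _] := wM.
pose pt be : 'rV[R]_n := \row_i (be i)%:R.
pose l := [seq i <- enum 'I_n | (0 < al i)%N].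
have lE i : (i \in l) = (0 < al i)%N by rewrite mem_filter mem_enum andbT.
have [||k Hk] := subgradient (a := pt al) (l := l) cF.
- by move=> i; rewrite mxE.
- by move=> i; rewrite lE mxE ltr0n.
pose K := \sum_i `|k i|.
have K0 : 0 <= K by exact: sumr_ge0.
have [C C0 HC] := weight_sequence_growth wM (expR_gt0 K).
have low (be : mi) : K * (deg be)%:R - ln C <= ln (M be).
  have := HC be; rewrite -expRM_natl => h.
  rewrite lerBlDl -lnM ?posrE// -[leLHS]expRK ler_ln ?posrE ?expR_gt0 ?mulr_gt0//.
  by rewrite mulrC.
(* [- A] is the slope along the coordinates where [al] vanishes: as soon as [be] is positive
   there, the growth bound [low] alone gives the inequality *)
pose A := `|K * (deg al)%:R + ln C + ln (M al)|.
pose kk i := if (0 < al i)%N then k i else - A.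
have main be : ln (M al) + \sum_i kk i * ((be i)%:R - (al i)%:R) <= ln (M be).
  have kS (ga : mi) : \sum_i `|k i| * (ga i)%:R <= K * (deg ga)%:R.
    rewrite /K mulr_suml; apply: ler_sum => i _; rewrite ler_wpM2l// ler_nat.
    by rewrite /deg (bigD1 i)//= leq_addr.
  have [H0|/forallPn[j]] := boolP [forall i, (0 < al i)%N || (be i == 0%N)].
    have := Hk (pt be); rewrite /pt !FE => H1; apply: le_trans (H1 _ _); last 2 first.
    - by move=> i; rewrite mxE.
    - move=> i; rewrite lE -eqn0Ngt !mxE => /eqP ai.
      by have := forallP H0 i; rewrite ai /= => /eqP ->.
    rewrite lerD2l; apply: le_of_eq.
    apply: eq_bigr => i _; rewrite !mxE /kk; case: ifPn => // ai.
    have := forallP H0 i; rewrite (negbTE ai) /= => /eqP ->.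
    by move: ai; rewrite -eqn0Ngt => /eqP ->; rewrite subrr !mulr0.
  rewrite negb_or -eqn0Ngt => /andP[/eqP aj bj].
  apply: le_trans (low be).
  have S : \sum_i kk i * ((be i)%:R - (al i)%:R) <= K * (deg be)%:R + K * (deg al)%:R - A.
    apply: (@le_trans _ _ (\sum_i (`|k i| * (be i)%:R + `|k i| * (al i)%:R - (if i == j then A else 0)))).
      apply: ler_sum => i _; rewrite /kk; case: ifPn => ai.
        have /negbTE -> : i != j by apply: contraTneq ai => ->; rewrite aj.
        rewrite subr0 -mulrDr (le_trans (ler_norm _))// normrM ler_wpM2l//.
        by rewrite (le_trans (ler_normB _ _))// !ger0_norm.
      move: ai; rewrite -eqn0Ngt => /eqP ->; rewrite subr0 mulr0 addr0.
      have A0 : 0 <= A by exact: normr_ge0.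
      have kb : 0 <= `|k i| * (be i)%:R by rewrite mulr_ge0.
      case: eqP => [ij|_]; last by rewrite subr0 mulNr (le_trans _ kb)// oppr_le0 mulr_ge0.
      have bi : 1 <= (be i)%:R :> R by rewrite ler1n lt0n ij.
      have Ab : A <= A * (be i)%:R by rewrite ler_peMr.
      by rewrite mulNr; lra.
    rewrite sumrB big_split/= -big_mkcond big_pred1_eq lerD2r; apply: lerD; exact: kS.
  move: S; have := ler_norm (K * (deg al)%:R + ln C + ln (M al)); rewrite -/A; lra.
have ME be : M be = expR (ln (M be)) by rewrite lnK// posrE.
have monoE be : mono (fun i => expR (kk i)) be = expR (\sum_i kk i * (be i)%:R).
  by rewrite expR_sum /mono; apply: eq_bigr => i _; rewrite -expRM_natl mulrC.
exists (fun i => expR (kk i)) => [i|be]; first exact: expR_gt0.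
rewrite !monoE (ME be) (ME al) -!expRB ler_expR; have := main be.
rewrite (_ : \sum_i kk i * _ = \sum_i kk i * (be i)%:R - \sum_i kk i * (al i)%:R); first by lra.
by rewrite -sumrB; apply: eq_bigr => i _; rewrite mulrBr.
Qed.

End WeightSequenceLemmas.

(** * A uniform boundedness principle *)

Section GeometricSeries.
Context {R : realType}.

(** The ratio [1/4] keeps the tail of the series below its [k]-th term as long as that term
nearly attains the supremum of the [k]-th seminorm. *)
Definition gsum (g : nat -> R) : R := limn (fun m => \sum_(k < m) 4^-1 ^+ k * g k).

Definition bounded_seq (g : nat -> R) : Prop := exists B, forall k, `|g k| <= B.

Lemma gsum_cvg g : bounded_seq g -> (fun m => \sum_(k < m) 4^-1 ^+ k * g k) @ \oo --> gsum g.
Proof.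
move=> [B HB].
suff : cvgn (series (fun k => 4^-1 ^+ k * g k)).
  have -> : series (fun k => 4^-1 ^+ k * g k) = (fun m => \sum_(k < m) 4^-1 ^+ k * g k).
    by apply/funext => m; rewrite /series /= big_mkord.
  by [].
apply: normed_cvg; apply: (@series_le_cvg _ _ (geometric B 4^-1)) => [k|k|k|].
- exact: normr_ge0.
- rewrite /geometric /= mulr_ge0 ?exprn_ge0//.
  by rewrite (le_trans _ (HB 0%N)).
- rewrite /= normrM ger0_norm ?exprn_ge0// mulrC /geometric /= ler_wpM2r ?exprn_ge0//.
- by apply: is_cvg_geometric_series; rewrite gtr0_norm ?invf_lt1// ltr1n.
Qed.

Lemma gsum_bounded_functional : bounded_functional setT bounded_seq gsum 2.
Proof.
split.
- move=> a b g h [B HB] [C HC]; exists (`|a| * B + `|b| * C) => k.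
  by rewrite (le_trans (ler_normD _ _))// !normrM lerD// ler_wpM2l.
- move=> a b g h Dg Dh; apply/cvg_lim => //.
  rewrite (_ : (fun m => _) = (fun m => a * (\sum_(k < m) 4^-1 ^+ k * g k) + b * (\sum_(k < m) 4^-1 ^+ k * h k))).
    by apply: cvgD; apply: cvgMr; exact: gsum_cvg.
  by apply/funext => m; rewrite !mulr_sumr -big_split/=; apply: eq_bigr => k _; ring.
- move=> g B [C HC] HB.
  have B0 : 0 <= B by rewrite (le_trans _ (HB 0%N I)).
  have Dg : bounded_seq g by exists C.
  have partial m : `|\sum_(k < m) 4^-1 ^+ k * g k| <= 2 * B.
    apply: (@le_trans _ _ (2 * B * (1 - 4^-1 ^+ m))); last first.
      by rewrite ler_piMr ?mulr_ge0// gerBl exprn_ge0.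
    elim: m => [|m IH]; first by rewrite big_ord0 normr0 expr0 subrr mulr0.
    rewrite big_ord_recr /= (le_trans (ler_normD _ _))//.
    rewrite (le_trans (lerD IH (_ : _ <= 4^-1 ^+ m * B)))//.
      by rewrite normrM ger0_norm ?exprn_ge0// ler_wpM2l ?exprn_ge0//; exact: HB.
    rewrite exprS; have : 0 <= (4^-1 : R) ^+ m by rewrite exprn_ge0.
    move: (4^-1 ^+ m) => u u0; have : 0 <= B * u by exact: mulr_ge0.
    lra.
  have cn : (fun m => `|\sum_(k < m) 4^-1 ^+ k * g k|) @ \oo --> `|gsum g|.
    by apply: cvg_norm; exact: gsum_cvg.
  rewrite -(cvg_lim _ cn)//; apply: limr_le; last exact: nearW.
  by apply/cvg_ex; exists `|gsum g|.
Qed.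

End GeometricSeries.

Section Gliding.
Context {R : realType} {n : nat}.
Local Notation V := 'rV[R]_n.
Variables (E : fspace R n) (HE : is_tibf_bounded_type E) (solE : solid E).
Local Notation RE := (RE E).
Local Notation RN := (RN E).

Definition ssum (u : nat -> V -> R) : V -> R := fun x => gsum (fun k => u k x).

Definition cutoff (d : R) (y : V) (h : V -> R) : V -> R :=
  fun x => \1_(cube d) (x - y) * h x.

Lemma measurable_cutoff d y h : measurable_fun setT h -> measurable_fun setT (cutoff d y h).
Proof.
move=> mh; apply: measurable_funM => //.
apply: (measurableT_comp (measurable_indic (measurable_cube d))).
apply: measurable_fun_rV => i; rewrite (_ : (fun t : V => (t - y) ord0 i) = fun t => t ord0 i - y ord0 i).
  by apply: measurable_funB; [exact: measurable_coor|exact: measurable_cst].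
by apply/funext => t; rewrite !mxE.
Qed.

Lemma cutoff_le d y h x : `|cutoff d y h x| <= `|h x|.
Proof.
rewrite /cutoff normrM indicE; case: (_ \in _) => /=; first by rewrite normr1 mul1r.
by rewrite normr0 mul0r.
Qed.

Lemma RE_cutoff d y h : RE h -> RE (cutoff d y h) /\ RN (cutoff d y h) <= RN h.
Proof.
move=> Eh; have [||? N] := @RE_le _ _ _ HE solE (cutoff d y h) h 1 Eh ler01.
- by apply: measurable_cutoff; exact: RE_measurable Eh.
- by move=> x; rewrite mul1r; exact: cutoff_le.
- by split=> //; rewrite mul1r in N.
Qed.

(** Local weighted seminorms are controlled by the unweighted norm, the weight being bounded
on cubes. *)
Lemma RE_cutoff_weight d y (v : V -> R) : continuous v -> exists2 C : R, 0 <= C &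
  forall h, RE h -> RE (cutoff d y (fun x => h x * v x)) /\
    RN (cutoff d y (fun x => h x * v x)) <= C * RN h.
Proof.
move=> cv; have [C HC] := continuous_locally_bounded cv (d + `|y|).
exists `|C| => // h Eh; have mh := RE_measurable HE Eh.
apply: (@RE_le _ _ _ HE solE) => // [|x].
  apply: measurable_cutoff; apply: measurable_funM => //; exact: continuous_measurable.
rewrite /cutoff indicE; have [xd|_] := boolP (_ \in _); last by rewrite mul0r normr0 mulr_ge0.
rewrite mul1r normrM mulrC ler_wpM2r// (le_trans (HC x _))// ?ler_norm//.
rewrite -[x](subrK y); apply: cubeD; last exact: cube_norm.
exact: set_mem.
Qed.

Section Sum.
Variables (u : nat -> V -> R) (beta : seq 'I_n -> R).
Hypothesis su : forall k, smooth (u k).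
Hypothesis bu : forall k s, RE (partials s (u k)) /\ RN (partials s (u k)) <= beta s.

Let ptw s : exists B, forall k x, `|partials s (u k) x| <= B.
Proof.
have [C C0 HC] := RE_Sobolev HE.
pose B := \sum_(t <- sobolev_lists n) `|beta (t ++ s)|.
exists (C * B) => k x; apply: HC => [|t tS].
  exact: smooth_partials.
rewrite -partials_cat; have [Et Nt] := bu k (t ++ s); split=> //.
rewrite (le_trans Nt)// (le_trans (ler_norm _))// /B.
by rewrite (big_rem t)//= lerDl sumr_ge0.
Qed.

Let Dptw s x : bounded_seq (fun k => partials s (u k) x).
Proof. by have [B HB] := ptw s; exists B. Qed.

Let bptw s (r : R) : exists B, forall k x, setT k -> cube r x -> `|partials s (u k) x| <= B.
Proof. by have [B HB] := ptw s; exists B. Qed.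

Lemma smooth_ssum : smooth (ssum u).
Proof. exact: (smooth_functional gsum_bounded_functional su Dptw bptw). Qed.

Lemma partials_ssum s : partials s (ssum u) = ssum (fun k => partials s (u k)).
Proof. exact: (partials_functional gsum_bounded_functional su Dptw bptw). Qed.

Lemma ssum_cvg s x : (fun m => \sum_(k < m) 4^-1 ^+ k * partials s (u k) x) @ \oo -->
  partials s (ssum u) x.
Proof. by rewrite partials_ssum; exact: gsum_cvg. Qed.

Lemma RE_ssum s (w : V -> R) (B : R) : continuous w ->
  (forall k, RE (fun x => partials s (u k) x * w x) /\
             RN (fun x => partials s (u k) x * w x) <= B) ->
  RE (fun x => partials s (ssum u) x * w x) /\
  RN (fun x => partials s (ssum u) x * w x) <= 2 * B.
Proof.
move=> cw H.
apply: (@RE_series _ _ _ HE (fun k x => 4^-1 ^+ k * (partials s (u k) x * w x))).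
- by move=> k; have [Hk _] := H k; have [] := RE_scale HE (4^-1 ^+ k) Hk.
- move=> k; have [Ek Nk] := H k; have [_ ->] := RE_scale HE (4^-1 ^+ k) Ek.
  by rewrite mulrC ger0_norm ?exprn_ge0// ler_wpM2r ?exprn_ge0.
- apply: measurable_funM; last exact: continuous_measurable.
  apply: measurable_partials; exact: smooth_ssum.
- move=> x; rewrite (_ : (fun _ => _) = (fun m => (\sum_(k < m) 4^-1 ^+ k * partials s (u k) x) * w x)).
    by apply: cvgMl; exact: ssum_cvg.
  by apply/funext => m; rewrite mulr_suml; apply: eq_bigr => k _; rewrite mulrA.
Qed.

Lemma RN_ssum_tail d y s (v : V -> R) (S : R) m : continuous v ->
  (forall k, (m <= k)%N -> RN (cutoff d y (fun x => partials s (u k) x * v x)) <= S) ->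
  RN (cutoff d y (fun x => (partials s (ssum u) x - \sum_(k < m) 4^-1 ^+ k * partials s (u k) x) * v x))
    <= 2 * (4^-1 ^+ m * S).
Proof.
move=> cv H; have [C C0 HC] := RE_cutoff_weight d y cv.
apply: (proj2 (@RE_series _ _ _ HE
  (fun k x => 4^-1 ^+ (m + k) * cutoff d y (fun x => partials s (u (m + k)%N) x * v x) x) _ _ _ _ _ _)).
- move=> k; have [Ek _] := bu (m + k) s; have [Hk _] := HC _ Ek.
  by have [] := RE_scale HE (4^-1 ^+ (m + k)) Hk.
- move=> k; have [Ek _] := bu (m + k) s; have [Hk _] := HC _ Ek.
  have [_ ->] := RE_scale HE (4^-1 ^+ (m + k)) Hk.
  rewrite ger0_norm ?exprn_ge0// exprD -!mulrA ler_wpM2l ?exprn_ge0// mulrC ler_wpM2r ?exprn_ge0//.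
  by apply: H; rewrite leq_addr.
- have mu (k : nat) := measurable_partials s (su k).
  apply: measurable_cutoff; apply: measurable_funM; last exact: continuous_measurable.
  apply: measurable_funB.
    apply: measurable_partials; exact: smooth_ssum.
  by apply: measurable_sum => k; apply: measurable_funM.
- move=> x; set T := fun m => \sum_(k < m) 4^-1 ^+ k * partials s (u k) x.
  rewrite (_ : (fun _ => _) = (fun j => \1_(cube d) (x - y) * ((T (m + j)%N - T m) * v x))).
    rewrite /cutoff; apply: cvgMr; apply: cvgMl; apply: cvgB; last exact: cvg_cst.
    have cT : T @ \oo --> partials s (ssum u) x by exact: (@ssum_cvg s x).
    by apply: (cvg_comp _ _ _ cT); exact: cvg_addnl.
  apply/funext => j; have -> : T (m + j)%N - T m =
      \sum_(k < j) 4^-1 ^+ (m + k) * partials s (u (m + k)%N) x.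
    by rewrite /T big_split_ord /= addrAC subrr add0r.
  rewrite mulr_suml mulr_sumr.
  by apply: eq_bigr => k _; rewrite /cutoff; ring.
Qed.

End Sum.

(** Sokal's form of the gliding hump: near-optimal elements are added with a sign that makes
the [k]-th seminorm of the partial sum large, and the tail cannot compensate for it. *)
Lemma gliding_hump (U : nat -> set (V -> R)) (d : R) (y : nat -> V) (s : nat -> seq 'I_n)
    (v : nat -> V -> R) (beta : seq 'I_n -> R) :
  (forall k, continuous (v k)) ->
  (forall k m, (k <= m)%N -> U m `<=` U k) ->
  (forall k u, U k u -> U k (fun x => - u x)) ->
  (forall u, U 0%N u -> smooth u) ->
  (forall u t, U 0%N u -> RE (partials t u) /\ RN (partials t u) <= beta t) ->
  (forall k, exists2 u, U k u &
     8 ^+ k <= RN (cutoff d (y k) (fun x => partials (s k) u x * v k x))) ->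
  exists u : nat -> V -> R, (forall k, U k (u k)) /\
    forall k, 2 ^+ k / 4 <=
      RN (cutoff d (y k) (fun x => partials (s k) (ssum u) x * v k x)).
Proof.
move=> cv Udec Usym Us Ub Uq.
pose q k (f : V -> R) := RN (cutoff d (y k) (fun x => partials (s k) f x * v k x)).
have U0 k u : U k u -> U 0%N u by apply: Udec.
pose Q k := [set q k u | u in U k].
pose S k := sup (Q k).
have QE k (f : V -> R) : RE (partials (s k) f) ->
    RE (cutoff d (y k) (fun x => partials (s k) f x * v k x)).
  by have [C _ HC] := RE_cutoff_weight d (y k) (cv k) => /HC[].
have hQ k : has_ubound (Q k).
  have [C C0 HC] := RE_cutoff_weight d (y k) (cv k).
  exists (C * beta (s k)) => _ [u Uu <-]; have [Eu Nu] := Ub u (s k) (U0 _ _ Uu).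
  by have [_ /le_trans] := HC _ Eu; apply; rewrite ler_wpM2l.
have Q0 k : Q k !=set0 by have [u Uu _] := Uq k; exists (q k u); exists u.
have S8 k : 8 ^+ k <= S k.
  have [u Uu /le_trans] := Uq k; apply.
  by apply: ub_le_sup; [exact: hQ|exists u].
have S0 k : 0 < S k by apply: lt_le_trans (S8 k); rewrite exprn_gt0.
have /choice[u0 Hu0] : forall k, exists u, U k u /\ 3 / 4 * S k <= q k u.
  move=> k; have e0 : 0 < S k / 4 by rewrite divr_gt0.
  have [_ [u Uu <-] /ltW h] := sup_adherent e0 (conj (Q0 k) (hQ k)).
  exists u; split=> //; apply: le_trans h; rewrite -/(S k); lra.
pose sgn k (X : V -> R) : R := if `[< 4^-1 ^+ k * q k (u0 k) <=
   q k (fun x => X x + 4^-1 ^+ k * u0 k x) >] then 1 else -1.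
pose X := fix X k : V -> R := if k is m.+1
  then (fun x => X m x + 4^-1 ^+ m * (sgn m (X m) * u0 m x)) else cst 0.
pose u k x := sgn k (X k) * u0 k x.
have Uu k : U k (u k).
  have [Uk _] := Hu0 k; rewrite /u /sgn; case: ifP => _.
    by rewrite (_ : (fun _ => _) = u0 k)//; apply/funext => x; rewrite mul1r.
  rewrite (_ : (fun _ => _) = (fun x => - u0 k x)); first exact: Usym.
  by apply/funext => x; rewrite mulN1r.
exists u; split=> // k.
have su j : smooth (u j) by apply: Us; apply: (U0 j).
have bu j t : RE (partials t (u j)) /\ RN (partials t (u j)) <= beta t.
  by apply: Ub; apply: (U0 j).
have sX m : smooth (X m).
  elim: m => [|m IH] /=; first exact: smooth_cst.
  exact: (smoothD IH (smoothZ (4^-1 ^+ m) (su m))).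
have XE m t : partials t (X m) = (fun x => \sum_(j < m) 4^-1 ^+ j * partials t (u j) x).
  elim: m => [|m IH].
    apply/funext => x; rewrite big_ord0 /=.
    by elim: t x => //= i t IHt x; rewrite (_ : partials t _ = cst 0) ?partial_cst//; exact/funext.
  rewrite (_ : X m.+1 = X m \+ (fun x => 4^-1 ^+ m * u m x))//.
  rewrite (partialsD _ (sX m) (smoothZ _ (su m))) (partialsZ _ _ (su m)) IH.
  by apply/funext => x; rewrite big_ord_recr.
have EX m t : RE (partials t (X m)).
  rewrite XE; elim: m => [|m IH].
    by rewrite (_ : (fun _ => _) = cst 0); [exact: RE0|apply/funext => x; rewrite big_ord0].
  rewrite (_ : (fun _ => _) = (fun x => \sum_(j < m) 4^-1 ^+ j * partials t (u j) x) \+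
      (fun x => 4^-1 ^+ m * partials t (u m) x)); last first.
    by apply/funext => x; rewrite big_ord_recr.
  have [Em _] := bu m t; have [Em' _] := RE_scale HE (4^-1 ^+ m) Em.
  by have [] := RE_add HE IH Em'.
(* one of the two signs works by the triangle inequality *)
have big : 4^-1 ^+ k * q k (u0 k) <= q k (X k.+1).
  have [Uk _] := Hu0 k; have su0 := Us _ (U0 _ _ Uk).
  have [E0 _] := Ub _ (s k) (U0 _ _ Uk).
  pose a x := partials (s k) (X k) x; pose b x := 4^-1 ^+ k * partials (s k) (u0 k) x.
  have plus : q k (fun x => X k x + 4^-1 ^+ k * u0 k x) =
      RN (cutoff d (y k) (fun x => (a x + b x) * v k x)).
    rewrite /q (partialsD _ (sX k) (smoothZ (4^-1 ^+ k) su0)) (partialsZ _ _ su0)//.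
  have minus : q k (fun x => X k x + 4^-1 ^+ k * (-1 * u0 k x)) =
      RN (cutoff d (y k) (fun x => (a x - b x) * v k x)).
    rewrite (_ : (fun x => _) = X k \- (fun x => 4^-1 ^+ k * u0 k x)); last first.
      by apply/funext => x /=; rewrite mulN1r mulrN.
    rewrite /q (partialsB _ (sX k) (smoothZ (4^-1 ^+ k) su0)) (partialsZ _ _ su0)//.
  rewrite /= /sgn; case: asboolP => [h|/negP]; last rewrite -ltNge => h.
    by rewrite (_ : (fun x => _) = (fun x => X k x + 4^-1 ^+ k * u0 k x))//; apply/funext => x; rewrite mul1r.
  have Eb : RE b by have [] := RE_scale HE (4^-1 ^+ k) E0.
  have [C _ HC] := RE_cutoff_weight d (y k) (cv k).
  have [Eab _] := RE_add HE (EX k (s k)) Eb; have [Eab' _] := RE_sub HE (EX k (s k)) Eb.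
  have [F1 _] := HC _ Eab; have [F2 _] := HC _ Eab'; have [F3 _] := HC _ E0.
  have [F4 N4] := RE_sub HE F1 F2.
  have [_ N5] := RE_scale HE (2 * 4^-1 ^+ k) F3.
  have E5 : cutoff d (y k) (fun x => (a x + b x) * v k x) \- cutoff d (y k) (fun x => (a x - b x) * v k x) =
     (fun x => 2 * 4^-1 ^+ k * cutoff d (y k) (fun x => partials (s k) (u0 k) x * v k x) x).
    by apply/funext => x; rewrite /cutoff /b /=; ring.
  have K0 : 0 <= 2 * (4^-1 : R) ^+ k by rewrite mulr_ge0// exprn_ge0.
  rewrite E5 N5 ger0_norm// in N4.
  rewrite -/(q k _) minus; move: h; rewrite plus => h.
  have : 2 * 4^-1 ^+ k * q k (u0 k) <=
    RN (cutoff d (y k) (fun x => (a x + b x) * v k x)) + RN (cutoff d (y k) (fun x => (a x - b x) * v k x)) by exact: N4.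
  rewrite -mulrA; lra.
have tl : RN (cutoff d (y k) (fun x => (partials (s k) (ssum u) x - partials (s k) (X k.+1) x) * v k x))
    <= 2 * (4^-1 ^+ k.+1 * S k).
  rewrite XE; apply: (@RN_ssum_tail u beta su bu) => // j kj.
  apply: ub_le_sup; first exact: hQ.
  by exists (u j) => //; apply: Udec (Uu j); exact: ltnW.
have Es : RE (partials (s k) (ssum u)).
  have := @RE_ssum u beta su bu (s k) (cst 1) (beta (s k)) (@cst_continuous _ _ _).
  have c1 h : (fun x => h x * cst 1 x) = h :> (V -> R) by apply/funext => x; rewrite /cst mulr1.
  by rewrite c1 => -[|//] j; rewrite c1; exact: bu.
have [C _ HC] := RE_cutoff_weight d (y k) (cv k).
have [F1 _] := HC _ Es; have [Ed _] := RE_sub HE Es (EX k.+1 (s k)); have [F2 _] := HC _ Ed.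
have [_ N1] := RE_sub HE F1 F2.
have E1 : cutoff d (y k) (fun x => partials (s k) (ssum u) x * v k x) \-
    cutoff d (y k) (fun x => (partials (s k) (ssum u) \- partials (s k) (X k.+1)) x * v k x) =
    cutoff d (y k) (fun x => partials (s k) (X k.+1) x * v k x).
  by apply/funext => x; rewrite /cutoff /=; ring.
rewrite E1 -/(q k _) in N1.
(* the [k]-th term is at least 3/4 and the tail at most 2/4 of [4^-k S_k], and [S_k >= 8^k] *)
have [_ Hk] := Hu0 k.
have p0 : 0 < (4^-1 : R) ^+ k by rewrite exprn_gt0.
have p1 : (4^-1 : R) ^+ k * 8 ^+ k = 2 ^+ k.
  by rewrite -exprMn; congr (_ ^+ k); field.
have p2 : 4^-1 ^+ k * 8 ^+ k <= 4^-1 ^+ k * S k by rewrite ler_pM2l.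
have p3 : 4^-1 ^+ k * (3 / 4 * S k) <= 4^-1 ^+ k * q k (u0 k) by rewrite ler_pM2l.
rewrite p1 in p2; rewrite exprS in tl.
rewrite -/(q k (ssum u)); move: tl N1 big p2 p3; rewrite -!mulrA.
rewrite [4^-1 ^+ k * (3 * _)]mulrCA [4^-1 ^+ k * (4^-1 * _)]mulrCA.
move: (4^-1 ^+ k * S k) => t tl N1 big p2 p3.
rewrite -/(q k _) in N1; lra.
Qed.

End Gliding.

(** * Steps of the spaces, for real functions *)

Section Steps.
Context {R : realType} {n : nat}.
Local Notation V := 'rV[R]_n.
Local Notation mi := (multi_index n).
Implicit Types (p : V -> R) (w v : V -> R) (M N : mi -> R).

Lemma partials_cst0 (s : seq 'I_n) : partials s (cst 0 : V -> R) = cst 0.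
Proof. by elim: s => //= i s ->; rewrite partial_cst. Qed.

Lemma Repart_toC p : Repart (toC p) = p. Proof. by []. Qed.

Lemma Impart_toC p : Impart (toC p) = cst 0. Proof. by []. Qed.

Lemma csmooth_toC p : smooth p -> csmooth (toC p).
Proof. by move=> sp; split; [exact: sp|exact: (smooth_cst 0)]. Qed.

Lemma wderiv_toC w s p : smooth p ->
  wderiv w (mindex s) (toC p) = toC (fun x => partials s p x * w x).
Proof.
move=> sp; apply/funext => x; rewrite /wderiv /cderiv Repart_toC Impart_toC.
rewrite (mderivE s sp) (mderivE s (smooth_cst 0)).
by rewrite partials_cst0 /toC /= rmorphM.
Qed.

Section WithE.
Variables (E : fspace R n) (HE : is_tibf_bounded_type E) (solE : solid E).

(** Carrying the bound as a parameter avoids the extended real norm of a step. *)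
Definition rstep M w (B : R) p : Prop := forall s,
  RE E (fun x => partials s p x * w x) /\
  RN E (fun x => partials s p x * w x) <= B * M (mindex s).

Lemma gs_norm_ge M w f (al : mi) : (forall be, 0 < M be) -> (gs_norm E M w f < +oo)%E ->
  exists B : R, forall be, fnorm E (wderiv w be f) <= B * M be.
Proof.
move=> M0 fin; have ub be : ((fnorm E (wderiv w be f) / M be)%:E <= gs_norm E M w f)%E.
  by apply: ereal_sup_ubound; exists be.
have := ub al; move: fin ub; case: (gs_norm E M w f) => // B _ ub _.
by exists B => be; have := ub be; rewrite lee_fin ler_pdivrMr.
Qed.

Lemma gs_step_rstep M w p : smooth p -> (forall be, 0 < M be) -> gs_step E M w (toC p) ->
  exists B, rstep M w B p.
Proof.
move=> sp M0 [_ Ep /(gs_norm_ge [ffun=> 0%N] M0)[B HB]]; exists B => s.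
by rewrite /RE /RN -!(wderiv_toC w s sp); split.
Qed.

Lemma rstep_gs_step M w p (B : R) : smooth p -> (forall be, 0 < M be) -> rstep M w B p ->
  gs_step E M w (toC p) /\ (gs_norm E M w (toC p) <= B%:E)%E.
Proof.
move=> sp M0 Hp.
have norm : (gs_norm E M w (toC p) <= B%:E)%E.
  apply: ge_ereal_sup => _ [al _ <-]; rewrite lee_fin ler_pdivrMr//.
  by have [_] := Hp (mlist al); rewrite /RN -wderiv_toC// mlistK.
split; last exact: norm.
split; [exact: (csmooth_toC sp)| |exact: (le_lt_trans norm (ltry _))].
by move=> al; have [+ _] := Hp (mlist al); rewrite /RE -wderiv_toC// mlistK.
Qed.

Lemma rstep_ge0 M w B p : (forall be, 0 < M be) -> rstep M w B p -> 0 <= B.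
Proof.
move=> M0 /(_ [::])[Ep Np]; have := le_trans (RN_ge0 HE Ep) Np.
by rewrite pmulr_lge0.
Qed.

Lemma rstep_le M w B B' p : (forall be, 0 < M be) -> B <= B' -> rstep M w B p -> rstep M w B' p.
Proof.
move=> M0 BB Hp s; have [Es Ns] := Hp s; split=> //.
by rewrite (le_trans Ns)// ler_wpM2r// ltW.
Qed.

Lemma rstep_mono M N w v (C1 C2 B : R) p : smooth p -> (forall be, 0 < M be) ->
  0 <= C2 -> continuous v -> (forall x, 0 <= v x <= C2 * w x) ->
  (forall al, M al <= C1 * N al) ->
  rstep M w B p -> rstep N v (B * C1 * C2) p.
Proof.
move=> sp M0 C20 cv vw MN Hp s; have [Es Ns] := Hp s.
have B0 := rstep_ge0 M0 Hp.
have ms := measurable_partials s sp.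
have [||E1 N1] := RE_le HE solE (h := fun x => partials s p x * v x) Es C20.
- by apply: measurable_funM => //; exact: continuous_measurable.
- move=> x; have /andP[v0 vx] := vw x.
  rewrite !normrM mulrCA ler_wpM2l// ger0_norm//.
  by rewrite (le_trans vx)// ler_wpM2l// ler_norm.
split=> //; rewrite (le_trans N1)// (le_trans (ler_wpM2l C20 Ns))//.
rewrite (_ : B * C1 * C2 * _ = C2 * (B * (C1 * N (mindex s)))); last by ring.
by rewrite ler_wpM2l// ler_wpM2l.
Qed.

Lemma rstep_scale M w B (a : R) p : smooth p ->
  rstep M w B p -> rstep M w (`|a| * B) (fun x => a * p x).
Proof.
move=> sp Hp s; have [Es Ns] := Hp s; rewrite partialsZ//.
rewrite (_ : (fun x => _) = (fun x => a * (partials s p x * w x))); last first.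
  by apply/funext => x; rewrite mulrA.
have [Ea ->] := RE_scale HE a Es; split=> //.
by rewrite -mulrA ler_wpM2l.
Qed.

(** Weights are at least 1, so the weighted estimates control the unweighted derivatives. *)
Lemma rstep_unweighted M w B p s : smooth p -> (forall x, 1 <= w x) -> rstep M w B p ->
  RE E (partials s p) /\ RN E (partials s p) <= B * M (mindex s).
Proof.
move=> sp w1 Hp; have [Es Ns] := Hp s.
have [||E1 N1] := RE_le HE solE (h := partials s p) Es ler01.
- exact: measurable_partials.
- by move=> x; rewrite mul1r normrM ler_peMr// (le_trans (w1 x))// ler_norm.
by rewrite mul1r in N1; split=> //; exact: le_trans N1 Ns.
Qed.

End WithE.
End Steps.

Section UniformBoundedness.
Context {R : realType} {n : nat}.
Local Notation V := 'rV[R]_n.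
Variables (c : limit_type) (E : fspace R n) (HE : is_tibf_bounded_type E) (solE : solid E).
Variables (M N : weight_sequence_system R n) (W Z : weight_function_system R n).
Hypothesis incl : gs_space c E M W `<=` gs_space c E N Z.

Variables (I : Type) (p : I -> V -> R) (a : {posnum R} -> I -> R).
Hypothesis sp : forall i, smooth (p i).
Hypothesis a0 : forall nu i, 0 < a nu i.
Hypothesis amono : forall (nu nu' : {posnum R}) i, nu%:num <= nu'%:num -> a nu' i <= a nu i.

(** The weight is bounded on cubes: this makes sense for functions that are not known to
belong to the target space. *)
Definition local_norm (d : R) lam s y q :=
  RN E (cutoff d y (fun x => partials s q x * Z lam x)).

Let U (nu : {posnum R}) : set (V -> R) :=
  [set u | exists i (t : R), `|t| * a nu i <= 1 /\ u = (fun x => t * p i x)].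

Let U_dec (nu nu' : {posnum R}) : nu'%:num <= nu%:num -> U nu' `<=` U nu.
Proof.
move=> h u [i [t [ti ->]]]; exists i, t; split=> //.
by rewrite (le_trans _ ti)// ler_wpM2l// amono.
Qed.

Let U_opp nu u : U nu u -> U nu (fun x => - u x).
Proof.
move=> [i [t [ti ->]]]; exists i, (- t); split; first by rewrite normrN.
by apply/funext => x; rewrite mulNr.
Qed.

Let U_smooth nu u : U nu u -> smooth u.
Proof. by move=> [i [t [_ ->]]]; exact: smoothZ. Qed.

(** A gliding hump along indices at which the local norms are not bounded: the sum lies in
no step of the target space whose index is below infinitely many of the [lam k]. *)
Lemma unbounded_sum (d : R) (nu lam : nat -> {posnum R}) (lam0 : {posnum R}) (C0 : R) :
  0 < C0 -> (forall k m, (k <= m)%N -> (nu m)%:num <= (nu k)%:num) ->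
  (forall i, rstep E (M lam0) (W lam0) (C0 * a (nu 0%N) i) (p i)) ->
  (forall k, exists i s y, 8 ^+ k * a (nu k) i * N (lam k) (mindex s) <
     local_norm d (lam k) s y (p i)) ->
  exists u : nat -> V -> R, [/\ forall k, U (nu k) (u k), smooth (ssum u),
    (forall l B, (forall k, rstep E (M l) (W l) B (u k)) ->
       rstep E (M l) (W l) (2 * B) (ssum u)) &
    forall l B, rstep E (N l) (Z l) B (ssum u) ->
      exists K, forall k, l%:num <= (lam k)%:num -> (k <= K)%N].
Proof.
move=> C00 numono H0 viol.
have M0 l be : 0 < M l be by exact: ws_gt0.
have N0 l be : 0 < N l be by exact: ws_gt0.
have /choice[i /choice[s /choice[y Hi]]] := viol.
have cZ l := @wf_continuous R n Z l.
pose v k x := (N (lam k) (mindex (s k)))^-1 * Z (lam k) x.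
have cv k : continuous (v k).
  move=> x; apply: (@continuousM _ _ (cst (N (lam k) (mindex (s k)))^-1) (Z (lam k))).
    exact: cst_continuous.
  exact: cZ.
pose beta t := C0 * M lam0 (mindex t).
have Ub u t : U (nu 0%N) u -> RE E (partials t u) /\ RN E (partials t u) <= beta t.
  move=> [j [b [bj ->]]]; apply: (rstep_unweighted HE solE _ (smoothZ b (sp j)) (wf_ge1 W lam0)).
  apply: (rstep_le _ _ (rstep_scale HE b (sp j) (H0 j))) => //.
  by rewrite mulrCA ler_piMr// ltW.
have [|||||u [Uu Hu]] := @gliding_hump R n E HE solE (fun k => U (nu k)) d y s v beta cv.
- by move=> k m km; apply: U_dec; exact: numono.
- by move=> k u; exact: U_opp.
- by move=> u; exact: U_smooth.
- exact: Ub.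
- move=> k; exists (fun x => (a (nu k) (i k))^-1 * p (i k) x).
    by exists (i k), (a (nu k) (i k))^-1; rewrite gtr0_norm ?invr_gt0// mulVf// gt_eqF.
  have [C _ HC] := RE_cutoff_weight HE solE d (y k) (cZ (lam k)).
  have [Ep _] := rstep_unweighted HE solE (s k) (sp (i k)) (wf_ge1 W lam0) (H0 (i k)).
  have [Ec _] := HC _ Ep.
  rewrite partialsZ//.
  rewrite (_ : cutoff _ _ _ = (fun x => ((a (nu k) (i k))^-1 * (N (lam k) (mindex (s k)))^-1) *
     cutoff d (y k) (fun x => partials (s k) (p (i k)) x * Z (lam k) x) x)); last first.
    by apply/funext => x; rewrite /cutoff /v; ring.
  have [_ ->] := RE_scale HE ((a (nu k) (i k))^-1 * (N (lam k) (mindex (s k)))^-1) Ec.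
  rewrite gtr0_norm ?mulr_gt0 ?invr_gt0// -invfM mulrC ler_pdivlMr ?mulr_gt0//.
  by rewrite mulrA ltW// Hi.
have su k : smooth (u k) by exact: U_smooth (Uu k).
have bu k t : RE E (partials t (u k)) /\ RN E (partials t (u k)) <= beta t.
  by apply: Ub; apply: U_dec (Uu k); exact: numono.
exists u; split=> //; first exact: (smooth_ssum HE su bu).
  move=> l B HB t; rewrite -mulrA.
  by apply: (RE_ssum HE su bu (@wf_continuous R n W l)) => k; exact: HB.
move=> l B HB; exists (Num.bound (4 * B)) => k lk.
have [Es Ns] := HB (s k).
have key : RN E (cutoff d (y k) (fun x => partials (s k) (ssum u) x * v k x)) <= B.
  have mv : measurable_fun setT (fun x => partials (s k) (ssum u) x * v k x).
    apply: measurable_funM; last exact: continuous_measurable.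
    by apply: measurable_partials; exact: (smooth_ssum HE su bu).
  have [|||_ N1] := RE_le HE solE (h := cutoff d (y k) (fun x => partials (s k) (ssum u) x * v k x))
     (c := (N (lam k) (mindex (s k)))^-1) Es.
  - by rewrite invr_ge0 ltW.
  - exact: measurable_cutoff.
  - move=> x; apply: (le_trans (cutoff_le _ _ _ _)); rewrite /v !normrM mulrCA.
    rewrite (gtr0_norm (_ : 0 < (N (lam k) (mindex (s k)))^-1)) ?invr_gt0//.
    apply: ler_wpM2l; first by rewrite invr_ge0 ltW.
    apply: ler_wpM2l => //; have z0 l' := ltW (wf_gt0 Z l' x).
    by rewrite (ger0_norm (z0 _)) (ger0_norm (z0 _)); exact: wf_anti.
  rewrite (le_trans N1)// mulrC ler_pdivrMr// (le_trans Ns)// ler_wpM2l//.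
    exact: rstep_ge0 HB.
  exact: ws_mono.
have := le_trans (Hu k) key; rewrite ler_pdivrMr// mulrC => h.
rewrite -(ler_nat R) ltW//; apply: le_lt_trans (archi_boundP _).
  apply: le_trans h; rewrite -natrX ler_nat; exact: ltnW (ltn_expl _ _).
by rewrite mulr_ge0// (rstep_ge0 HE _ HB).
Qed.

(** If the bound fails for all choices of the index, it fails with constants [8^k] along a
sequence of indices that exhausts the system: [nu] decreases to 0 for fixed [lam] in the Beurling
case, and [lam] tends to infinity for fixed [nu] in the Roumieu case.  In both cases
[unbounded_sum] produces an element of the source space outside the target space. *)
Lemma uniform_local_bound (d : R) :
  quant c (fun lam nu : {posnum R} => exists2 C : R, 0 < C &
    forall i, rstep E (M lam) (W lam) (C * a nu i) (p i)) ->
  quant c (fun lam nu : {posnum R} => exists2 C : R, 0 < C &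
    forall i s y, local_norm d lam s y (p i) <= C * a nu i * N lam (mindex s)).
Proof.
move=> H.
have M0 l be : 0 < M l be by exact: ws_gt0.
have N0 l be : 0 < N l be by exact: ws_gt0.
case: c H incl => /= H inc.
  move=> lam; have [nu1 [C0 C00 H0]] := H lam.
  apply: contrapT => nex.
  have nu0 (k : nat) : 0 < nu1%:num / k.+1%:R :> R by rewrite divr_gt0// ltr0n.
  pose nu k := PosNum (nu0 k).
  have numono k m : (k <= m)%N -> (nu m)%:num <= (nu k)%:num.
    by move=> km; rewrite /= ler_pM2l// lef_pV2 ?posrE ?ltr0n// ler_nat.
  have [||u [Uu su uM uN]] := @unbounded_sum d nu (fun=> lam) lam C0 C00 numono.
  - move=> i; apply: (rstep_le (M0 lam) _ (H0 i)); rewrite ler_pM2l//; apply: amono.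
    by rewrite /= invr1 mulr1.
  - move=> k; apply: contrapT => nv; apply: nex; exists (nu k), (8 ^+ k).
      by rewrite exprn_gt0.
    move=> i s y; rewrite leNgt; apply/negP => h; apply: nv; by exists i, s, y.
  have inM : gs_space Beurling E M W (toC (ssum u)).
    move=> l; have [nu' [C' C'0 H']] := H l.
    have /choice[i /choice[t Hu]] := Uu.
    pose b k := `|t k| * (C' * a nu' (i k)).
    have b0 k : 0 <= b k by rewrite mulr_ge0// mulr_ge0 ?ltW.
    have ub k : rstep E (M l) (W l) (b k) (u k).
      by have [_ ->] := Hu k; exact: (rstep_scale HE (t k) (sp _) (H' _)).
    pose K := Num.bound (nu1%:num / nu'%:num).
    have Hb k : b k <= C' + \sum_(j < K) b j.
      have [kK|Kk] := ltnP k K.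
        rewrite (bigD1 (Ordinal kK))//= addrCA lerDl; apply: addr_ge0; first exact: ltW.
        by apply: sumr_ge0 => j _; exact: b0.
      apply: (@le_trans _ _ C'); last by rewrite lerDl; apply: sumr_ge0 => j _; exact: b0.
      rewrite /b mulrCA; apply: ler_piMr; [exact: ltW|have [tk _] := Hu k].
      apply: (le_trans _ tk); apply: ler_wpM2l => //; apply: amono; rewrite /=.
      rewrite ler_pdivrMr ?ltr0n// mulrC -ler_pdivrMr// (le_trans (ltW (archi_boundP _)))//.
      by rewrite ler_nat -/K leqW.
    have [|//] := @rstep_gs_step R n E (M l) (W l) (ssum u) (2 * (C' + \sum_(j < K) b j)) su (M0 l).
    by apply: uM => k; apply: (rstep_le _ _ (ub k)).
  have [B HB] := gs_step_rstep su (N0 lam) (inc _ inM lam).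
  by have [K HK] := uN lam B HB; have := HK K.+1 (lexx _); rewrite ltnn.
move=> nu; have [lam0 [C0 C00 H0]] := H nu.
apply: contrapT => nex.
have l0 (k : nat) : 0 < k.+1%:R :> R by rewrite ltr0n.
pose lam k := PosNum (l0 k).
have [|u [Uu su uM uN]] := @unbounded_sum d (fun=> nu) lam lam0 C0 C00 (fun _ _ _ => lexx _) H0.
- move=> k; apply: contrapT => nv; apply: nex; exists (lam k), (8 ^+ k).
    by rewrite exprn_gt0.
  move=> i s y; rewrite leNgt; apply/negP => h; apply: nv; by exists i, s, y.
have inM : gs_space Roumieu E M W (toC (ssum u)).
  exists lam0.
  have [|//] := @rstep_gs_step R n E (M lam0) (W lam0) (ssum u) (2 * C0) su (M0 lam0).
  apply: uM => k; have [i [t [ti ->]]] := Uu k.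
  apply: (rstep_le _ _ (rstep_scale HE t (sp i) (H0 i))) => //.
  by rewrite mulrCA ler_piMr// ltW.
have [l Hl] := inc _ inM; have [B HB] := gs_step_rstep su (N0 l) Hl.
have [K HK] := uN l B HB.
pose k := maxn K.+1 (Num.bound l%:num).
have lk : l%:num <= (lam k)%:num.
  rewrite /= (le_trans (ltW (archi_boundP _)))// ler_nat leqW// leq_maxr//.
by have := HK k lk; rewrite leqNgt leq_maxl.
Qed.

End UniformBoundedness.

(** * Inclusion of the weight function systems *)

Section QuantAux.
Context {R : realType}.

Definition holds_in (c : limit_type) (P : {posnum R} -> Prop) : Prop :=
  match c with Beurling => forall l, P l | Roumieu => exists l, P l end.

(** An element of the space lives in all steps or in one step, according to the case; once an
index for it is chosen, a triple condition becomes a relation between the other two indices in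
both cases. *)
Lemma quant3_freeze c (P : {posnum R} -> Prop) (T : {posnum R} -> {posnum R} -> {posnum R} -> Prop) :
  holds_in c P -> quant3 c T ->
  quant c (fun lam nu => exists l1 mu ka, [/\ P ka, T l1 mu nu,
    ka%:num <= lam%:num, ka%:num <= mu%:num & l1%:num <= lam%:num]).
Proof.
case: c => /= HP HT.
  move=> lam; have [mu [nu H]] := HT lam; exists nu.
  have m0 : 0 < Num.min lam%:num mu%:num by rewrite lt_min !gt0.
  exists lam, mu, (PosNum m0); split=> //=; by rewrite ge_min lexx ?orbT.
have [ka Pk] := HP => nu; have [l1 H] := HT ka nu.
have m0 : 0 < Num.max l1%:num ka%:num by rewrite lt_max gt0.
exists (PosNum m0), l1, ka, ka; split=> //=; by rewrite le_max lexx ?orbT.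
Qed.

End QuantAux.

Section WeightInclusion.
Context {R : realType} {n : nat}.
Local Notation V := 'rV[R]_n.
Local Notation mi := (multi_index n).
Variables (c : limit_type) (E : fspace R n) (HE : is_tibf_bounded_type E) (solE : solid E).
Variables (M : weight_sequence_system R n) (W : weight_function_system R n).
Implicit Types (p : V -> R).

Let M0 l be : 0 < M l be. Proof. exact: ws_gt0. Qed.
Let cW := @wf_continuous R n.
Let W1 := @wf_ge1 R n.
Let W0 := @wf_gt0 R n.

Definition rspace p := holds_in c (fun l => exists B, rstep E (M l) (W l) B p).

Lemma rstep_translate l1 mu nu (Ml : mi -> R) (C : R) : (forall be, 0 < Ml be) -> 0 < C ->
  (forall x y, W l1 (x + y) <= C * (W mu x * W nu y)) ->
  exists2 C' : R, 0 < C' & forall p x B, smooth p -> rstep E Ml (W mu) B p ->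
    rstep E Ml (W l1) (C' * B * W nu x) (fun y => p (y + - x)).
Proof.
move=> Ml0 C0 HC; have [C1 C10 H1] := RE_shift HE.
exists (C * C1) => [|p x B sp Hp s]; first exact: mulr_gt0.
have [Es Ns] := Hp s; have [Ex Nx] := H1 (- x) _ Es.
have ms := measurable_partials s sp.
rewrite partials_shift//.
have [|||E2 N2] := RE_le HE solE (h := fun y => partials s p (y + - x) * W l1 y)
    (c := C * W nu x) Ex.
- by rewrite mulr_ge0// ltW.
- apply: measurable_funM; last exact: continuous_measurable (@cW W _).
  apply: continuous_measurable; apply: continuous_shift; apply: smooth_continuous.
  exact: smooth_partials.
- move=> y; rewrite !normrM mulrCA; apply: ler_wpM2l => //.
  rewrite (gtr0_norm (W0 W _ _)) (gtr0_norm (W0 W _ _)).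
  by have := HC (y - x) x; rewrite subrK => /le_trans; apply; rewrite -mulrA [W nu x * _]mulrC.
split=> //; apply: (le_trans N2).
apply: (@le_trans _ _ (C * W nu x * (C1 * (B * Ml (mindex s))))).
  apply: ler_wpM2l; first by rewrite mulr_ge0// ltW.
  by rewrite (le_trans Nx)// ler_wpM2l// ltW.
by apply: le_of_eq; ring.
Qed.

(** The index at which [p] lives takes the place of one of the indices of [[M]]. *)
Lemma translate_family p : smooth p -> rspace p -> cond_M c W ->
  quant c (fun lam nu : {posnum R} => exists2 C : R, 0 < C &
    forall x, rstep E (M lam) (W lam) (C * W nu x) (fun y => p (y + - x))).
Proof.
move=> sp Hp HM; apply: quant_impl (quant3_freeze Hp HM) => lam nu.
move=> [l1 [mu [ka [[B HB] [C C0 HC] kl km l1l]]]].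
have HB1 : rstep E (M lam) (W mu) (B * 1 * 1) p.
  apply: (rstep_mono HE solE sp (M0 ka) ler01 (@cW W _) _ _ HB) => [x|al].
    by rewrite mul1r ltW//=; exact: wf_anti.
  by rewrite mul1r; exact: ws_mono.
have [C' C'0 HC'] := rstep_translate (M0 lam) C0 HC.
exists (C' * (`|B| + 1)) => [|x]; first by rewrite mulr_gt0// ltr_wpDl.
have H2 := HC' p x _ sp HB1.
have ss : smooth (fun y => p (y + - x)) by exact: smooth_shift.
have H3 : rstep E (M lam) (W lam) (C' * (B * 1 * 1) * W nu x * 1 * 1) (fun y => p (y + - x)).
  apply: (rstep_mono HE solE ss (M0 lam) ler01 (@cW W _) _ _ H2) => [y|al].
    by rewrite mul1r ltW//=; exact: wf_anti.
  by rewrite mul1r.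
apply: (rstep_le (M0 lam) _ H3); rewrite !mulr1 ler_wpM2r//; first exact: ltW.
apply: ler_wpM2l; first exact: ltW.
by rewrite (le_trans (ler_norm _))// lerDl.
Qed.

Lemma rspace_translate p x : smooth p -> rspace p -> cond_M c W -> rspace (fun y => p (y + x)).
Proof.
move=> sp Hp HM; have := translate_family sp Hp HM; rewrite /rspace.
case: c => /= H.
  move=> l; have [nu [C _ HC]] := H l; exists (C * W nu (- x)).
  by have := HC (- x); rewrite opprK.
have [lam [C _ HC]] := H 1%:pos; exists lam, (C * W 1%:pos (- x)).
by have := HC (- x); rewrite opprK.
Qed.

Lemma rspace_scale p (a : R) : smooth p -> rspace p -> rspace (fun x => a * p x).
Proof.
move=> sp; rewrite /rspace; case: c => /= [H l|[l [B HB]]].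
  by have [B HB] := H l; exists (`|a| * B); exact: (rstep_scale HE a sp HB).
by exists l, (`|a| * B); exact: (rstep_scale HE a sp HB).
Qed.

Lemma gs_step_part l f (g : V -> R) : gs_step E (M l) (W l) f -> smooth g ->
  (forall al x, `|mderiv al g x| <= normc (cderiv al f x)) ->
  exists B, rstep E (M l) (W l) B g.
Proof.
move=> [sf Ef /(gs_norm_ge [ffun=> 0%N] (M0 l))[B HB]] sg Hg; exists B => s.
have ms := measurable_partials s sg.
have [||E1 N1] := RE_dominated HE solE (h := fun x => partials s g x * W l x)
    (Ef (mindex s)) ler01.
- by apply: measurable_funM => //; exact: continuous_measurable (@cW W _).
- move=> x; rewrite mul1r normrM /wderiv normcM normc_real ler_wpM2r//.
  by have := Hg (mindex s) x; rewrite mderivE.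
by split=> //; rewrite (le_trans N1)// mul1r.
Qed.

(** The real or the imaginary part of an element of the space is again in the space; by
translation it can be assumed positive at the origin. *)
Lemma positive_test_function f : cond_M c W -> gs_space c E M W f -> f <> cst 0 ->
  exists p, [/\ smooth p, rspace p & 0 < p 0].
Proof.
move=> HM Hf f0.
have sf : csmooth f.
  by move: Hf; rewrite /gs_space; case: c => [/(_ 1%:pos)[]|[l []]].
have part (g : V -> R) : smooth g ->
    (forall al x, `|mderiv al g x| <= normc (cderiv al f x)) -> rspace g.
  move=> sg Hg; move: Hf; rewrite /rspace /gs_space; case: c => /= [H l|[l H]].
    by have := H l => /gs_step_part; exact.
  by exists l; exact: gs_step_part H sg Hg.
have HRe : rspace (Repart f).
  by apply: part => [|al x]; [exact: sf.1|exact: (Re_le_normc (cderiv al f x))].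
have HIm : rspace (Impart f).
  by apply: part => [|al x]; [exact: sf.2|exact: (Im_le_normc (cderiv al f x))].
have fin g x : smooth g -> rspace g -> g x != 0 -> exists p, [/\ smooth p, rspace p & 0 < p 0].
  move=> sg Hg gx; exists (fun y => Num.sg (g x) * g (y + x)).
  have ss : smooth (fun y => g (y + x)) by exact: smooth_shift.
  split; first exact: (smoothZ (Num.sg (g x)) ss).
    by apply: rspace_scale => //; exact: rspace_translate.
  by rewrite add0r -normrEsg normr_gt0.
have [x fx] : exists x, f x != 0.
  apply: contrapT => H; apply: f0; apply/funext => x; apply/eqP.
  by apply: contrapT => /negP fx; apply: H; exists x.
have [re|re] := eqVneq (Repart f x) 0; last exact: fin sf.1 HRe re.
apply: (fin (Impart f) x sf.2 HIm); apply: contra_neq fx => im.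
by move: re im; rewrite /Repart /Impart; case: (f x) => a b /= -> ->.
Qed.

Lemma positive_near p : smooth p -> 0 < p 0 -> forall d : R, 0 < d ->
  exists2 e : R, 0 < e <= d & forall x, cube e x -> p 0 / 2 <= p x.
Proof.
move=> sp p0 d d0; have p2 : 0 < p 0 / 2 by rewrite divr_gt0.
have [e e0 He] := continuous_cubeP 0 (smooth_continuous sp) p2.
have m0 : 0 < Num.min e d by rewrite lt_min e0.
exists (Num.min e d); first by rewrite m0 ge_min lexx orbT.
move=> x cx; have := He x (cube_le _ cx); rewrite ge_min lexx add0r => /(_ isT).
rewrite ltr_norml => /andP[_]; lra.
Qed.

(** Otherwise [p] would vanish almost everywhere on a cube where it is positive. *)
Lemma RN_cutoff_gt0 p (d : R) : smooth p -> RE E p -> 0 < p 0 -> 0 < d ->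
  0 < RN E (cutoff d 0 p).
Proof.
move=> sp Ep p0 d0; have [Ec _] := RE_cutoff HE solE d 0 Ep.
rewrite lt_neqAle (RN_ge0 HE Ec) andbT eq_sym; apply/eqP => N0.
have [e /andP[e0 ed] He] := positive_near sp p0 d0.
have := tibf_norm_eq0 HE Ec N0 => -[A [mA A0 sA]].
have cA : cube e `<=` A.
  move=> x cx; apply: sA => /= /eqP; rewrite /toC.
  have cd : cube d x by exact: cube_le cx.
  rewrite /cutoff subr0 indicE mem_set// mul1r => /eqP/(congr1 (@complex.Re R)) /= px.
  by have := He x cx; rewrite px leNgt divr_gt0.
have : (lebesgue_rV R n (cube e) <= 0)%E.
  rewrite -A0; apply: le_measure => //; apply/mem_set => //; exact: measurable_cube.
by rewrite (lebesgue_cube n (ltW e0)) lee_fin leNgt exprn_gt0// mulr_gt0.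
Qed.

(** The translates [T_x p] have norm at most of the order of [w^nu(x)] in the source space, and
at least of the order of [v^lam(x)] on the ball around [x]. *)
Lemma wf_incl_of_subset (N : weight_sequence_system R n) (Z : weight_function_system R n) p :
  smooth p -> rspace p -> 0 < p 0 -> cond_M c W -> cond_wM c Z ->
  gs_space c E M W `<=` gs_space c E N Z -> wf_incl c W Z.
Proof.
move=> sp Hp p0 HM HwM incl.
pose d : R := n.+1%:R^-1.
have d0 : 0 < d by rewrite invr_gt0 ltr0n.
have Ep : RE E p.
  have [l [B HB]] : exists l B, rstep E (M l) (W l) B p.
    by move: Hp; rewrite /rspace; case: c => /= [/(_ 1%:pos)|//]; exists 1%:pos.
  by have [] := rstep_unweighted HE solE [::] sp (W1 W l) HB.
have rho0 := RN_cutoff_gt0 sp Ep p0 d0.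
have [C0 C00 HC0] := RE_shift HE.
have UB := @uniform_local_bound R n c E HE solE M N W Z incl V (fun x y => p (y + - x))
  (fun nu x => W nu x) (fun x => smooth_shift (- x) sp) (fun nu x => W0 W nu x)
  (fun nu nu' x h => @wf_anti R n W nu' nu h x) d (translate_family sp Hp HM).
apply: quant_comp HwM UB => l lam nu [C C_0 HC] [C' C'0 HC'].
set rho := RN E (cutoff d 0 p) in rho0.
exists (C0 * C * C' / rho) => [|t]; first by rewrite divr_gt0// !mulr_gt0.
have [C1 _ HC1] := RE_cutoff_weight HE solE d t (@cW Z lam).
have [Et _] := HC0 (- t) _ Ep; have [ED _] := HC1 _ Et.
have ND := HC' t [::] t; rewrite /local_norm /= in ND.
have mp : measurable_fun setT (fun y : V => p (y + - t)).
  by apply: continuous_measurable; apply: continuous_shift; exact: smooth_continuous.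
pose h := cutoff d t (fun y => p (y + - t)).
have small (y : V) : cube d y -> enorm y < 1.
  move=> cy; rewrite /enorm -[ltRHS]sqrtr1 ltr_sqrt//.
  apply: (@le_lt_trans _ _ (\sum_(i < n) d ^+ 2)).
    by apply: ler_sum => i _; rewrite -real_normK ?num_real// lerXn2r ?nnegrE ?(ltW d0)//; exact: cy.
  rewrite sumr_const card_ord -[ltLHS]mulr_natr /d exprVn mulrC ltr_pdivrMr ?exprn_gt0 ?ltr0n//.
  by rewrite mul1r -natrX ltr_nat -mulnn leq_pmulr.
have [|||Eh Nh] := RE_le HE solE (h := h) (c := C / Z l t) ED.
- by rewrite divr_ge0// ltW// W0.
- exact: measurable_cutoff.
- move=> y; rewrite /h /cutoff !normrM indicE; have [yc|_] := boolP (_ \in _); last first.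
    by rewrite normr0 !mul0r mulr0.
  rewrite normr1 !mul1r mulrCA ler_peMr// mulrAC ler_pdivlMr ?W0// mul1r.
  have cy : cube d (t - y) by move=> i; have := set_mem yc i; rewrite !mxE distrC.
  have := HC y (t - y) (small _ cy); rewrite addrC subrK => /le_trans; apply.
  by apply: ler_wpM2l; [exact: ltW|exact: ler_norm].
have [_ Nr] := HC0 t _ Eh.
have hE : (fun x => h (x + t)) = cutoff d 0 p.
  by apply/funext => x; rewrite /h /cutoff addrK subr0.
rewrite hE -/rho in Nr.
have N1 : N lam (mindex [::]) = 1.
  have [_ N1 _] := ws_weight N lam; rewrite -[RHS]N1.
  have -> : mindex [::] = [ffun=> 0%N] :> mi by apply/ffunP => i; rewrite !ffunE.
  by [].
rewrite N1 mulr1 in ND.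
have key : rho <= C0 * (C / Z l t * (C' * W nu t)).
  apply: (le_trans Nr); apply: ler_wpM2l; first exact: ltW.
  by apply: (le_trans Nh); apply: ler_wpM2l => //; rewrite divr_ge0// ltW// W0.
rewrite mulrAC ler_pdivlMr//.
apply: (le_trans (ler_wpM2l (ltW (W0 Z l t)) key)).
apply: le_of_eq; field.
by rewrite gt_eqF// W0.
Qed.

End WeightInclusion.

(** * Averages of smooth functions *)

Section IntegralFunctional.
Context {R : realType} d (T : measurableType d) (m : {measure set T -> \bar R}).
Variables (Q : set T) (mQ : measurable Q) (finQ : (m Q < +oo)%E).

Definition bounded_measurable (g : T -> R) : Prop :=
  measurable_fun Q g /\ exists B, forall t, Q t -> `|g t| <= B.

Lemma bounded_measurable_integrable g : bounded_measurable g -> m.-integrable Q (EFin \o g).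
Proof.
move=> [mg [B HB]]; apply: measurable_bounded_integrable => //.
exists B; split; first exact: num_real.
by move=> x Bx t Qt /=; rewrite (le_trans (HB t Qt))// ltW.
Qed.

Lemma integral_bounded_functional :
  bounded_functional Q bounded_measurable (fun g => \int[m]_(t in Q) g t) (fine (m Q)).
Proof.
split.
- move=> a b g h [mg [B HB]] [mh [C HC]]; split.
    by apply: measurable_funD; apply: measurable_funM => //; exact: measurable_cst.
  exists (`|a| * B + `|b| * C) => t Qt.
  by rewrite (le_trans (ler_normD _ _))// !normrM lerD// ler_wpM2l ?HB ?HC.
- move=> a b g h Dg Dh; have ig := bounded_measurable_integrable Dg.
  have ih := bounded_measurable_integrable Dh.
  have scale (k : R) f : bounded_measurable f -> m.-integrable Q (EFin \o (fun t => k * f t)).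
    move=> [mf [B HB]]; apply: bounded_measurable_integrable; split.
      by apply: measurable_funM => //; exact: measurable_cst.
    by exists (`|k| * B) => t Qt; rewrite normrM ler_wpM2l// HB.
  rewrite RintegralD//; first by rewrite !RintegralZl.
  - exact: scale.
  - exact: scale.
- move=> g B Dg HB; have ig := bounded_measurable_integrable Dg.
  apply: (le_trans (le_normr_Rintegral mQ ig)).
  rewrite mulrC -Rintegral_cst//; apply: le_Rintegral => //.
    apply: bounded_measurable_integrable; split; last first.
      by exists B => t Qt; rewrite normr_id HB.
    by apply: measurableT_comp; [exact: normr_measurable|case: Dg].
  apply: bounded_measurable_integrable; split; first exact: measurable_cst.
  by exists `|B|.
Qed.

End IntegralFunctional.

Section SmoothFamilies.
Context {R : realType} {n : nat} d (T : measurableType d).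
Local Notation V := 'rV[R]_n.
Variable Q : set T.
Hypothesis mQ : measurable Q.

(** These families can be integrated under the derivatives over a set of finite measure; they
are stable under products, and contain the translates of a smooth function. *)
Record smooth_family (k : T -> V -> R) : Prop := SmoothFamily {
  sf_smooth : forall t, smooth (k t);
  sf_measurable : forall s x, measurable_fun Q (fun t => partials s (k t) x);
  sf_bounded : forall s (r : R), exists B, forall t x, Q t -> cube r x -> `|partials s (k t) x| <= B
}.

Lemma smooth_family_dom k s x : smooth_family k ->
  bounded_measurable Q (fun t => partials s (k t) x).
Proof.
move=> Fk; split; first exact: sf_measurable.
have [B HB] := sf_bounded Fk s `|x|; exists B => t Qt.
by apply: HB => //; exact: cube_norm.
Qed.

Lemma smooth_family_shift (h : V -> R) (phi : T -> V) (r : R) : smooth h ->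
  measurable_fun Q phi -> (forall t, Q t -> cube r (phi t)) ->
  smooth_family (fun t x => h (x + phi t)).
Proof.
move=> sh mphi bphi.
have mshift x : measurable_fun Q (fun t => x + phi t).
  apply: (@measurableT_comp _ _ _ _ _ _ (fun y : V => x + y)) => //.
  apply: measurable_fun_rV => i.
  rewrite (_ : (fun t : V => (x + t) ord0 i) = fun t => x ord0 i + t ord0 i); last first.
    by apply/funext => y; rewrite mxE.
  by apply: measurable_funD; [exact: measurable_cst|exact: measurable_coor].
split=> [t|s x|s q].
- exact: smooth_shift.
- under eq_fun do rewrite partials_shift//.
  apply: (@measurableT_comp _ _ _ _ _ _ (partials s h)) => //.
  exact: measurable_partials.
- have [B HB] := smooth_locally_bounded s sh (q + r); exists B => t x Qt cx.
  by rewrite partials_shift//; apply: HB; apply: cubeD => //; exact: bphi.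
Qed.

Lemma smooth_family_const (h : V -> R) : smooth h -> smooth_family (fun=> h).
Proof.
move=> sh; split=> // s q.
have [B HB] := smooth_locally_bounded s sh q; exists B => t x _; exact: HB.
Qed.

Lemma smooth_familyM k l : smooth_family k -> smooth_family l ->
  smooth_family (fun t => k t \* l t).
Proof.
have E i f g : smooth f -> smooth g ->
    partial i (f \* g) = (partial i f \* g) \+ (f \* partial i g) :> (V -> R).
  by move=> sf sg; apply/funext => x; apply: partialM; exact: smooth_derivable.
have shift i k' : smooth_family k' -> smooth_family (fun t => partial i (k' t)).
  move=> [s1 s2 s3]; split=> [t|s x|s r]; first exact: smooth_partial.
    by under eq_fun do rewrite -partials_rcons; exact: s2.
  by have [B HB] := s3 (rcons s i) r; exists B => t x; rewrite -partials_rcons; exact: HB.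
move=> Fk Fl; split=> [t|s x|s r].
- by apply: smoothM; exact: sf_smooth.
- elim/last_ind: s k l Fk Fl => [|s i IH] k l Fk Fl.
    by apply: measurable_funM; [exact: (sf_measurable Fk [::] x)|exact: (sf_measurable Fl [::] x)].
  have sk := sf_smooth Fk; have sl := sf_smooth Fl.
  rewrite (_ : (fun t => _) = (fun t => partials s (partial i (k t) \* l t) x) \+
      (fun t => partials s (k t \* partial i (l t)) x)); last first.
    apply/funext => t; rewrite partials_rcons (E _ _ _ (sk t) (sl t)).
    rewrite partialsD//; apply: smoothM => //; exact: smooth_partial.
  have [Fk' Fl'] := (shift i _ Fk, shift i _ Fl).
  exact: measurable_funD (IH _ _ Fk' Fl) (IH _ _ Fk Fl').
- elim/last_ind: s k l Fk Fl => [|s i IH] k l Fk Fl.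
    have [B HB] := sf_bounded Fk [::] r; have [C HC] := sf_bounded Fl [::] r.
    by exists (B * C) => t x Qt cx; rewrite /= normrM ler_pM// ?(HB t x)// (HC t x).
  have sk := sf_smooth Fk; have sl := sf_smooth Fl.
  have [B HB] := IH _ _ (shift i _ Fk) Fl; have [C HC] := IH _ _ Fk (shift i _ Fl).
  exists (B + C) => t x Qt cx; rewrite partials_rcons (E _ _ _ (sk t) (sl t)).
  rewrite partialsD; last 2 first.
  + by apply: smoothM => //; exact: smooth_partial.
  + by apply: smoothM => //; exact: smooth_partial.
  by rewrite (le_trans (ler_normD _ _))// lerD ?HB ?HC.
Qed.

Variables (m : {measure set T -> \bar R}) (finQ : (m Q < +oo)%E).

Lemma smooth_integral k : smooth_family k -> smooth (fun x => \int[m]_(t in Q) k t x).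
Proof.
move=> Fk; apply: (smooth_functional (integral_bounded_functional mQ finQ)) => //.
- exact: sf_smooth.
- by move=> s x; exact: smooth_family_dom.
- by move=> s r; exact: sf_bounded.
Qed.

Lemma partials_integral k s x : smooth_family k ->
  partials s (fun x => \int[m]_(t in Q) k t x) x = \int[m]_(t in Q) partials s (k t) x.
Proof.
move=> Fk; rewrite (partials_functional (integral_bounded_functional mQ finQ))//.
- exact: sf_smooth.
- by move=> s' x'; exact: smooth_family_dom.
- by move=> s' r; exact: sf_bounded.
Qed.

Lemma partials_integral_le k s x (B : R) : smooth_family k ->
  (forall t, Q t -> `|partials s (k t) x| <= B) ->
  `|partials s (fun x => \int[m]_(t in Q) k t x) x| <= fine (m Q) * B.
Proof.
move=> Fk HB; rewrite partials_integral//.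
apply: (bf_bound (integral_bounded_functional mQ finQ)) => //.
exact: smooth_family_dom.
Qed.

End SmoothFamilies.

(** * Plane waves and averages along the axes *)

Section WaveAverages.
Context {R : realType} {n : nat}.
Local Notation V := 'rV[R]_n.
Local Notation ee i := (delta_mx ord0 i).
Variables (e : R) (e0 : 0 < e).
Implicit Types (F : V -> R) (j : 'I_n) (xi : 'I_n -> R).

Let Q : set (measurableTypeR R) := `[- e, e]%classic.

Let mQ : measurable Q. Proof. exact: measurable_itv. Qed.

Let finQ : ((@lebesgue_measure R) Q < +oo)%E.
Proof. by rewrite /Q lebesgue_measure_itv /=; case: ifP => _; rewrite ?ltry// -EFinB ltry. Qed.

Let measQ : fine ((@lebesgue_measure R) Q) = 2 * e.
Proof.
rewrite /Q lebesgue_measure_itv /= lte_fin ifT; first by rewrite /=; ring.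
by rewrite (lt_trans _ e0)// oppr_lt0.
Qed.

Definition axis_average j F : V -> R := fun x => \int[lebesgue_measure]_(t in Q) F (x + t *: ee j).

Let mline j : measurable_fun Q (fun t : measurableTypeR R => t *: ee j : V).
Proof.
apply: measurable_funTS; apply: measurable_fun_rV => i.
rewrite (_ : (fun t => _) = fun t : R => t * (ee j : V) ord0 i); last first.
  by apply/funext => t; rewrite mxE.
by apply: measurable_funM; [exact: measurable_id|exact: measurable_cst].
Qed.

Let bline j t : Q t -> cube e (t *: ee j : V).
Proof.
rewrite /Q /= in_itv /= -ler_norml => te i; rewrite !mxE eqxx /=.
exact: (le_trans (normrM_bool _ _)).
Qed.

Lemma line_family j F : smooth F -> smooth_family Q (fun t x => F (x + t *: ee j)).
Proof. by move=> sF; exact: (smooth_family_shift sF (@mline j) (@bline j)). Qed.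

Lemma smooth_axis_average j F : smooth F -> smooth (axis_average j F).
Proof. by move=> sF; apply: (smooth_integral mQ finQ); exact: line_family. Qed.

Lemma axis_averageZ j (a : R) F : smooth F ->
  axis_average j (fun x => a * F x) = (fun x => a * axis_average j F x).
Proof.
move=> sF; apply/funext => x; rewrite /axis_average RintegralZl//.
apply: (bounded_measurable_integrable mQ finQ).
exact: (smooth_family_dom [::] x (line_family j sF)).
Qed.

Lemma partial_axis_average j F x : smooth F ->
  partial j (axis_average j F) x = F (x + e *: ee j) - F (x - e *: ee j).
Proof.
move=> sF.
have := partials_integral mQ finQ [:: j] x (line_family j sF); rewrite /= => ->.
have D (t : R) : is_derive t (1 : R) (fun t : R => F (x + t *: ee j)) (partial j F (x + t *: ee j)).
  by apply: line_is_derive; exact: smooth_derivable.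
have D' (t : R) : is_derive t (1 : R) (fun t : R => partial j F (x + t *: ee j))
    (partial j (partial j F) (x + t *: ee j)).
  by apply: line_is_derive; apply: smooth_derivable; exact: smooth_partial.
have c1 := is_derive_continuous D.
have c2 := is_derive_continuous D'.
under eq_Rintegral do rewrite (proj2 (partial_shift (smooth_derivable j _ sF))).
rewrite /Rintegral (@continuous_FTC2 R _ (fun t : R => F (x + t *: ee j)) (- e) e).
- by rewrite -EFinB /= scaleNr.
- by rewrite (lt_trans _ e0)// oppr_lt0.
- exact: continuous_subspaceT.
- split=> [t _||]; first by have [] := D t.
  + exact/cvg_at_right_filter/c1.
  + exact/cvg_at_left_filter/c1.
- by move=> t _; rewrite derive1E; have [_ ->] := D t.
Qed.

(** All phases and all points are included to make the property stable under translations of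
[F], which only change the phase of the wave. *)
Definition wave_bounded xi F (b : seq 'I_n -> R) : Prop := smooth F /\
  forall th s x, `|partials s (wave xi th \* F) x| <= b s.

Lemma wave_bounded_shift xi F b (a : V) th s x : wave_bounded xi F b ->
  `|partials s (wave xi th \* (fun y => F (y + a))) x| <= b s.
Proof.
move=> [sF HF].
have -> : wave xi th \* (fun y => F (y + a)) =
    (fun y => (wave xi (th - \sum_i xi i * a ord0 i) \* F) (y + a)).
  by apply/funext => y; rewrite /= wave_shift subrK.
have sw : smooth (wave xi (th - \sum_i xi i * a ord0 i) : V -> R) by exact: smooth_wave.
by rewrite (partials_shift s a (smoothM sw sF)); exact: HF.
Qed.

Lemma partial_wave xi th j :
  partial j (wave xi th : V -> R) = (fun x => xi j * wave xi (th + pi / 2) x).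
Proof. by apply/funext => x; exact: (proj2 (wave_partial _ _ _ _)). Qed.

(** The derivative of a product of a plane wave with an average of [F] along an axis is
[xi j] times the product with a shifted wave, up to a difference of translates of [F]. *)
Lemma wave_bounded_average xi F b j : wave_bounded xi F b ->
  wave_bounded xi (fun x => xi j * axis_average j F x)
    (fun s => 2 * e * b (rcons s j) + 2 * b s).
Proof.
move=> HF; have [sF bF] := HF; have sA := smooth_axis_average j sF.
split=> [|th s x]; first exact: smoothZ.
pose th' := th - pi / 2.
have sw t : smooth (wave xi t : V -> R) by exact: smooth_wave.
pose Dl := (wave xi th' \* (fun y => F (y + e *: ee j))) \-
  (wave xi th' \* (fun y => F (y + - e *: ee j))).
have E : wave xi th \* (fun x => xi j * axis_average j F x) =
    partial j (wave xi th' \* axis_average j F) \- Dl.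
  apply/funext => y /=; rewrite (@partialM R n j (wave xi th') (axis_average j F)); last 2 first.
  - exact: (smooth_derivable j y (sw th')).
  - exact: (smooth_derivable j y sA).
  by rewrite partial_wave partial_axis_average// /Dl /th' /= subrK scaleNr; ring.
have s1 : smooth (wave xi th' \* axis_average j F) by exact: (smoothM (sw th') sA).
have s2 (a : V) : smooth (wave xi th' \* (fun y => F (y + a))).
  exact: (smoothM (sw th') (smooth_shift a sF)).
have sD : smooth Dl by exact: (smoothB (s2 _) (s2 _)).
rewrite E (partialsB s (smooth_partial j s1) sD) -partials_rcons /=.
rewrite (le_trans (ler_normB _ _))//; apply: lerD.
  have k_fam := smooth_familyM (smooth_family_const Q (sw th')) (line_family j sF).
  have -> : wave xi th' \* axis_average j F =
      (fun x => \int[lebesgue_measure]_(t in Q) (wave xi th' x * F (x + t *: ee j))).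
    apply/funext => y; rewrite RintegralZl//.
    apply: (bounded_measurable_integrable mQ finQ).
    exact: (smooth_family_dom [::] y (line_family j sF)).
  rewrite -measQ; apply: (partials_integral_le mQ finQ k_fam) => t _.
  exact: wave_bounded_shift.
rewrite (partialsB s (s2 _) (s2 _)) /= (le_trans (ler_normB _ _))//.
by rewrite mulr2n mulrDl mul1r; apply: lerD; exact: wave_bounded_shift.
Qed.

Fixpoint axis_averages (l : seq 'I_n) F : V -> R :=
  if l is j :: l' then axis_average j (axis_averages l' F) else F.

Lemma smooth_axis_averages l F : smooth F -> smooth (axis_averages l F).
Proof. by move=> sF; elim: l => [//|j l IH]; exact: (smooth_axis_average j IH). Qed.

(** The bounds that result from [wave_bounded_average], applied along the axes in [l]. *)
Fixpoint average_bound (b : seq 'I_n -> R) (l s : seq 'I_n) : R :=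
  if l is j :: l' then 2 * e * average_bound b l' (rcons s j) + 2 * average_bound b l' s
  else b s.

Lemma wave_bounded_averages xi F b l : wave_bounded xi F b ->
  wave_bounded xi (fun x => (\prod_(j <- l) xi j) * axis_averages l F x) (average_bound b l).
Proof.
move=> HF; elim: l => [|j l IH].
  rewrite (_ : (fun x => _) = F)//.
  by apply/funext => x; rewrite big_nil mul1r.
have := wave_bounded_average j IH; rewrite axis_averageZ; last first.
  by apply: smooth_axis_averages; have [] := HF.
rewrite (_ : (fun x => xi j * _) = (fun x => (\prod_(j0 <- j :: l) xi j0) * axis_averages (j :: l) F x))//.
by apply/funext => x; rewrite big_cons mulrA.
Qed.

(** Each of the terms of [average_bound] is a bound for a part of the list [s ++ l], and the
coefficients add up to [(2 e + 2)^|l|]. *)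
Lemma average_bound_le b l s (B Y : R) : 0 <= B ->
  (forall s1 s2, perm_eq (s1 ++ s2) (s ++ l) -> b s1 <= B * Y) ->
  average_bound b l s <= B * (2 * (1 + e)) ^+ size l * Y.
Proof.
move=> B0; elim: l s => [|j l IH] s H /=.
  by rewrite expr0 mulr1; apply: (H s [::]).
have h1 : average_bound b l (rcons s j) <= B * (2 * (1 + e)) ^+ size l * Y.
  apply: IH => s1 s2 st; apply: (H s1 s2); rewrite (perm_trans st)//.
  by rewrite -cats1 -catA.
have h2 : average_bound b l s <= B * (2 * (1 + e)) ^+ size l * Y.
  apply: IH => s1 s2 st; apply: (H s1 (j :: s2)).
  by rewrite perm_catC /= perm_sym perm_catC /= perm_cons perm_catC perm_sym perm_catC.
have h3 := ler_wpM2l (_ : 0 <= 2 * e) h1; have {}h3 := h3 (mulr_ge0 (ler0n _ 2) (ltW e0)).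
have h4 := ler_wpM2l (ler0n R 2) h2.
rewrite (le_trans (lerD h3 h4))// exprS; apply: le_of_eq; ring.
Qed.

(** From a point of the box, a part of length [e] of the segment of integration stays in the
box; elsewhere [F] is nonnegative. *)
Lemma axis_average_ge j F (a : R) : smooth F -> 0 <= a -> (forall x, 0 <= F x) ->
  (forall x : V, (forall i, 0 <= x ord0 i <= e) -> a <= F x) ->
  (forall x, 0 <= axis_average j F x) /\
  (forall x : V, (forall i, 0 <= x ord0 i <= e) -> e * a <= axis_average j F x).
Proof.
move=> sF a0 F0 Fa; split=> x; first by apply: Rintegral_ge0 => t _; exact: F0.
move=> xe; have /andP[xj0 xje] := xe j.
pose A : set (measurableTypeR R) := `[- x ord0 j, e - x ord0 j]%classic.
have mA : measurable A by exact: measurable_itv.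
have AQ : A `<=` Q.
  by move=> t; rewrite /A /Q /= !in_itv /= => /andP[h1 h2]; apply/andP; split; lra.
have iF : lebesgue_measure.-integrable Q (EFin \o (fun t => F (x + t *: ee j))).
  apply: (bounded_measurable_integrable mQ finQ).
  exact: (smooth_family_dom [::] x (line_family j sF)).
have iA : lebesgue_measure.-integrable Q (EFin \o (fun t : R => a * \1_A t)).
  apply: (bounded_measurable_integrable mQ finQ); split.
    by apply: measurable_funM; [exact: measurable_cst|exact: measurable_indic].
  exists a => t _; rewrite normrM (ger0_norm a0) ler_piMr// indicE.
  by case: (_ \in _); rewrite ?normr1 ?normr0.
apply: (@le_trans _ _ (\int[lebesgue_measure]_(t in Q) (a * \1_A t))); last first.
  apply: le_Rintegral => // t Qt; rewrite indicE; have [tA|_] := boolP (_ \in _); last first.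
    by rewrite mulr0; exact: F0.
  rewrite mulr1; apply: Fa => i; rewrite !mxE eqxx /=.
  have := set_mem tA; rewrite /A /= in_itv /= => /andP[h1 h2].
  by have [->|_] := eqVneq i j; rewrite ?mulr1 ?mulr0 ?addr0//; apply/andP; split; lra.
rewrite RintegralZl//; last first.
  apply: (bounded_measurable_integrable mQ finQ); split; first exact: measurable_indic.
  by exists 1 => t _; rewrite indicE; case: (_ \in _); rewrite ?normr1 ?normr0.
rewrite mulrC /Rintegral integral_indic// setIidl//.
have -> : fine (lebesgue_measure A) = e.
  rewrite /A lebesgue_measure_itv /= lte_fin ifT; last by rewrite ltrDr.
  by rewrite -EFinB /= opprK subrK.
by [].
Qed.

Lemma axis_averages_ge l F (a : R) : smooth F -> 0 <= a -> (forall x, 0 <= F x) ->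
  (forall x : V, (forall i, 0 <= x ord0 i <= e) -> a <= F x) ->
  (forall x, 0 <= axis_averages l F x) /\
  (forall x : V, (forall i, 0 <= x ord0 i <= e) -> e ^+ size l * a <= axis_averages l F x).
Proof.
move=> sF a0 F0 Fa; elim: l => [|j l [IH1 IH2]] /=.
  by split=> // x xe; rewrite expr0 mul1r; exact: Fa.
have [|h1 h2] := axis_average_ge j (smooth_axis_averages l sF) _ IH1 IH2.
  by rewrite mulr_ge0// exprn_ge0// ltW.
by split=> // x xe; rewrite exprS -mulrA; exact: h2.
Qed.

End WaveAverages.

(** * Integrals over a product of two sets of finite measure *)

Section ProductIntegral.
Context {R : realType} d1 d2 (T1 : measurableType d1) (T2 : measurableType d2).
Variables (m1 : {sigma_finite_measure set T1 -> \bar R}).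
Variables (m2 : {sigma_finite_measure set T2 -> \bar R}).
Variables (Q1 : set T1) (Q2 : set T2) (mQ1 : measurable Q1) (mQ2 : measurable Q2).
Hypotheses (fin1 : (m1 Q1 < +oo)%E) (fin2 : (m2 Q2 < +oo)%E).
Local Notation Q := (Q1 `*` Q2).
Local Notation m12 := (m1 \x m2)%E.

Lemma measurable_rectangle : measurable Q.
Proof. exact: measurableX. Qed.

Lemma product_measure_rectangle : (m12 Q < +oo)%E.
Proof. by rewrite product_measure1E// lte_mul_pinfty// ge0_fin_numE. Qed.

Let restrict_measurable (g : T1 * T2 -> R) : bounded_measurable Q g ->
  measurable_fun setT (EFin \o (g \_ Q)).
Proof.
move=> [mg _]; apply/measurable_EFinP.
exact: (proj1 (measurable_restrictT g measurable_rectangle) mg).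
Qed.

Let slice_restrict (g : T1 * T2 -> R) t u :
  (g \_ Q) (t, u) = ((fun t => g (t, u)) \_ Q1) t * \1_Q2 u.
Proof.
rewrite /patch /= in_setX /= indicE.
by case: (t \in Q1); case: (u \in Q2); rewrite ?mulr1 ?mulr0 ?mul0r.
Qed.

Lemma Rintegral_slices (g : T1 * T2 -> R) : bounded_measurable Q g ->
  \int[m12]_(z in Q) g z = \int[m2]_(u in Q2) \int[m1]_(t in Q1) g (t, u).
Proof.
move=> bg; have mh := restrict_measurable bg; have [mg [B HB]] := bg.
have ih : m12.-integrable setT (EFin \o (g \_ Q)).
  rewrite -restrict_EFin; apply/integrable_restrict => //; rewrite ?setTI//.
    exact: measurable_rectangle.
  exact: (bounded_measurable_integrable measurable_rectangle product_measure_rectangle bg).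
rewrite Rintegral_mkcond {1}/Rintegral -(integral21_prod_meas1 ih) [RHS]Rintegral_mkcond.
rewrite /Rintegral; congr fine; apply: eq_integral => u _.
rewrite /fubini_G /=; under eq_integral do rewrite slice_restrict.
rewrite /patch indicE; case: ifPn => [uQ|_]; last first.
  by apply: integral0_eq => t _; rewrite mulr0.
have mgu : bounded_measurable Q1 (fun t => g (t, u)).
  split; last by exists B => t Qt; apply: HB; split=> //=; exact: set_mem.
  apply/(measurable_restrictT _ mQ1).
  rewrite (_ : _ \_ Q1 = (g \_ Q) \o (fun t => (t, u))); last first.
    by apply/funext => t; rewrite /= slice_restrict indicE uQ mulr1.
  by apply: measurableT_comp; [exact/measurable_EFinP|exact: measurable_pair2].
under eq_integral do rewrite mulr1.
have igu := bounded_measurable_integrable mQ1 fin1 mgu.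
rewrite fineK; last exact: integrable_fin_num.
by rewrite [RHS]integral_mkcond restrict_EFin.
Qed.

Lemma Rintegral_product_le (g : T1 * T2 -> R) (B : R) : bounded_measurable Q g -> 0 <= B ->
  (forall t, Q1 t -> \int[m2]_(u in Q2) `|g (t, u)|%:E <= B%:E)%E ->
  `|\int[m12]_(z in Q) g z| <= fine (m1 Q1) * B.
Proof.
move=> bg B0 HB; have mh := restrict_measurable bg.
have ig := bounded_measurable_integrable measurable_rectangle product_measure_rectangle bg.
rewrite -lee_fin (EFin_normr_Rintegral measurable_rectangle ig).
apply: (le_trans (le_abse_integral _ measurable_rectangle (measurable_int _ ig))).
rewrite integral_mkcond.
have ma : measurable_fun setT (abse \o (EFin \o (g \_ Q))) by exact: measurableT_comp.
rewrite (_ : (fun z => _) = abse \o (EFin \o (g \_ Q))); last first.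
  by apply/funext => z; rewrite /patch /=; case: ifP => //; rewrite normr0.
rewrite (fubini_tonelli1 _ ma) /=; last by move=> z; rewrite lee_fin.
apply: (@le_trans _ _ (\int[m1]_t (B%:E * (\1_Q1 t)%:E))%E); last first.
  rewrite integralZl//; last first.
    apply/integrableP; split; first exact/measurable_EFinP/measurable_indic.
    under eq_integral do rewrite gee0_abs ?lee_fin//.
    by rewrite integral_indic// setIT.
  rewrite integral_indic// setIT mulrC EFinM fineK// ge0_fin_numE//.
apply: ge0_le_integral => //.
- by move=> t _; apply: integral_ge0 => u _; rewrite lee_fin.
- exact: (measurable_fun_fubini_tonelli_F _ ma (fun z => abse_ge0 _)).
- by apply/measurable_EFinP; apply: measurable_funM; [exact: measurable_cst|exact: measurable_indic].
move=> t _; rewrite /fubini_F /= indicE; have [tQ|tQ] := boolP (t \in Q1); last first.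
  rewrite mule0; apply: le_of_eq; apply: integral0_eq => u _.
  by rewrite slice_restrict /patch (negbTE tQ) mul0r normr0.
rewrite mule1; apply: le_trans (HB t (set_mem tQ)).
rewrite [leRHS]integral_mkcond; apply: le_of_eq.
apply: eq_integral => u _; rewrite slice_restrict /patch tQ indicE.
by case: ifP => _; rewrite ?mulr1 ?mulr0 ?normr0.
Qed.

End ProductIntegral.

(** * Inclusion of the weight sequence systems *)

Section Leibniz.
Context {R : realType} {n : nat}.
Local Notation V := 'rV[R]_n.
Local Notation mi := (multi_index n).
Implicit Types (f g : V -> R).

(** The rule is stated for an arbitrary additive family of bounds [P], since it is used for
pointwise bounds as well as for weighted norms. *)
Lemma Leibniz (P : R -> (V -> R) -> Prop) :
  (forall X Y f g, P X f -> P Y g -> P (X + Y) (f \+ g)) ->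
  forall s f g X, smooth f -> smooth g ->
  (forall s1 s2, perm_eq (s1 ++ s2) s -> P X (partials s1 f \* partials s2 g)) ->
  P (2 ^+ size s * X) (partials s (f \* g)).
Proof.
move=> PD; elim/last_ind => [|s i IH] f g X sf sg H.
  by rewrite expr0 mul1r; exact: (H [::] [::]).
have sf' := smooth_partial i sf; have sg' := smooth_partial i sg.
have -> : partials (rcons s i) (f \* g) =
    partials s (partial i f \* g) \+ partials s (f \* partial i g).
  rewrite partials_rcons -(partialsD s (smoothM sf' sg) (smoothM sf sg')); congr partials.
  by apply/funext => x; exact: (partialM (smooth_derivable i x sf) (smooth_derivable i x sg)).
rewrite size_rcons exprS -mulrA mulrDl mul1r; apply: PD.
- apply: (IH _ _ X sf' sg) => s1 s2 st; rewrite -partials_rcons; apply: H.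
  by rewrite -!cats1 -catA perm_catCA /= perm_sym perm_catC /= perm_cons perm_sym.
- apply: (IH _ _ X sf sg') => s1 s2 st; rewrite -partials_rcons; apply: H.
  by rewrite -!cats1 catA perm_cat2r.
Qed.

Definition deriv_bounded (M : mi -> R) (B : R) f : Prop :=
  smooth f /\ forall s x, `|partials s f x| <= B * M (mindex s).

Lemma deriv_bounded_shift M B f (a : V) : deriv_bounded M B f ->
  deriv_bounded M B (fun x => f (x + a)).
Proof.
by move=> [sf bf]; split=> [|s x]; [exact: smooth_shift|rewrite partials_shift].
Qed.

Lemma wave_deriv_bounded (M : mi -> R) xi th : is_weight_sequence M ->
  deriv_bounded M (assoc_fun M xi) (wave xi th).
Proof.
move=> wM; split=> [|s x]; first exact: smooth_wave.
have [th' ->] := partials_wave xi th s; rewrite normrM prod_list.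
apply: le_trans (mono_le_assoc wM _ _).
by rewrite ler_piMr// wave_le1.
Qed.

Variables (M1 M2 M3 : mi -> R) (C : R).
Hypotheses (M10 : forall al, 0 < M1 al) (M20 : forall al, 0 < M2 al).
Hypothesis M12 : forall al be, M1 al * M2 be * 2 ^+ deg (madd al be) <= C * M3 (madd al be).

Let bound s1 s2 s : perm_eq (s1 ++ s2) s ->
  M1 (mindex s1) * M2 (mindex s2) <= (2 ^+ size s)^-1 * (C * M3 (mindex s)).
Proof.
move=> st; rewrite [leRHS]mulrC ler_pdivlMr ?exprn_gt0// -(perm_mindex st) -(perm_size st).
by rewrite -deg_mindex mindex_cat.
Qed.

Let expK (X : R) (s : seq 'I_n) : 2 ^+ size s * (X * ((2 ^+ size s)^-1 * (C * M3 (mindex s)))) =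
  X * C * M3 (mindex s).
Proof. by field; rewrite expf_neq0. Qed.

Lemma deriv_boundedM B1 B2 f g : 0 <= B1 -> 0 <= B2 ->
  deriv_bounded M1 B1 f -> deriv_bounded M2 B2 g ->
  deriv_bounded M3 (B1 * B2 * C) (f \* g).
Proof.
move=> B10 B20 [sf bf] [sg bg]; split=> [|s x]; first exact: (smoothM sf sg).
rewrite -expK; apply: (@Leibniz (fun X h => `|h x| <= X)) => //.
  by move=> X Y h k hX kY; rewrite (le_trans (ler_normD _ _))// lerD.
move=> s1 s2 st /=; rewrite normrM (le_trans (ler_pM _ _ (bf s1 x) (bg s2 x)))//.
rewrite mulrACA; apply: ler_wpM2l; first exact: mulr_ge0.
exact: bound.
Qed.

Lemma rstepM (E : fspace R n) (w : V -> R) B1 B2 f g :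
  is_tibf_bounded_type E -> solid E -> continuous w -> 0 <= B1 ->
  deriv_bounded M1 B1 f -> smooth g -> rstep E M2 w B2 g ->
  rstep E M3 w (B1 * B2 * C) (f \* g).
Proof.
move=> HE solE cw B10 [sf bf] sg Hg s; have B20 := rstep_ge0 HE M20 Hg.
rewrite -expK.
apply: (@Leibniz (fun X h => RE E (fun x => h x * w x) /\ RN E (fun x => h x * w x) <= X)) => //.
  move=> X Y h k [Eh Nh] [Ek Nk]; have [Ehk Nhk] := RE_add HE Eh Ek.
  rewrite (_ : (fun x => _) = (fun x => h x * w x) \+ (fun x => k x * w x)); last first.
    by apply/funext => x /=; rewrite mulrDl.
  by split=> //; rewrite (le_trans Nhk)// lerD.
move=> s1 s2 st; have [E2 N2] := Hg s2.
have [|||E12 N12] := RE_le HE solE (h := fun x => (partials s1 f \* partials s2 g) x * w x)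
    (c := B1 * M1 (mindex s1)) E2.
- by rewrite mulr_ge0// ltW.
- apply: continuous_measurable => x; apply: (@continuousM _ _ (partials s1 f \* partials s2 g) w).
    exact: (smooth_continuous (smoothM (smooth_partials s1 sf) (smooth_partials s2 sg))).
  exact: cw.
- by move=> x /=; rewrite -mulrA normrM ler_wpM2r.
split=> //; apply: (le_trans N12).
apply: (@le_trans _ _ (B1 * M1 (mindex s1) * (B2 * M2 (mindex s2)))).
  by rewrite ler_wpM2l// mulr_ge0// ltW.
by rewrite mulrACA; apply: ler_wpM2l; [exact: mulr_ge0|exact: bound].
Qed.

End Leibniz.

Section SequenceInclusion.
Context {R : realType} {n : nat}.
Local Notation V := 'rV[R]_n.
Local Notation mi := (multi_index n).
Variables (c : limit_type) (E : fspace R n) (HE : is_tibf_bounded_type E) (solE : solid E).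
Variables (M : weight_sequence_system R n) (W : weight_function_system R n).
Variables (p : V -> R) (sp : smooth p) (Hp : rspace c E M W p).
Hypotheses (LM : cond_L c M) (IM : cond_I c M).

Let M0 l be : 0 < M l be. Proof. exact: ws_gt0. Qed.
Let cW := @wf_continuous R n.
Let W1 := @wf_ge1 R n.

Let frozen : quant c (fun lam nu : {posnum R} => exists m ka C, [/\
  exists B, rstep E (M ka) (W ka) B p, 0 < C, ka%:num <= lam%:num, ka%:num <= m%:num &
  forall al be, M nu al * M m be * 2 ^+ deg (madd al be) <= C * M lam (madd al be)]).
Proof.
apply: quant_impl (quant3_freeze Hp (I_L (ltr0n R 2) LM IM)) => lam nu.
move=> [l1 [m [ka [Bp [C C0 HC] kl km l1l]]]]; exists m, ka, C; split=> // al be.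
rewrite [M nu al * _]mulrC; have -> : madd al be = madd be al.
  by apply/ffunP => i; rewrite !ffunE addnC.
apply: (le_trans (HC be al)); apply: ler_wpM2l; first exact: ltW.
exact: ws_mono.
Qed.

(** The function [p] lives in a step whose index takes the place of one of the indices of [[I]],
and [[L]] absorbs the binomial factors of the rule of Leibniz. *)
Lemma multiplier_rstep : quant c (fun lam nu : {posnum R} => exists2 C : R, 0 < C &
  forall m B, 0 <= B -> deriv_bounded (M nu) B m ->
    rstep E (M lam) (W lam) (C * B) (m \* p)).
Proof.
apply: quant_impl frozen => lam nu [mu [ka [C [[B HB] C0 kl km HC]]]].
have B0 := rstep_ge0 HE (M0 ka) HB.
have HB1 : rstep E (M mu) (W lam) (B * 1 * 1) p.
  apply: (rstep_mono HE solE sp (M0 ka) ler01 (@cW W _) _ _ HB) => [x|al].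
    by rewrite mul1r (le_trans ler01)//=; exact: wf_anti.
  by rewrite mul1r; exact: ws_mono.
exists (B * C + 1) => [|m B' B'0 Hm]; first by rewrite ltr_wpDl// mulr_ge0// ltW.
have := rstepM (M0 nu) (M0 mu) HC HE solE (@cW W lam) B'0 Hm sp HB1.
apply: (rstep_le (M0 lam)); rewrite !mulr1 -mulrA mulrC.
by apply: ler_wpM2r => //; rewrite lerDl.
Qed.

Variables (r : R) (r0 : 0 < r).
Local Notation Q := (@cube R n r).
Local Notation mu := (@lebesgue_sf R n).

Let mQ : measurable Q := measurable_cube r.
Let finQ : (mu Q < +oo)%E. Proof. exact: lebesgue_cube_lty. Qed.

Definition smear : V -> R := fun x => \int[mu]_(t in Q) p (x + t).

Let smear_family : smooth_family Q (fun t x => p (x + t)).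
Proof. exact: (@smooth_family_shift _ _ _ _ Q p id r sp (@measurable_id _ _ _) (fun _ => id)). Qed.

Lemma smooth_smear : smooth smear.
Proof. exact: (smooth_integral mQ finQ smear_family). Qed.

(** Integrals over a cube are bounded by the norm of [E]: unlike [p], the function [smear] has
bounded derivatives, without loss in the weight sequence. *)
Lemma smear_bounded : exists2 C : R, 0 < C & forall l B, rstep E (M l) (W l) B p ->
  deriv_bounded (M l) (C * B) smear.
Proof.
have [C1 C10 H1] := RE_integral HE r; have [C2 C20 H2] := RE_shift HE.
exists (C1 * C2 + 1) => [|l B HB]; first by rewrite ltr_wpDl// mulr_ge0// ltW.
have B0 := rstep_ge0 HE (M0 l) HB.
split=> [|s x]; first exact: smooth_smear.
have [Es Ns] := rstep_unweighted HE solE s sp (W1 W l) HB.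
rewrite (partials_integral mQ finQ s x smear_family).
have Ei := bounded_measurable_integrable mQ finQ (smooth_family_dom s x smear_family).
rewrite -lee_fin (EFin_normr_Rintegral mQ Ei).
apply: (le_trans (le_abse_integral _ mQ (measurable_int _ Ei))).
rewrite (eq_integral (fun t : V => `|partials s p (t + x)|%:E)); last first.
  by move=> t _ /=; rewrite (partials_shift s t sp) addrC.
have [Ex Nx] := H2 x _ Es.
apply: (le_trans (H1 _ Ex)); rewrite lee_fin.
apply: (@le_trans _ _ (C1 * (C2 * (B * M l (mindex s))))).
  by apply: ler_wpM2l => //; apply: (le_trans Nx); apply: ler_wpM2l => //; exact: ltW.
rewrite !mulrA; apply: ler_wpM2r; first exact: ltW.
by apply: ler_wpM2r => //; rewrite lerDl.
Qed.

Lemma multiplier_smear : quant c (fun lam nu : {posnum R} => exists2 C : R, 0 < C &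
  forall m B t, 0 <= B -> deriv_bounded (M nu) B m ->
    deriv_bounded (M lam) (C * B) (m \* (fun x => smear (x + t)))).
Proof.
have [C1 C10 H1] := smear_bounded.
apply: quant_impl frozen => lam nu [m' [ka [C [[B HB] C0 kl km HC]]]].
have B0 := rstep_ge0 HE (M0 ka) HB.
have [ss bs] := H1 _ _ HB.
have HB1 : deriv_bounded (M m') (C1 * B) smear.
  split=> // s x; apply: (le_trans (bs s x)); apply: ler_wpM2l; last exact: ws_mono.
  by rewrite mulr_ge0// ltW.
exists (C1 * B * C + 1) => [|m B' t B'0 Hm].
  by rewrite ltr_wpDl// mulr_ge0 ?(ltW C0)// mulr_ge0// ltW.
have CB0 : 0 <= C1 * B by rewrite mulr_ge0// ltW.
have [sm bm] := deriv_boundedM HC B'0 CB0 Hm (deriv_bounded_shift t HB1).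
split=> // s x; apply: (le_trans (bm s x)); apply: ler_wpM2r; first exact: ltW.
by rewrite -mulrA mulrC; apply: ler_wpM2r => //; rewrite lerDl.
Qed.

(** The norm of these functions is of the order of the associated function at [i.1.1]; the
translates of [smear] serve to produce a nonnegative function by averaging. *)
Definition modulated (i : ('I_n -> R) * R * V) : V -> R :=
  (wave i.1.1 i.1.2 \* (fun x => smear (x + - i.2))) \* p.

Lemma smooth_modulated i : smooth (modulated i).
Proof.
apply: (smoothM _ sp); apply: smoothM; first exact: smooth_wave.
exact: (smooth_shift _ smooth_smear).
Qed.

Lemma modulated_family : quant c (fun lam nu : {posnum R} => exists2 C : R, 0 < C &
  forall i, rstep E (M lam) (W lam) (C * assoc_fun (M nu) i.1.1) (modulated i)).
Proof.
apply: quant_comp multiplier_rstep multiplier_smear => lam l nu [C C0 HC] [C' C'0 HC'].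
exists (C * C') => [|i]; first exact: mulr_gt0.
have a0 : 0 <= assoc_fun (M nu) i.1.1 by rewrite (le_trans ler01)// assoc_ge1//; exact: ws_weight.
rewrite -mulrA; apply: HC; first by rewrite mulr_ge0// ltW.
exact: (HC' _ _ _ a0 (wave_deriv_bounded _ _ (ws_weight M nu))).
Qed.

Local Notation mu2 := (mu \x mu)%E.
Local Notation Q2 := (Q `*` Q).

(** As [smear] is a convolution of [p] with an indicator function, integrating against [smear]
once more produces a square. *)
Definition square : V -> R := fun x =>
  \int[mu2]_(z in Q2) (p (x + (z.1 + z.2)) * smear (x + z.2)).

Let measurable_add : measurable_fun setT (fun z : V * V => z.1 + z.2).
Proof.
apply: measurable_fun_rV => i.
rewrite (_ : (fun t : V * V => _) = fun t : V * V => t.1 ord0 i + t.2 ord0 i); last first.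
  by apply/funext => y; rewrite mxE.
by apply: measurable_funD; apply: (measurableT_comp (measurable_coor i));
  [exact: measurable_fst|exact: measurable_snd].
Qed.

Let mQ2 : measurable Q2. Proof. exact: measurableX. Qed.
Let finQ2 : (mu2 Q2 < +oo)%E. Proof. exact: product_measure_rectangle. Qed.

Let square_family : smooth_family Q2 (fun z => (fun x => p (x + (z.1 + z.2))) \*
  (fun x => smear (x + z.2))).
Proof.
apply: smooth_familyM.
- apply: (@smooth_family_shift _ _ _ _ Q2 p (fun z => z.1 + z.2) (r + r) sp).
    exact: measurable_funTS measurable_add.
  by move=> [t u] [/= tQ uQ]; exact: cubeD.
- apply: (@smooth_family_shift _ _ _ _ Q2 smear (fun z => z.2) r smooth_smear).
    by apply: measurable_funTS; exact: measurable_snd.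
  by move=> [t u] [].
Qed.

Lemma smooth_square : smooth square.
Proof. exact: (smooth_integral mQ2 finQ2 square_family). Qed.

Lemma squareE x : square x = \int[mu]_(u in Q) (smear (x + u) * smear (x + u)).
Proof.
rewrite /square (Rintegral_slices mQ mQ finQ finQ); last first.
  exact: (smooth_family_dom [::] x square_family).
apply: eq_Rintegral => u _ /=; rewrite RintegralZr//.
  congr (_ * _); apply: eq_Rintegral => t _.
  by rewrite -addrA [t + u]addrC.
have := bounded_measurable_integrable mQ finQ (smooth_family_dom [::] (x + u) smear_family).
by congr (_.-integrable _ _); apply/funext => t /=; rewrite -addrA [t + u]addrC.
Qed.

Lemma square_ge0 x : 0 <= square x.
Proof. by rewrite squareE; apply: Rintegral_ge0 => u _; rewrite -expr2 sqr_ge0. Qed.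

Lemma Rintegral_cube_ge (g : V -> R) (a : R) : bounded_measurable Q g ->
  (forall t, Q t -> a <= g t) -> (2 * r) ^+ n * a <= \int[mu]_(t in Q) g t.
Proof.
move=> bg Hg.
have -> : (2 * r) ^+ n * a = \int[mu]_(t in Q) a.
  rewrite Rintegral_cst// mulrC; congr (_ * _).
  exact: (esym (congr1 fine (lebesgue_cube n (ltW r0)))).
apply: le_Rintegral => //; last exact: (bounded_measurable_integrable mQ finQ bg).
apply: (bounded_measurable_integrable mQ finQ); split; first exact: measurable_cst.
by exists `|a|.
Qed.

Lemma square_gt0 (a : R) : 0 < a -> (forall x, cube (3 * r) x -> a <= p x) ->
  exists2 b : R, 0 < b & forall x, cube r x -> b <= square x.
Proof.
move=> a0 pa; have q0 : 0 < (2 * r) ^+ n by rewrite exprn_gt0// mulr_gt0.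
exists ((2 * r) ^+ n * ((2 * r) ^+ n * a) ^+ 2); first by rewrite mulr_gt0// exprn_gt0// mulr_gt0.
have phi x u : Q x -> Q u -> (2 * r) ^+ n * a <= smear (x + u).
  move=> xQ uQ; apply: Rintegral_cube_ge; first exact: (smooth_family_dom [::] (x + u) smear_family).
  move=> t tQ; apply: pa; rewrite (_ : 3 * r = r + r + r); last by ring.
  by apply: cubeD => //; exact: cubeD.
have sm_fam : smooth_family Q (fun u x => smear (x + u)).
  exact: (@smooth_family_shift _ _ _ _ Q smear id r smooth_smear (@measurable_id _ _ _) (fun _ => id)).
move=> x xQ; rewrite squareE; apply: Rintegral_cube_ge.
  exact: (smooth_family_dom [::] x (smooth_familyM sm_fam sm_fam)).
move=> u uQ; rewrite -expr2 lerXn2r ?nnegrE//; first by rewrite mulr_ge0// ltW.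
  by apply: le_trans (phi x u xQ uQ); rewrite mulr_ge0// ltW.
exact: phi.
Qed.

Variables (N : weight_sequence_system R n) (Z : weight_function_system R n).
Hypothesis incl : gs_space c E M W `<=` gs_space c E N Z.

Lemma modulated_local_bound : quant c (fun lam nu : {posnum R} => exists2 C : R, 0 < C &
  forall i s y, local_norm E Z r lam s y (modulated i) <=
    C * assoc_fun (M nu) i.1.1 * N lam (mindex s)).
Proof.
apply: (@uniform_local_bound R n c E HE solE M N W Z incl _ modulated
  (fun nu i => assoc_fun (M nu) i.1.1) smooth_modulated _ _ r modulated_family) => [nu i|nu nu' i h].
  by rewrite (lt_le_trans ltr01)// assoc_ge1//; exact: ws_weight.
by apply: assoc_anti; [exact: ws_weight|exact: ws_weight|exact: ws_mono].
Qed.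

Lemma RE_modulated i s : RE E (partials s (modulated i)).
Proof.
have [lam [nu [C _ HC]]] : exists lam nu, exists2 C : R, 0 < C &
    forall i, rstep E (M lam) (W lam) (C * assoc_fun (M nu) i.1.1) (modulated i).
  have := modulated_family; case: (c) => /= /(_ 1%:pos) [m H]; by [exists 1%:pos, m|exists m, 1%:pos].
by have [] := rstep_unweighted HE solE s (smooth_modulated i) (W1 W lam) (HC i).
Qed.

Let measurable_modulated i s y :
  measurable_fun Q (fun u => `|partials s (modulated i) (y + u)|%:E).
Proof.
apply/measurable_EFinP; apply: measurable_funTS; apply: measurableT_comp => //.
under eq_fun do rewrite addrC.
rewrite -(partials_shift s y (smooth_modulated i)).
exact: (measurable_partials s (smooth_shift y (smooth_modulated i))).
Qed.

(** The norm of [E] controls integrals over cubes, and the weights are at least 1. *)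
Lemma integral_local_norm : exists2 C : R, 0 < C & forall lam s y i,
  (\int[mu]_(u in Q) `|partials s (modulated i) (y + u)|%:E <=
     (C * local_norm E Z r lam s y (modulated i))%:E)%E.
Proof.
have [C1 C10 H1] := RE_integral HE r; have [C2 C20 H2] := RE_shift HE.
exists (C1 * C2 + 1) => [|lam s y i]; first by rewrite ltr_wpDl// mulr_ge0// ltW.
have [C3 _ H3] := RE_cutoff_weight HE solE r y (@cW Z lam).
have [Ec _] := H3 _ (RE_modulated i s).
have [Es Ns] := H2 y _ Ec.
pose h := cutoff r y (fun x => partials s (modulated i) x * Z lam x).
apply: (@le_trans _ _ (\int[mu]_(u in Q) `|h (u + y)|%:E)%E); last first.
  apply: (le_trans (H1 _ Es)); rewrite lee_fin.
  apply: (@le_trans _ _ (C1 * (C2 * RN E h))); first by apply: ler_wpM2l.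
  by rewrite mulrA; apply: ler_wpM2r; [exact: RN_ge0|rewrite lerDl].
apply: ge0_le_integral => //.
- apply/measurable_EFinP; apply: measurable_funTS; apply: measurableT_comp => //.
  exact: (RE_measurable HE Es).
move=> u uQ; rewrite lee_fin /h /cutoff addrK indicE mem_set// mul1r normrM [y + u]addrC.
by rewrite ler_peMr// (le_trans (W1 Z lam (u + y)))// ler_norm.
Qed.

Lemma modulated_phase xi th b t : modulated (xi, th + b, t) =
  (fun x => cos b * modulated (xi, th, t) x) \+ (fun x => sin b * modulated (xi, th + pi / 2, t) x).
Proof. by apply/funext => x; rewrite /modulated /= wave_phase; ring. Qed.

Lemma partials_modulated_phase xi th b t s x : `|partials s (modulated (xi, th + b, t)) x| <=
  `|partials s (modulated (xi, th, t)) x| + `|partials s (modulated (xi, th + pi / 2, t)) x|.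
Proof.
have s1 := smooth_modulated (xi, th, t); have s2 := smooth_modulated (xi, th + pi / 2, t).
rewrite modulated_phase (partialsD s (smoothZ _ s1) (smoothZ _ s2)).
rewrite (partialsZ s _ s1) (partialsZ s _ s2) /= (le_trans (ler_normD _ _))// !normrM.
by apply: lerD; rewrite ler_piMl// ?cos_max ?sin_max.
Qed.

(** The product of a plane wave with [square] is an average of translates of test functions,
over a cube: its derivatives are bounded by local norms. *)
Lemma wave_bounded_square : exists2 C : R, 0 < C & forall lam xi (b : seq 'I_n -> R),
  (forall th t s y, local_norm E Z r lam s y (modulated (xi, th, t)) <= b s) ->
  wave_bounded xi square (fun s => C * b s).
Proof.
have [C C0 HC] := integral_local_norm.
have q0 : 0 <= fine (mu Q) by exact: fine_ge0.
exists (fine (mu Q) * (2 * C) + 1) => [|lam xi b Hb].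
  by rewrite ltr_wpDl// mulr_ge0// mulr_ge0// ltW.
split=> [|th s x]; first exact: smooth_square.
have b0 : 0 <= b s.
  apply: le_trans (Hb 0 0 s 0); apply: (RN_ge0 HE).
  have [C3 _ H3] := RE_cutoff_weight HE solE r 0 (@cW Z lam).
  by have [] := H3 _ (RE_modulated (xi, 0, 0) s).
have sw : smooth (wave xi th : V -> R) by exact: smooth_wave.
have fam := smooth_familyM (smooth_family_const Q2 sw) square_family.
have -> : wave xi th \* square = (fun x => \int[mu2]_(z in Q2)
    (wave xi th \* ((fun x => p (x + (z.1 + z.2))) \* (fun x => smear (x + z.2)))) x).
  apply/funext => y; rewrite [RHS]RintegralZl//.
  exact: (bounded_measurable_integrable mQ2 finQ2 (smooth_family_dom [::] y square_family)).
rewrite (partials_integral mQ2 finQ2 s x fam).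
apply: (@le_trans _ _ (fine (mu Q) * (2 * (C * b s)))); last first.
  by rewrite [2 * _]mulrA mulrA; apply: ler_wpM2r => //; rewrite lerDl.
apply: (Rintegral_product_le mQ mQ finQ finQ (smooth_family_dom s x fam)).
  by rewrite mulr_ge0// mulr_ge0// ltW.
move=> t tQ.
pose B u := `|partials s (modulated (xi, th, t)) (x + t + u)| +
  `|partials s (modulated (xi, th + pi / 2, t)) (x + t + u)|.
have mB th' := measurable_modulated (xi, th', t) s (x + t).
apply: (@le_trans _ _ (\int[mu]_(u in Q) (B u)%:E)%E); last first.
  under eq_integral do rewrite EFinD.
  rewrite ge0_integralD//.
  rewrite (_ : 2 * (C * b s) = C * b s + C * b s); last by ring.
  rewrite EFinD; apply: leeD; apply: (le_trans (HC lam s (x + t) _));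
    by rewrite lee_fin; apply: ler_wpM2l; [exact: ltW|exact: Hb].
apply: ge0_le_integral => //.
- apply/measurable_EFinP; apply: measurableT_comp => //.
  have [/(measurable_restrictT _ mQ2) m1 _] := smooth_family_dom s x fam.
  apply/(measurable_restrictT _ mQ).
  rewrite (_ : _ \_ Q = (fun z => ((fun z => partials s (wave xi th \* ((fun x => p (x + (z.1 + z.2))) \*
    (fun x => smear (x + z.2)))) x) \_ Q2) z) \o pair t); last first.
    by apply/funext => u; rewrite /patch /= in_setX /= (mem_set tQ).
  by apply: measurableT_comp => //; exact: measurable_pair1.
- by under eq_fun do rewrite EFinD; apply: emeasurable_funD.
move=> u uQ; rewrite lee_fin.
set a := t + u.
have -> : wave xi th \* ((fun x => p (x + a)) \* (fun x => smear (x + u))) =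
    (fun y => modulated (xi, th - \sum_i xi i * a ord0 i, t) (y + a)).
  apply/funext => y; rewrite /modulated /= wave_shift subrK /a.
  rewrite (_ : y + (t + u) - t = y + u); last by rewrite addrA addrAC addrK.
  by rewrite -mulrA [p _ * _]mulrC.
rewrite (partials_shift s a (smooth_modulated _)).
by rewrite /B -[x + t + u]addrA; exact: partials_modulated_phase.
Qed.

(** The averages of [square] are bounded below at the origin; comparing with the upper bound for
their products with waves of frequency [xi] gives [|xi^al| <= C A(xi) N_al], where [A] is the
associated function of [M].  At the exponential of a subgradient of [log M] at [al], the supremum
that defines [A] is attained at [al], whence the bound for [M_al]. *)
Lemma ws_incl_of_positive (a : R) : 0 < a -> (forall x, cube (3 * r) x -> a <= p x) ->
  log_convex M -> cond_L c N -> cond_wI c N -> ws_incl c M N.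
Proof.
move=> a0 pa lcM LN wN.
have [k k0 Hk] := square_gt0 a0 pa; have [D D0 HD] := wave_bounded_square.
(* [2 (1 + r)] comes from the upper bound of the averages, [r] from the lower bound *)
have K0 : 0 < 2 * (1 + r) / r by rewrite divr_gt0// mulr_gt0// ltr_wpDl.
have N0 l be : 0 < N l be by exact: ws_gt0.
apply: quant_comp (wI_L K0 LN wN) modulated_local_bound => l' l nu HN [C C0 HC].
have [C' C'0 HC'] := HN 1 ltr01.
have key xi al : `|mono xi al| <= D * C * C' / k * assoc_fun (M nu) xi * N l' al.
  rewrite -(mlistK al); set L := mlist al.
  have A0 : 0 <= assoc_fun (M nu) xi by rewrite (le_trans ler01)// assoc_ge1//; exact: ws_weight.
  have WB := HD l xi (fun s => C * assoc_fun (M nu) xi * N l (mindex s)) (fun th t s y => HC (xi, th, t) s y).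
  have [_ /(_ 0 [::] 0)] := wave_bounded_averages r0 L WB; rewrite /=.
  have -> : wave xi 0 (0 : V) = 1.
    by rewrite /wave big1 ?addr0 ?cos0// => i _; rewrite mxE mulr0.
  rewrite mul1r normrM prod_list => low.
  have [|_ /(_ 0)] := @axis_averages_ge R n r r0 L square k smooth_square (ltW k0) square_ge0.
    move=> x xr; apply: Hk => i; have /andP[h1 h2] := xr i; by rewrite ger0_norm.
  move=> /(_ (fun i => _)) ge.
  have {}ge : r ^+ size L * k <= axis_averages r L square 0.
    by apply: ge => i; rewrite mxE lexx ltW.
  have DCA0 := mulr_ge0 (mulr_ge0 (ltW D0) (ltW C0)) A0.
  have up : average_bound r (fun s => D * (C * assoc_fun (M nu) xi * N l (mindex s))) L [::] <=
      D * C * assoc_fun (M nu) xi * (2 * (1 + r)) ^+ size L *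
        (C' * N l' (mindex L) / (2 * (1 + r) / r) ^+ size L).
    apply: (average_bound_le r0 DCA0) => s1 s2 /= st.
    have -> : D * (C * assoc_fun (M nu) xi * N l (mindex s1)) =
      D * C * assoc_fun (M nu) xi * N l (mindex s1) by ring.
    apply: (ler_wpM2l DCA0).
    rewrite ler_pdivlMr ?exprn_gt0//.
    have := HC' (mindex s1) (mindex s2).
    by rewrite expr1n mulr1 -mindex_cat deg_mindex (perm_size st) (perm_mindex st).
  have := le_trans low up.
  set P := `|mono xi _| => {}low.
  have rL : 0 < r ^+ size L by rewrite exprn_gt0.
  have qL : 0 < (2 * (1 + r)) ^+ size L by rewrite exprn_gt0// mulr_gt0// ltr_wpDl// ltW.
  have {}low : P * (r ^+ size L * k) <= D * C * assoc_fun (M nu) xi * (2 * (1 + r)) ^+ size L *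
        (C' * N l' (mindex L) / (2 * (1 + r) / r) ^+ size L).
    apply: le_trans low; apply: ler_wpM2l; first exact: normr_ge0.
    by rewrite (le_trans ge)// ler_norm.
  rewrite -(ler_pM2r (mulr_gt0 rL k0)) (le_trans low)//; apply: le_of_eq.
  rewrite expr_div_n; field; by rewrite !gt_eqF.
exists (D * C * C' / k) => [|al]; first by rewrite divr_gt0// !mulr_gt0.
have [xi xi0 Hxi] := log_convex_subgradient al (ws_weight M nu) (lcM nu).
have m0 : 0 < mono xi al by rewrite /mono; apply: prodr_gt0 => i _; rewrite exprn_gt0.
have as1 : assoc_fun (M nu) xi <= mono xi al / M nu al.
  apply: assoc_le => be; rewrite (_ : (fun i => `|xi i|) = xi)//.
  by apply/funext => i; rewrite gtr0_norm.
have := key xi al; rewrite (gtr0_norm m0) => k1.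
have k2 : mono xi al <= D * C * C' / k * (mono xi al / M nu al) * N l' al.
  apply: (le_trans k1); apply: ler_wpM2r; first exact: ltW.
  by apply: ler_wpM2l => //; rewrite divr_ge0 ?mulr_ge0// ltW.
rewrite -(ler_pM2l (divr_gt0 m0 (M0 nu al))) divfK ?gt_eqF//.
by rewrite (le_trans k2)//; apply: le_of_eq; ring.
Qed.

End SequenceInclusion.

(** * Linearity and monotonicity of the spaces *)

Section Spaces.
Context {R : realType} {n : nat}.
Local Notation V := 'rV[R]_n.
Local Notation mi := (multi_index n).
Variables (E : fspace R n) (HE : is_tibf_bounded_type E) (solE : solid E).
Implicit Types (f g : V -> R[i]) (w v : V -> R) (M N : mi -> R).

Lemma gs_stepP M w f : (forall be, 0 < M be) -> gs_step E M w f <->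
  csmooth f /\ exists B, forall al, E (wderiv w al f) /\ fnorm E (wderiv w al f) <= B * M al.
Proof.
move=> M0; split=> [[sf Ef fin]|[sf [B HB]]].
  have [B HB] := gs_norm_ge [ffun=> 0%N] M0 fin.
  by split=> //; exists B => al; split.
split=> // [al|]; first exact: (HB al).1.
apply: (@le_lt_trans _ _ B%:E); last exact: ltry.
by apply: ge_ereal_sup => _ [al _ <-]; rewrite lee_fin ler_pdivrMr//; exact: (HB al).2.
Qed.

Lemma csmoothD f g : csmooth f -> csmooth g -> csmooth (f \+ g).
Proof.
move=> [f1 f2] [g1 g2]; split.
  rewrite (_ : Repart _ = Repart f \+ Repart g); first exact: smoothD.
  by apply/funext => x; rewrite /Repart /= raddfD.
rewrite (_ : Impart _ = Impart f \+ Impart g); first exact: smoothD.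
by apply/funext => x; rewrite /Impart /= raddfD.
Qed.

Let ReZ (a : R[i]) f : Repart (fun x => a * f x) =
  (fun x => complex.Re a * Repart f x) \- (fun x => complex.Im a * Impart f x).
Proof. by apply/funext => x; rewrite /Repart /Impart /=; case: a; case: (f x). Qed.

Let ImZ (a : R[i]) f : Impart (fun x => a * f x) =
  (fun x => complex.Re a * Impart f x) \+ (fun x => complex.Im a * Repart f x).
Proof. by apply/funext => x; rewrite /Repart /Impart /=; case: a; case: (f x). Qed.

Lemma csmoothZ (a : R[i]) f : csmooth f -> csmooth (fun x => a * f x).
Proof.
move=> [f1 f2]; split; rewrite ?ReZ ?ImZ.
  exact: (smoothB (smoothZ _ f1) (smoothZ _ f2)).
exact: (smoothD (smoothZ _ f2) (smoothZ _ f1)).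
Qed.

Lemma wderivD w al f g : csmooth f -> csmooth g ->
  wderiv w al (f \+ g) = wderiv w al f \+ wderiv w al g.
Proof.
move=> [f1 f2] [g1 g2]; apply/funext => x; rewrite /wderiv /cderiv /= -mulrDl; congr (_ * _).
have -> : Repart (f \+ g) = Repart f \+ Repart g.
  by apply/funext => y; rewrite /Repart /= raddfD.
have -> : Impart (f \+ g) = Impart f \+ Impart g.
  by apply/funext => y; rewrite /Impart /= raddfD.
by rewrite /mderiv (partialsD _ f1 g1) (partialsD _ f2 g2).
Qed.

Lemma wderivZ w al (a : R[i]) f : csmooth f ->
  wderiv w al (fun x => a * f x) = (fun x => a * wderiv w al f x).
Proof.
move=> [f1 f2]; apply/funext => x; rewrite /wderiv /cderiv mulrA; congr (_ * _).
rewrite ReZ ImZ /mderiv (partialsB _ (smoothZ _ f1) (smoothZ _ f2)).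
rewrite (partialsD _ (smoothZ _ f2) (smoothZ _ f1)).
rewrite (partialsZ _ _ f1) (partialsZ _ _ f2) (partialsZ _ _ f1) (partialsZ _ _ f2).
by case: a.
Qed.

Lemma gs_stepD M w f g : (forall be, 0 < M be) ->
  gs_step E M w f -> gs_step E M w g -> gs_step E M w (f \+ g).
Proof.
move=> M0 /(gs_stepP _ _ M0)[sf [B HB]] /(gs_stepP _ _ M0)[sg [C HC]].
apply/(gs_stepP _ _ M0); split; first exact: csmoothD.
exists (B + C) => al; have [Ef Nf] := HB al; have [Eg Ng] := HC al.
rewrite (wderivD w al sf sg); split; first exact: (tibf_add HE Ef Eg).
by rewrite (le_trans (tibf_norm_add HE Ef Eg))// mulrDl lerD.
Qed.

Lemma gs_stepZ M w (a : R[i]) f : (forall be, 0 < M be) ->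
  gs_step E M w f -> gs_step E M w (fun x => a * f x).
Proof.
move=> M0 /(gs_stepP _ _ M0)[sf [B HB]]; apply/(gs_stepP _ _ M0); split; first exact: csmoothZ.
exists (normc a * B) => al; have [Ef Nf] := HB al.
rewrite (wderivZ w al a sf); split; first exact: (tibf_scale HE a Ef).
by rewrite (tibf_norm_scale HE a Ef) -mulrA ler_wpM2l// normc_ge0.
Qed.

Let Re_wderiv w al f : Repart (wderiv w al f) = fun x => mderiv al (Repart f) x * w x.
Proof. by apply/funext => x; rewrite /wderiv /cderiv /Repart /= mulr0 subr0. Qed.

Let Im_wderiv w al f : Impart (wderiv w al f) = fun x => mderiv al (Impart f) x * w x.
Proof. by apply/funext => x; rewrite /wderiv /cderiv /Impart /= mulr0 add0r. Qed.

(** As [E] is solid, a domination of the weights is inherited by the norms of all derivatives. *)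
Lemma gs_step_mono M N w v (C1 C2 : R) : (forall be, 0 < M be) -> (forall be, 0 < N be) ->
  0 < C1 -> 0 < C2 -> continuous v -> (forall x, 0 <= v x <= C2 * w x) ->
  (forall al, M al <= C1 * N al) -> forall f, gs_step E M w f ->
  gs_step E N v f /\
  forall e : R, (gs_norm E M w f < e%:E -> gs_norm E N v f < (C1 * C2 * e)%:E)%E.
Proof.
move=> M0 N0 C10 C20 cv vw MN f Hf; have /(gs_stepP _ _ M0)[sf _] := Hf.
have [_ Ef _] := Hf; have C120 : 0 < C1 * C2 by exact: mulr_gt0.
have ms h al : smooth h -> measurable_fun setT (fun x => mderiv al h x * v x).
  move=> sh; apply: measurable_funM; last exact: continuous_measurable.
  exact: measurable_partials.
have dom al : E (wderiv v al f) /\ fnorm E (wderiv v al f) <= C2 * fnorm E (wderiv w al f).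
  apply: (E_dominated HE solE (Ef al) (ltW C20)).
  - by rewrite Re_wderiv; exact: ms sf.1.
  - by rewrite Im_wderiv; exact: ms sf.2.
  move=> x; rewrite /wderiv !normcM !normc_real mulrCA.
  apply: ler_wpM2l; first exact: normc_ge0.
  have /andP[v0 vx] := vw x; rewrite ger0_norm// (le_trans vx)//.
  by apply: ler_wpM2l; [exact: ltW|exact: ler_norm].
have bound al S : fnorm E (wderiv w al f) <= S * M al ->
    fnorm E (wderiv v al f) <= C1 * C2 * S * N al.
  move=> fS; have F0 := fnorm_ge0 HE (Ef al).
  have S0 : 0 <= S by rewrite -(pmulr_lge0 _ (M0 al)) (le_trans F0).
  apply: (le_trans (dom al).2); apply: (@le_trans _ _ (C2 * (S * (C1 * N al)))).
    apply: ler_wpM2l; first exact: ltW.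
    by apply: (le_trans fS); apply: ler_wpM2l.
  by apply: le_of_eq; ring.
split=> [|e fe].
  have /(gs_stepP _ _ M0)[_ [B HB]] := Hf; apply/(gs_stepP _ _ N0); split=> //.
  by exists (C1 * C2 * B) => al; split; [exact: (dom al).1|exact: bound (HB al).2].
have ub al : ((fnorm E (wderiv w al f) / M al)%:E <= gs_norm E M w f)%E.
  by apply: ereal_sup_ubound; exists al.
have ub0 := ub [ffun=> 0%N].
move: fe ub0 ub; case: (gs_norm E M w f) => // S Se _ ub.
apply: (@le_lt_trans _ _ (C1 * C2 * S)%:E); last by rewrite lte_fin ltr_pM2l// -lte_fin.
apply: ge_ereal_sup => _ [al _ <-]; rewrite lee_fin ler_pdivrMr//; apply: bound.
by rewrite -ler_pdivrMr// -lee_fin.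
Qed.

Variables (c : limit_type).

Lemma quant_and (P Q : {posnum R} -> {posnum R} -> Prop) :
  (forall l l' m m', l%:num <= l'%:num -> m'%:num <= m%:num -> P l m -> P l' m') ->
  (forall l l' m m', l%:num <= l'%:num -> m'%:num <= m%:num -> Q l m -> Q l' m') ->
  quant c P -> quant c Q -> quant c (fun l m => P l m /\ Q l m).
Proof.
move=> mP mQ; case: c => /= HP HQ l.
  have [m Pm] := HP l; have [k Qk] := HQ l.
  have m0 : 0 < Num.min m%:num k%:num by rewrite lt_min !gt0.
  exists (PosNum m0); split; [apply: mP Pm|apply: mQ Qk] => //=; by rewrite ge_min lexx ?orbT.
have [m Pm] := HP l; have [k Qk] := HQ l.
have m0 : 0 < Num.max m%:num k%:num by rewrite lt_max gt0.
exists (PosNum m0); split; [apply: mP Pm|apply: mQ Qk] => //=; by rewrite le_max lexx ?orbT.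
Qed.

Variables (M : weight_sequence_system R n) (W : weight_function_system R n).

Let W0 S l x := ltW (@wf_gt0 R n S l x).
Let cW := @wf_continuous R n.

Lemma gs_step_up (l l' : {posnum R}) f : l%:num <= l'%:num ->
  gs_step E (M l) (W l) f -> gs_step E (M l') (W l') f.
Proof.
move=> ll; have M0 k be : 0 < M k be by exact: ws_gt0.
have H x : 0 <= W l' x <= 1 * W l x by rewrite mul1r W0 /=; exact: wf_anti.
have H' al : M l al <= 1 * M l' al by rewrite mul1r; exact: ws_mono.
move=> Hf.
exact: (gs_step_mono (M0 l) (M0 l') ltr01 ltr01 (@cW W l') H H' Hf).1.
Qed.

Lemma gs_space0 : gs_space c E M W (cst 0).
Proof.
have H l : gs_step E (M l) (W l) (cst 0).
  have M0 be : 0 < M l be by exact: ws_gt0.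
  have s0 : csmooth (cst 0 : V -> R[i]) by split; exact: (smooth_cst 0).
  have H0 al : wderiv (W l) al (cst 0) = cst 0.
    apply/funext => x; rewrite /wderiv /cderiv /mderiv.
    have -> : Repart (cst 0 : V -> R[i]) = cst 0 by [].
    have -> : Impart (cst 0 : V -> R[i]) = cst 0 by [].
    by rewrite partials_cst0 /= mul0r.
  apply/(gs_stepP _ _ M0); split=> //; exists 0 => al; rewrite H0 mul0r.
  split; first exact: (tibf_0 HE).
  have := tibf_norm_scale HE 0 (tibf_0 HE); rewrite normc0 mul0r.
  rewrite (_ : (fun x => 0 * cst 0 x) = cst 0 :> (V -> R[i])); last first.
    by apply/funext => x; rewrite mul0r.
  by move=> ->.
by rewrite /gs_space; case: c => //=; exists 1%:pos.
Qed.

Lemma gs_space_lin (a b : R[i]) f g : gs_space c E M W f -> gs_space c E M W g ->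
  gs_space c E M W (fun x => a * f x + b * g x).
Proof.
have lin l : gs_step E (M l) (W l) f -> gs_step E (M l) (W l) g ->
    gs_step E (M l) (W l) (fun x => a * f x + b * g x).
  have M0 be : 0 < M l be by exact: ws_gt0.
  by move=> Hf Hg; exact: (gs_stepD M0 (gs_stepZ a M0 Hf) (gs_stepZ b M0 Hg)).
rewrite /gs_space; case: c => /= [Hf Hg l|[l Hf] [l' Hg]]; first exact: lin.
have m0 : 0 < Num.max l%:num l'%:num by rewrite lt_max gt0.
exists (PosNum m0); apply: lin; [apply: gs_step_up Hf|apply: gs_step_up Hg] => /=;
  by rewrite le_max lexx ?orbT.
Qed.

Lemma gs_spaceD f g : gs_space c E M W f -> gs_space c E M W g -> gs_space c E M W (f \+ g).
Proof.
move=> Hf Hg; have := gs_space_lin 1 1 Hf Hg.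
by rewrite (_ : (fun x => _) = f \+ g)//; apply/funext => x; rewrite !mul1r.
Qed.

Variables (N : weight_sequence_system R n) (Z : weight_function_system R n).

Lemma step_inclusion : ws_incl c M N -> wf_incl c W Z ->
  quant c (fun lam nu : {posnum R} => exists2 C : R, 0 < C &
    forall f, gs_step E (M nu) (W nu) f -> gs_step E (N lam) (Z lam) f /\
    forall e : R, (gs_norm E (M nu) (W nu) f < e%:E ->
      gs_norm E (N lam) (Z lam) f < (C * e)%:E)%E).
Proof.
move=> MN WZ; apply: quant_impl (quant_and _ _ MN WZ) => [l m [[C1 C10 H1] [C2 C20 H2]]||].
- exists (C1 * C2); first exact: mulr_gt0.
  apply: (gs_step_mono _ _ C10 C20 (@cW Z l)) => //; try by move=> be; exact: ws_gt0.
  by move=> x; rewrite W0 H2.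
- move=> l l' m m' ll mm [C C0 H]; exists C => // al.
  apply: (le_trans (ws_mono M mm al)); apply: (le_trans (H al)); apply: ler_wpM2l; first exact: ltW.
  exact: ws_mono.
- move=> l l' m m' ll mm [C C0 H]; exists C => // x.
  apply: (le_trans (wf_anti Z ll x)); apply: (le_trans (H x)); apply: ler_wpM2l; first exact: ltW.
  exact: wf_anti.
Qed.

Hypotheses (MN : ws_incl c M N) (WZ : wf_incl c W Z).

Lemma gs_space_sub : gs_space c E M W `<=` gs_space c E N Z.
Proof.
move=> f; have := step_inclusion MN WZ; rewrite /gs_space; case: c => /= H.
  by move=> Hf l; have [m [C _ HC]] := H l; exact: (HC f (Hf m)).1.
by move=> [m Hf]; have [l [C _ HC]] := H m; exists l; exact: (HC f Hf).1.
Qed.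

(** In the Beurling case finitely many steps are estimated with a common constant; in the
Roumieu case the trace itself is absolutely convex and a neighbourhood in each step. *)
Lemma basic_nbhs0_trace U : basic_nbhs0 c E N Z U ->
  exists2 U', basic_nbhs0 c E M W U' & U' `<=` gs_space c E M W `&` U.
Proof.
have := step_inclusion MN WZ; have := gs_space_sub; have := gs_space_lin; have := gs_space0.
rewrite /basic_nbhs0; case: c => /= h0 hlin hsub H.
  move=> [s [e [e0 ->]]].
  have /choice[m Hm] : forall l, exists p : {posnum R} * {posnum R},
      forall f, gs_step E (M p.1) (W p.1) f ->
      forall e : R, (gs_norm E (M p.1) (W p.1) f < e%:E ->
        gs_norm E (N l) (Z l) f < (p.2%:num * e)%:E)%E.
    by move=> l; have [m [C C0 HC]] := H l; exists (m, PosNum C0) => f /HC[].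
  pose K := 1 + \sum_(l <- s) (m l).2%:num.
  have K0 : 0 < K by rewrite ltr_wpDr// sumr_ge0.
  pose U' := [set f | gs_space Beurling E M W f /\
    forall l, l \in [seq (m l).1 | l <- s] -> (gs_norm E (M l) (W l) f < (e / K)%:E)%E].
  exists U'; first by exists [seq (m l).1 | l <- s], (e / K); split=> //; exact: divr_gt0.
  move=> f [Hf Hs]; split=> //; split; first exact: hsub.
  move=> l ls; have := Hm l f (Hf _) (e / K) (Hs _ (map_f _ ls)).
  move/lt_le_trans; apply; rewrite lee_fin mulrCA ger_pMr// ler_pdivrMr// mul1r.
  rewrite /K (big_rem l)//= addrCA lerDl addr_ge0//; apply: sumr_ge0 => *; exact: ltW.
move=> [Us [U0 Ulin] Ue]; exists (gs_space Roumieu E M W `&` U) => //; split.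
- by move=> f [].
- split; first by split.
  by move=> a b f g ab [Hf Uf] [Hg Ug]; split; [exact: hlin|exact: Ulin].
move=> m; have [l [C C0 HC]] := H m; have [e e0 He] := Ue l.
exists (e / C) => [|f Hf fe]; first exact: divr_gt0.
split; first by exists m.
have [Hl Hn] := HC f Hf; apply: He => //.
by have := Hn _ fe; rewrite mulrC divfK// gt_eqF.
Qed.

Lemma inclusion_continuous : continuous_inclusion c E M N W Z.
Proof.
move=> O [Os HO]; split=> [f []//|f [Hf Of]].
have [U bU UO] := HO f Of; have [U' bU' U'U] := basic_nbhs0_trace bU.
exists U' => // g /U'U[Hg Ug]; split; [exact: gs_spaceD|exact: UO].
Qed.

End Spaces.

Theorem theorem3p3 (R : realType) (n : nat) (c : limit_type) (E : fspace R n)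
    (M N : weight_sequence_system R n) (W V : weight_function_system R n) :
  (0 < n)%N ->
  is_tibf_bounded_type E -> solid E ->
  log_convex M -> cond_L c M -> cond_I c M ->
  cond_L c N -> cond_wI c N ->
  cond_M c W -> cond_wM c V ->
  (exists2 f, gs_space c E M W f & f <> cst 0) ->
  [<-> ws_incl c M N /\ wf_incl c W V;
       gs_space c E M W `<=` gs_space c E N V;
       gs_space c E M W `<=` gs_space c E N V /\ continuous_inclusion c E M N W V].
Proof.
move=> _ HE solE lcM LM IM LN wIN MW wMV [f Hf f0].
have hard : gs_space c E M W `<=` gs_space c E N V -> ws_incl c M N /\ wf_incl c W V.
  move=> incl; have [p [sp Hp p0]] := positive_test_function HE solE MW Hf f0.
  split; last exact: (wf_incl_of_subset HE solE sp Hp p0 MW wMV incl).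
  have [e /andP[e0 _] He] := positive_near sp p0 ltr01.
  have r0 : 0 < e / 3 by exact: divr_gt0.
  have a0 : 0 < p 0 / 2 by exact: divr_gt0.
  apply: (ws_incl_of_positive HE solE sp Hp LM IM r0 incl a0 _ lcM LN wIN) => x.
  by rewrite mulrC divfK//; exact: He.
tfae.
- by move=> [MN WV]; exact: gs_space_sub.
- move=> incl; split=> //; have [MN WV] := hard incl; exact: inclusion_continuous.
- by move=> [incl _]; exact: hard.
Qed.
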